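(* Let $G\in L^\infty_{q\times p}$ and assume the Hankel operator $H:H^2_p\to K^2_q$, $Hf=P_-(Gf)$, satisfies: (C1) $H$ has finite rank; (C2) no maximizing vector of $H$ belongs to $SH^2_p$, and the linear span of the maximizing vectors of $H$ has dimension $p$. Let $\gamma=\|H\|$, $\Delta=\gamma^2I_{\mathcal X}-ZWW^*Z^*$ and $\Xi=\gamma^2I_{\mathcal X}-WW^*$. Then $\Delta$ is invertible and the Nehari problem for $G$ has a unique optimal solution $F\in H^\infty_{q\times p}$. This solution is $F=G_+-\Phi_+$, where $G_+$ is the analytic part of $G$ and $\Phi_+$ is the rational $q\times p$ matrix-valued $H^\infty$ function $\Phi_+(\lambda)=N(\lambda)M(\lambda)^{-1}$ with $N(\lambda)=-\Pi HW^*(I_{\mathcal X}-\lambda Z^* )^{-1}Z^*\Delta^{-1}WE$, $M(\lambda)=I+\lambda E^*W^*(I_{\mathcal X}-\lambda Z^* )^{-1}Z^*\Delta^{-1}WE$. Furthermore $r_{\mathrm{spec}}(Z^*\Delta^{-1}\Xi)<1$, and for $|\lambda|\le1$ the inverse of $M(\lambda)$ is $M(\lambda)^{-1}=I-\lambda E^*W^*(I_{\mathcal X}-\lambda Z^*\Delta^{-1}\Xi)^{-1}Z^*\Delta^{-1}WE$.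
   Context: $L^2_{q\times p},H^2,L^\infty,H^\infty$ spaces of $q\times p$ matrix functions on the unit circle; $K^2=L^2\ominus H^2$; analytic part $G_+\in H^2_{q\times p}$ and co-analytic part $G_-\in K^2_{q\times p}$ with $G=G_++G_-$. $P_-$: orthogonal projection of $L^2_q$ onto $K^2_q$; $S$ forward shift on $H^2_p$; $V$ multiplication by $e^{it}$ on $L^2_q$, $V_-=P_-V|_{K^2_q}$. $\mathcal X=\overline{\operatorname{Im}H}$, $Z=V_-|_{\mathcal X}$, $W:H^2_p\to\mathcal X$, $Wf=Hf$. $E:\mathbb C^p\to H^2_p$ maps $u$ to the constant function $u$; $\Pi:K^2_q\to\mathbb C^q$, $\Pi f=\frac1{2\pi}\int_0^{2\pi}e^{it}f(e^{it})dt$. A maximizing vector of $H$ is a nonzero $h$ with $\|Hh\|=\|H\|\,\|h\|$. The Nehari problem: minimize $\|G-F\|_\infty$ over $F\in H^\infty_{q\times p}$; minimizers are optimal solutions. *)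

(* Defs.v *)
(* MathComp + MathComp-Analysis (R : realType), complex numbers R[i]
   from mathcomp-real-closed.  Functions on the unit circle are represented as
   functions of the angle t, restricted to [0, 2 pi]; t |-> f t stands for
   e^{it} |-> f(e^{it}).  L^2-classes are handled via representatives and
   equality almost everywhere (aeq). *)
From HB Require Import structures.
From mathcomp Require Import all_boot all_order all_algebra.
From mathcomp Require Import all_classical all_reals all_analysis.
From mathcomp Require Import complex.
Set Implicit Arguments.
Unset Strict Implicit.
Unset Printing Implicit Defensive.
Import Order.TTheory GRing.Theory Num.Theory.
Local Open Scope classical_set_scope.
Local Open Scope ring_scope.

Definition pickd {T : Type} (d : T) (P : T -> Prop) : T :=
  match pselect (exists x, P x) with
  | left h => proj1_sig (cid h)
  | right _ => d
  end.

Definition cexpi {R : realType} (t : R) : R[i] := Complex (cos t) (sin t).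
Definition rC {R : realType} (x : R) : R[i] := Complex x 0.
Definition cabs {R : realType} (z : R[i]) : R :=
  Num.sqrt (complex.Re z ^+ 2 + complex.Im z ^+ 2).

Definition circ {R : realType} : set R := `[0, pi *+ 2]%classic.

Notation mfun R m n := (R -> 'M[R[i]]_(m, n)).

Definition mxsq {R : realType} {m n : nat} (A : 'M[R[i]]_(m, n)) : R :=
  \sum_(i < m) \sum_(j < n) (complex.Re (A i j) ^+ 2 + complex.Im (A i j) ^+ 2).

Definition mxnorm {R : realType} {m n : nat} (A : 'M[R[i]]_(m, n)) : R :=
  sup [set Num.sqrt (mxsq (A *m v)) | v in [set v : 'cV[R[i]]_n | mxsq v <= 1]].

Definition fmeas {R : realType} {m n : nat} (f : mfun R m n) : Prop :=
  forall i j, measurable_fun circ (fun t => complex.Re (f t i j)) /\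
              measurable_fun circ (fun t => complex.Im (f t i j)).

Definition aeq {R : realType} {m n : nat} (f g : mfun R m n) : Prop :=
  {ae (@lebesgue_measure R), forall t, circ t -> f t = g t}.

Definition zf {R : realType} {m n : nat} : mfun R m n := fun _ => 0.

Definition L2 {R : realType} {m n : nat} (f : mfun R m n) : Prop :=
  fmeas f /\
  (\int[@lebesgue_measure R]_(t in circ) (mxsq (f t))%:E < +oo)%E.

Definition l2norm {R : realType} {m n : nat} (f : mfun R m n) : R :=
  Num.sqrt (fine (\int[@lebesgue_measure R]_(t in circ) (mxsq (f t))%:E)
            / (pi *+ 2)).

Definition cint {R : realType} (f : R -> R[i]) : R[i] :=
  Complex (Rintegral (@lebesgue_measure R) circ (fun t => complex.Re (f t)))
          (Rintegral (@lebesgue_measure R) circ (fun t => complex.Im (f t))).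
Definition mcint {R : realType} {m n : nat} (f : mfun R m n) : 'M[R[i]]_(m, n) :=
  \matrix_(i, j) cint (fun t => f t i j).

Definition fc {R : realType} {m n : nat} (f : mfun R m n) (k : int) :
  'M[R[i]]_(m, n) :=
  rC (pi *+ 2)^-1 *: mcint (fun t => cexpi (- (k%:~R * t)) *: f t).

Definition H2 {R : realType} {m n : nat} (f : mfun R m n) : Prop :=
  L2 f /\ forall k : int, k < 0 -> fc f k = 0.
Definition K2 {R : realType} {m n : nat} (f : mfun R m n) : Prop :=
  L2 f /\ forall k : int, 0 <= k -> fc f k = 0.

Definition Linf {R : realType} {m n : nat} (A : mfun R m n) : Prop :=
  fmeas A /\ exists M : R,
    {ae (@lebesgue_measure R), forall t, circ t -> mxnorm (A t) <= M}.
Definition linf_norm {R : realType} {m n : nat} (A : mfun R m n) : R :=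
  inf [set M : R |
    {ae (@lebesgue_measure R), forall t, circ t -> mxnorm (A t) <= M}].
Definition HInf {R : realType} {m n : nat} (A : mfun R m n) : Prop :=
  Linf A /\ forall k : int, k < 0 -> fc A k = 0.

Definition analytic_part {R : realType} {m n : nat} (G Gp : mfun R m n) : Prop :=
  H2 Gp /\ K2 (fun t => G t - Gp t).

Definition nehari_optimal {R : realType} {m n : nat} (G F : mfun R m n) : Prop :=
  HInf F /\ forall F', HInf F' ->
    linf_norm (fun t => G t - F t) <= linf_norm (fun t => G t - F' t).

Definition inner {R : realType} {m : nat} (f g : mfun R m 1) : R[i] :=
  rC (pi *+ 2)^-1 * cint (fun t => \sum_(i < m) f t i 0 * conjc (g t i 0)).
Definition cinner {R : realType} {m : nat} (u v : 'cV[R[i]]_m) : R[i] :=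
  \sum_(i < m) u i 0 * conjc (v i 0).

(* P_- : L^2_q -> K^2_q, orthogonal projection (L^2 = H^2 (+) K^2) *)
Definition Pminus {R : realType} {q : nat} (u : mfun R q 1) : mfun R q 1 :=
  pickd zf (fun g => K2 g /\ H2 (fun t => u t - g t)).

Definition Hank {R : realType} {q p : nat} (G : mfun R q p) (f : mfun R p 1) :
  mfun R q 1 := Pminus (fun t => G t *m f t).

Definition Vmul {R : realType} {m : nat} (f : mfun R m 1) : mfun R m 1 :=
  fun t => cexpi t *: f t.
Definition Vminus {R : realType} {q : nat} (x : mfun R q 1) : mfun R q 1 :=
  Pminus (Vmul x).

Definition Econst {R : realType} {p : nat} (u : 'cV[R[i]]_p) : mfun R p 1 :=
  fun _ => u.
Definition Pi {R : realType} {q : nat} (f : mfun R q 1) : 'cV[R[i]]_q :=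
  rC (pi *+ 2)^-1 *: mcint (fun t => cexpi t *: f t).

Definition lincomb {R : realType} {m k : nat} (c : 'I_k -> R[i])
  (b : 'I_k -> mfun R m 1) : mfun R m 1 := fun t => \sum_(i < k) c i *: b i t.
Definition in_span {R : realType} {m : nat} (S : set (mfun R m 1))
  (f : mfun R m 1) : Prop :=
  exists k (c : 'I_k -> R[i]) (b : 'I_k -> mfun R m 1),
    (forall i, S (b i)) /\ aeq f (lincomb c b).
Definition span_dim {R : realType} {m : nat} (S : set (mfun R m 1)) (d : nat) :
  Prop :=
  exists b : 'I_d -> mfun R m 1,
    (forall i, in_span S (b i)) /\
    (forall c : 'I_d -> R[i], aeq (lincomb c b) zf -> forall i, c i = 0) /\
    (forall f, in_span S f -> exists c : 'I_d -> R[i], aeq f (lincomb c b)).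

Definition finite_rank {R : realType} {q p : nat} (G : mfun R q p) : Prop :=
  exists k (b : 'I_k -> mfun R q 1),
    forall f, H2 f -> exists c : 'I_k -> R[i], aeq (Hank G f) (lincomb c b).

Definition hnorm {R : realType} {q p : nat} (G : mfun R q p) : R :=
  sup [set l2norm (Hank G f) | f in [set f | H2 f /\ l2norm f <= 1]].

Definition maxvec {R : realType} {q p : nat} (G : mfun R q p) (h : mfun R p 1) :
  Prop := H2 h /\ ~ aeq h zf /\ l2norm (Hank G h) = hnorm G * l2norm h.

Definition SH2 {R : realType} {p : nat} (h : mfun R p 1) : Prop :=
  exists f, H2 f /\ aeq h (Vmul f).

Definition Xsp {R : realType} {q p : nat} (G : mfun R q p) : set (mfun R q 1) :=
  [set x | L2 x /\ forall e : R, 0 < e ->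
     exists f, H2 f /\ l2norm (fun t => x t - Hank G f t) < e].

Definition adj {R : realType} {a b : nat} (dom : set (mfun R a 1))
  (T : mfun R a 1 -> mfun R b 1) (y : mfun R b 1) : mfun R a 1 :=
  pickd zf (fun x => dom x /\ forall u, dom u -> inner (T u) y = inner u x).

Definition opinv {R : realType} {m : nat} (X : set (mfun R m 1))
  (A : mfun R m 1 -> mfun R m 1) (y : mfun R m 1) : mfun R m 1 :=
  pickd zf (fun x => X x /\ aeq (A x) y).

Definition invertible_on {R : realType} {m : nat} (X : set (mfun R m 1))
  (A : mfun R m 1 -> mfun R m 1) : Prop :=
  (forall y, X y -> exists x, X x /\ aeq (A x) y) /\
  (forall x, X x -> aeq (A x) zf -> aeq x zf).

Definition spec {R : realType} {m : nat} (X : set (mfun R m 1))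
  (A : mfun R m 1 -> mfun R m 1) : set R[i] :=
  [set mu | ~ invertible_on X (fun x t => mu *: x t - A x t)].
Definition rspec {R : realType} {m : nat} (X : set (mfun R m 1))
  (A : mfun R m 1 -> mfun R m 1) : R := sup (cabs @` spec X A).

Definition Wop {R : realType} {q p : nat} (G : mfun R q p) := Hank G.
Definition Wst {R : realType} {q p : nat} (G : mfun R q p) :=
  adj H2 (Wop G).
Definition Zop {R : realType} {q p : nat} (G : mfun R q p) :
  mfun R q 1 -> mfun R q 1 := @Vminus R q.
Definition Zst {R : realType} {q p : nat} (G : mfun R q p) :=
  adj (Xsp G) (Zop G).
Definition Estar {R : realType} {p : nat} (h : mfun R p 1) : 'cV[R[i]]_p :=
  pickd 0 (fun u => forall v, inner (Econst v) h = cinner v u).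

Definition Delta {R : realType} {q p : nat} (G : mfun R q p) (x : mfun R q 1) :
  mfun R q 1 := fun t =>
  rC (hnorm G ^+ 2) *: x t - Zop G (Wop G (Wst G (Zst G x))) t.
Definition Xi {R : realType} {q p : nat} (G : mfun R q p) (x : mfun R q 1) :
  mfun R q 1 := fun t =>
  rC (hnorm G ^+ 2) *: x t - Wop G (Wst G x) t.
Definition Dinv {R : realType} {q p : nat} (G : mfun R q p) :=
  opinv (Xsp G) (Delta G).

Definition chainN {R : realType} {q p : nat} (G : mfun R q p) (lam : R[i])
  (u : 'cV[R[i]]_p) : mfun R q 1 :=
  opinv (Xsp G) (fun x t => x t - lam *: Zst G x t)
        (Zst G (Dinv G (Wop G (Econst u)))).

Definition unitv {R : realType} {p : nat} (j : 'I_p) : 'cV[R[i]]_p :=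
  delta_mx j 0.

Definition Nfun {R : realType} {q p : nat} (G : mfun R q p) (lam : R[i]) :
  'M[R[i]]_(q, p) :=
  - \matrix_(i < q, j < p) Pi (Hank G (Wst G (chainN G lam (unitv j)))) i 0.

Definition Mfun {R : realType} {q p : nat} (G : mfun R q p) (lam : R[i]) :
  'M[R[i]]_p :=
  1%:M + lam *: \matrix_(i < p, j < p) Estar (Wst G (chainN G lam (unitv j))) i 0.

Definition Phiplus {R : realType} {q p : nat} (G : mfun R q p) (lam : R[i]) :
  'M[R[i]]_(q, p) := Nfun G lam *m invmx (Mfun G lam).

Definition Minv_formula {R : realType} {q p : nat} (G : mfun R q p) (lam : R[i]) :
  'M[R[i]]_p :=
  1%:M - lam *: \matrix_(i < p, j < p)
    Estar (Wst G (opinv (Xsp G) (fun x t => x t - lam *: Zst G (Dinv G (Xi G x)) t)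
                        (Zst G (Dinv G (Wop G (Econst (unitv j))))))) i 0.

(* Main.v *)
(* Let X be the range of H.  Since H has finite rank, an orthonormal basis of X
   turns Z, WE, Pi and WW^* into matrices A, B, C, Q with
     Q = A Q A^* + B B^*,   A^* A + C^* C = 1,   A without eigenvalues outside the
   open unit disc.  The maximizing vectors of H correspond to the kernel of
   gamma^2 - Q, which by (C2) has dimension p; moreover (C2) makes
   Delta = gamma^2 - A Q A^* injective and Y = Delta^-1 B satisfies Q Y = gamma^2 Y
   and B^* Y = 1.  Hence M(z) = B^* (1 - z A^* )^-1 Y is, column by column, a basis of
   maximizing vectors, and with T = Z^* Delta^-1 Xi the formulas for M^-1 and N M^-1
   are identities of rational matrix functions.  On the circle
     Phi = G_- + Phi_+ = gamma^2 C (z - A)^-1 Y M(z)^-1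
   satisfies Phi^* Phi = gamma^2, so that F = G - Phi attains the lower bound gamma of
   the Nehari problem.  If F' is another optimal solution, then for every maximizing
   vector h the function (G - F') h has norm at most ||H h|| and P_- of it is H h, so
   (G - F') h = H h; thus (G - F') M = Phi M and F' = F. *)
Require Import Defs.
From HB Require Import structures.
From mathcomp Require Import all_boot all_order all_algebra.
From mathcomp Require Import all_classical all_reals all_analysis.
From mathcomp Require Import measurable_realfun complex ring lra zify.
(* [measurable_realfun] exports a notation [mfun], which would shadow the one of [Defs]. *)
Import Defs.
Import Order.TTheory GRing.Theory Num.Theory.
Import numFieldNormedType.Exports.
Set Implicit Arguments.
Unset Strict Implicit.
Unset Printing Implicit Defensive.
Local Open Scope classical_set_scope.
Local Open Scope ring_scope.

(** The operators of the statement are choices among representatives: [Pminus], [adj], [opinv] and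
    [Estar] return a default value when nothing fits. Each of them is therefore computed in two
    moves, the existence of a candidate and its uniqueness up to null sets, after which matrices
    carry all the algebra. The analysis rests on two facts about L^2: it is complete, and a function
    whose Fourier coefficients all vanish is zero almost everywhere.

    Analyticity is read throughout as the vanishing of the Fourier coefficients of negative index.
    No holomorphic function on the disc occurs; (1 - zT)^-1 is placed in H^\infty by a boundedness
    argument and Cayley-Hamilton.

    The dimension in (C2) has to be exactly p because it makes a certain matrix B^* K square, so
    that its injectivity is invertibility; this yields the explicit form of Delta^-1 B. The lower
    bound gamma comes from the fact that P_- annihilates F f for F in H^\infty and f in H^2. *)

Ltac sq_tac := repeat match goal with
  | |- context [complex.Re ?x] => let a := fresh "a" in set a := complex.Re x; clearbody a
  | |- context [complex.Im ?x] => let a := fresh "a" in set a := complex.Im x; clearbody a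
  end; nra.

Lemma norm_dot_le (F : realFieldType) (a b c d : F) :
  `|a * c + b * d| <= a ^+ 2 + b ^+ 2 + (c ^+ 2 + d ^+ 2).
Proof.
rewrite ler_norml; apply/andP; split;
 move: (sqr_ge0 (a - c)) (sqr_ge0 (b - d)) (sqr_ge0 (a + c)) (sqr_ge0 (b + d));
 move: (sqr_ge0 a) (sqr_ge0 b) (sqr_ge0 c) (sqr_ge0 d); nra.
Qed.

#[global] Arguments conjc : simpl never.
#[global] Arguments cint : simpl never.
#[global] Arguments inner : simpl never.

(** * Complex-valued functions on the circle *)
Section scalar_functions.
Variable R : realType.
Local Notation C := R[i].
Local Notation mu := (@lebesgue_measure R).
Implicit Types (f g : R -> C) (t : R) (z : C).

(** Real-valued, unlike the norm of [R[i]], and convertible to the summand of [mxsq]. *)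
Definition nsq z : R := complex.Re z ^+ 2 + complex.Im z ^+ 2.
Definition rint (h : R -> R) := mu.-integrable circ (EFin \o h).
Definition cmeas f := measurable_fun circ (fun t => complex.Re (f t)) /\
                      measurable_fun circ (fun t => complex.Im (f t)).
Definition cL1 f := rint (fun t => complex.Re (f t)) /\
                    rint (fun t => complex.Im (f t)).
Definition cL2 f := cmeas f /\ rint (fun t => nsq (f t)).

Lemma cReD (x y : C) : complex.Re (x + y) = complex.Re x + complex.Re y.
Proof. by case: x; case: y. Qed.
Lemma cImD (x y : C) : complex.Im (x + y) = complex.Im x + complex.Im y.
Proof. by case: x; case: y. Qed.
Lemma cReN (x : C) : complex.Re (- x) = - complex.Re x.
Proof. by case: x. Qed.
Lemma cImN (x : C) : complex.Im (- x) = - complex.Im x.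
Proof. by case: x. Qed.
Lemma cReM (x y : C) : complex.Re (x * y) =
  complex.Re x * complex.Re y - complex.Im x * complex.Im y.
Proof. by case: x; case: y. Qed.
Lemma cImM (x y : C) : complex.Im (x * y) =
  complex.Re x * complex.Im y + complex.Im x * complex.Re y.
Proof. by case: x => a b; case: y => c d. Qed.
Lemma cReJ (x : C) : complex.Re (conjc x) = complex.Re x.
Proof. by case: x. Qed.
Lemma cImJ (x : C) : complex.Im (conjc x) = - complex.Im x.
Proof. by case: x. Qed.
Lemma Re_rC (x : R) : complex.Re (rC x) = x. Proof. by []. Qed.
Lemma Im_rC (x : R) : complex.Im (rC x) = 0. Proof. by []. Qed.
Lemma conjc_rC (x : R) : conjc (rC x) = rC x.
Proof. by rewrite /conjc /= oppr0. Qed.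
Lemma conjcM (x y : C) : conjc (x * y) = conjc x * conjc y.
Proof. exact: rmorphM. Qed.
Lemma conjcD (x y : C) : conjc (x + y) = conjc x + conjc y.
Proof. exact: rmorphD. Qed.
Lemma conjcN (x : C) : conjc (- x) = - conjc x.
Proof. exact: rmorphN. Qed.
Lemma conjc_sum (I : Type) (r : seq I) (P : pred I) (F : I -> C) :
  conjc (\sum_(i <- r | P i) F i) = \sum_(i <- r | P i) conjc (F i).
Proof. exact: rmorph_sum. Qed.
Lemma cRe_rCM (x : R) (z : C) : complex.Re (rC x * z) = x * complex.Re z.
Proof. by rewrite cReM Re_rC Im_rC mul0r subr0. Qed.
Definition cRI := (cReD, cImD, cReN, cImN, cReM, cImM, cReJ, cImJ).

Lemma Re_sum (I : Type) (r : seq I) (P : pred I) (F : I -> C) :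
  complex.Re (\sum_(i <- r | P i) F i) = \sum_(i <- r | P i) complex.Re (F i).
Proof. by apply: (big_morph _ cReD). Qed.
Lemma Im_sum (I : Type) (r : seq I) (P : pred I) (F : I -> C) :
  complex.Im (\sum_(i <- r | P i) F i) = \sum_(i <- r | P i) complex.Im (F i).
Proof. by apply: (big_morph _ cImD). Qed.

Lemma complex_ext (x y : C) : complex.Re x = complex.Re y ->
  complex.Im x = complex.Im y -> x = y.
Proof. by case: x; case: y => a b c d /= -> ->. Qed.

Lemma nsq_ge0 z : 0 <= nsq z.
Proof. by rewrite addr_ge0 ?sqr_ge0. Qed.
Lemma nsqM (x y : C) : nsq (x * y) = nsq x * nsq y.
Proof. by rewrite /nsq !cRI; ring. Qed.
Lemma nsqJ z : nsq (conjc z) = nsq z.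
Proof. by rewrite /nsq !cRI sqrrN. Qed.
Lemma nsqN z : nsq (- z) = nsq z.
Proof. by rewrite /nsq !cRI !sqrrN. Qed.
Lemma nsqD (x y : C) : nsq (x + y) <= 2 * nsq x + 2 * nsq y.
Proof.
rewrite /nsq !cRI; set a := complex.Re x; set b := complex.Im x.
set c := complex.Re y; set d := complex.Im y.
have := sqr_ge0 (a - c); have := sqr_ge0 (b - d); rewrite !expr2; lra.
Qed.
Lemma mulCJ z : z * conjc z = rC (nsq z).
Proof. by apply: complex_ext; rewrite /nsq !cRI /=; ring. Qed.
Lemma nsq_eq0 z : nsq z = 0 -> z = 0.
Proof.
move=> /eqP; rewrite /nsq paddr_eq0 ?sqr_ge0// !sqrf_eq0 => /andP[/eqP a /eqP b].
exact: complex_ext.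
Qed.

Lemma measurable_circ : measurable (@circ R).
Proof. exact: measurable_itv. Qed.

(* The measurable structure carried by [lebesgue_measure] and the default one on
   [R] have convertible sigma-algebras but distinct displays. *)
Lemma mcirc : measurable (circ : set (measurableTypeR R)).
Proof. exact: measurable_circ. Qed.

Lemma circ_fin : (mu circ < +oo)%E.
Proof.
rewrite /circ lebesgue_measure_itv /=; case: ifP => // _.
by rewrite -EFinB ltry.
Qed.
Hint Resolve measurable_circ mcirc circ_fin : core.

Lemma mu_circ : mu circ = (pi *+ 2)%:E.
Proof.
rewrite /circ lebesgue_measure_itv /= lte_fin.
by rewrite mulrn_wgt0 ?pi_gt0// oppr0 adde0.
Qed.

Lemma rint_meas (h : R -> R) : rint h -> measurable_fun circ h.
Proof. by move/measurable_int/measurable_EFinP. Qed.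

Lemma rintD (g h : R -> R) : rint g -> rint h -> rint (fun t => g t + h t).
Proof.
by move=> ig ih; have := integrableD mcirc ig ih. Qed.

Lemma rintB (g h : R -> R) : rint g -> rint h -> rint (fun t => g t - h t).
Proof. by move=> ig ih; have := integrableB mcirc ig ih. Qed.

Lemma rintZ (c : R) (h : R -> R) : rint h -> rint (fun t => c * h t).
Proof. by move=> ih; have := integrableZl mcirc c ih. Qed.

Lemma rint_le (g h : R -> R) : measurable_fun circ g -> rint h ->
  (forall t, circ t -> `|g t| <= h t) -> rint g.
Proof.
move=> mg ih gh; apply: le_integrable ih => //; first exact/measurable_EFinP.
move=> t ct /=; rewrite lee_fin; apply: le_trans (gh t ct) _; exact: ler_norm.
Qed.

Lemma rint_cst (c : R) : rint (fun=> c).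
Proof.
apply: (measurable_bounded_integrable (f := fun=> c)) => //.
exists `|c|; split; first exact: num_real.
by move=> M cM t _ /=; exact: ltW.
Qed.

Lemma cmeas_cst z : cmeas (fun=> z).
Proof. by split; exact: measurable_cst. Qed.
Lemma cmeasD f g : cmeas f -> cmeas g -> cmeas (fun t => f t + g t).
Proof.
move=> [f1 f2] [g1 g2]; split; under eq_fun do rewrite !cRI; exact: measurable_funD.
Qed.
Lemma cmeasM f g : cmeas f -> cmeas g -> cmeas (fun t => f t * g t).
Proof.
move=> [f1 f2] [g1 g2]; split; under eq_fun do rewrite !cRI.
  by apply: measurable_funB; exact: measurable_funM.
by apply: measurable_funD; exact: measurable_funM.
Qed.
Lemma cmeasJ f : cmeas f -> cmeas (fun t => conjc (f t)).
Proof.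
move=> [f1 f2]; split; first by under eq_fun do rewrite !cRI.
by under eq_fun do rewrite !cRI; exact: measurableT_comp.
Qed.
Lemma cmeas_nsq f : cmeas f -> measurable_fun circ (fun t => nsq (f t)).
Proof.
by move=> [f1 f2]; apply: measurable_funD; exact: measurable_funX.
Qed.
Lemma cmeas_rC (h : R -> R) : measurable_fun circ h -> cmeas (fun t => rC (h t)).
Proof. by move=> mh; split => //=; exact: measurable_cst. Qed.

Lemma cmeas_cexpi (a : R) : cmeas (fun t => cexpi (a * t)).
Proof.
have m : measurable_fun circ (fun t : R => a * t) by exact: measurable_funM.
split => /=.
- apply: (@measurableT_comp _ _ _ _ _ _ cos) => //.
  by apply: continuous_measurable_fun; exact: continuous_cos.
- apply: (@measurableT_comp _ _ _ _ _ _ sin) => //.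
  by apply: continuous_measurable_fun; exact: continuous_sin.
Qed.

Lemma cL1_meas f : cL1 f -> cmeas f.
Proof. by move=> [f1 f2]; split; exact: rint_meas. Qed.
Lemma cL1D f g : cL1 f -> cL1 g -> cL1 (fun t => f t + g t).
Proof. by move=> [f1 f2] [g1 g2]; split; under eq_fun do rewrite !cRI; exact: rintD. Qed.
Lemma cL1Z z f : cL1 f -> cL1 (fun t => z * f t).
Proof.
move=> [f1 f2]; split; under eq_fun do rewrite !cRI.
  by apply: rintB; exact: rintZ.
by apply: rintD; exact: rintZ.
Qed.
Lemma cL1_0 : cL1 (fun=> 0).
Proof. by split; exact: rint_cst. Qed.
Lemma cL1_sum (I : Type) (r : seq I) (F : I -> R -> C) :
  (forall i, cL1 (F i)) -> cL1 (fun t => \sum_(i <- r) F i t).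
Proof.
move=> mF; elim: r => [|i r IH].
  by under eq_fun do rewrite big_nil; exact: cL1_0.
by under eq_fun do rewrite big_cons; exact: cL1D.
Qed.
Lemma cL1_le f (h : R -> R) : cmeas f -> rint h ->
  (forall t, circ t -> `|complex.Re (f t)| <= h t) ->
  (forall t, circ t -> `|complex.Im (f t)| <= h t) -> cL1 f.
Proof. by move=> [f1 f2] ih h1 h2; split; exact: rint_le ih _. Qed.

Lemma cintD f g : cL1 f -> cL1 g ->
  cint (fun t => f t + g t) = cint f + cint g.
Proof.
move=> [f1 f2] [g1 g2]; apply: complex_ext; rewrite !cRI /=.
  by under eq_Rintegral do rewrite !cRI; rewrite RintegralD.
by under eq_Rintegral do rewrite !cRI; rewrite RintegralD.
Qed.
Lemma cintZ z f : cL1 f -> cint (fun t => z * f t) = z * cint f.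
Proof.
move=> [f1 f2]; apply: complex_ext; rewrite !cRI /=.
  under eq_Rintegral do rewrite !cRI.
  by rewrite RintegralB ?RintegralZl//; exact: rintZ.
under eq_Rintegral do rewrite !cRI.
by rewrite RintegralD ?RintegralZl//; exact: rintZ.
Qed.
Lemma cintJ f : cL1 f -> cint (fun t => conjc (f t)) = conjc (cint f).
Proof.
move=> [f1 f2]; apply: complex_ext; rewrite !cRI /=.
  by under eq_Rintegral do rewrite !cRI.
under eq_Rintegral do rewrite !cRI -mulN1r.
by rewrite RintegralZl// mulN1r.
Qed.
Lemma cint0 : cint (fun=> 0 : C) = 0.
Proof.
by apply: complex_ext => /=; rewrite Rintegral_cst // mul0r.
Qed.
Lemma cint_sum (I : Type) (r : seq I) (F : I -> R -> C) :
  (forall i, cL1 (F i)) ->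
  cint (fun t => \sum_(i <- r) F i t) = \sum_(i <- r) cint (F i).
Proof.
move=> mF; elim: r => [|i r IH].
  by under eq_fun do rewrite big_nil; rewrite big_nil cint0.
under eq_fun do rewrite big_cons; rewrite big_cons cintD// ?IH//.
exact: cL1_sum.
Qed.

(** Unfolds to the shape of [aeq], so that the lemmas on [aeC] apply to [aeq] by conversion. *)
Definition aeC (P : R -> Prop) := {ae mu, forall t, circ t -> P t}.

Lemma aeC_imp (P Q : R -> Prop) :
  (forall t, circ t -> P t -> Q t) -> aeC P -> aeC Q.
Proof.
have F := @ae_filter_ringOfSetsType _ (measurableTypeR R) R mu.
move=> PQ; apply: (@filterS _ _ F).
by move=> t Pt ct; exact: PQ (Pt ct).
Qed.
Lemma aeC_and (P Q : R -> Prop) : aeC P -> aeC Q -> aeC (fun t => P t /\ Q t).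
Proof.
have F := @ae_filter_ringOfSetsType _ (measurableTypeR R) R mu.
apply: (@filterS2 _ _ F).
by move=> t Pt Qt ct; split; [exact: Pt|exact: Qt].
Qed.
Lemma aeC_imp2 (P Q S : R -> Prop) :
  (forall t, circ t -> P t -> Q t -> S t) -> aeC P -> aeC Q -> aeC S.
Proof.
move=> PQS P' Q'; apply: aeC_imp (aeC_and P' Q') => t ct [].
exact: PQS.
Qed.
Lemma aeC_all (P : R -> Prop) : (forall t, circ t -> P t) -> aeC P.
Proof. by move=> h; apply: aeW => t ct; exact: h. Qed.
Lemma aeC_forall (I : finType) (P : I -> R -> Prop) :
  (forall i, aeC (P i)) -> aeC (fun t => forall i, P i t).
Proof.
move=> h; suff : aeC (fun t => forall i, i \in enum I -> P i t).
  by apply: aeC_imp => t _ H i; apply: H; rewrite mem_enum.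
elim: (enum I) => [|i r IH]; first exact: aeC_all.
apply: aeC_imp2 IH (h i) => t _ IH hi j; rewrite inE => /orP[/eqP ->//|].
exact: IH.
Qed.

Lemma ae_eq_cint f g : cmeas f -> cmeas g ->
  {ae mu, forall t, circ t -> f t = g t} -> cint f = cint g.
Proof.
move=> [f1 f2] [g1 g2] fg; apply: complex_ext => /=; congr fine;
 apply: ae_eq_integral => //; do ?[exact/measurable_EFinP];
 by apply: aeC_imp fg => t _ ->.
Qed.

Lemma cL2M f g : cL2 f -> cL2 g -> cL1 (fun t => f t * conjc (g t)).
Proof.
move=> [mf f2] [mg g2].
apply: (cL1_le _ (rintD f2 g2)).
- by apply: cmeasM => //; exact: cmeasJ.
- move=> t _; rewrite !cRI mulrN opprK; exact: norm_dot_le.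
- move=> t _; rewrite !cRI /nsq (addrC (complex.Re (g t) ^+ 2)).
  rewrite -[X in _ <= _ + (X + _)]sqrrN; exact: norm_dot_le.
Qed.

Lemma cL2_le f (h : R -> R) : cmeas f -> rint h ->
  (forall t, circ t -> nsq (f t) <= h t) -> cL2 f.
Proof.
move=> mf ih fh; split=> //; apply: rint_le ih _; first exact: cmeas_nsq.
by move=> t ct; rewrite ger0_norm ?nsq_ge0 ?fh.
Qed.
Lemma cL2D f g : cL2 f -> cL2 g -> cL2 (fun t => f t + g t).
Proof.
move=> [mf f2] [mg g2]; apply: (cL2_le (cmeasD mf mg) (rintD (rintZ 2 f2) (rintZ 2 g2))).
by move=> t _; exact: nsqD.
Qed.
Lemma cL2Mb f g (K : R) : cmeas g -> (forall t, circ t -> nsq (g t) <= K) -> cL2 f ->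
  cL2 (fun t => g t * f t).
Proof.
move=> mg gK [mf f2]; apply: (cL2_le (cmeasM mg mf) (rintZ K f2)) => t ct.
by rewrite nsqM ler_wpM2r ?nsq_ge0 ?gK.
Qed.
Lemma cL2_cst z : cL2 (fun=> z).
Proof. by apply: (cL2_le (cmeas_cst z) (rint_cst (nsq z))). Qed.
Lemma cL2Z z f : cL2 f -> cL2 (fun t => z * f t).
Proof. by apply: (@cL2Mb f (fun=> z) (nsq z)) => //; exact: cmeas_cst. Qed.
Lemma cL2_sum (I : Type) (r : seq I) (F : I -> R -> C) :
  (forall i, cL2 (F i)) -> cL2 (fun t => \sum_(i <- r) F i t).
Proof.
move=> mF; elim: r => [|i r IH].
  by under eq_fun do rewrite big_nil; exact: cL2_cst.
by under eq_fun do rewrite big_cons; exact: cL2D.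
Qed.
Lemma cL2_L1 f : cL2 f -> cL1 f.
Proof.
move=> [mf f2]; apply: (cL1_le mf (rintD (rint_cst 1) f2)) => t _;
 by rewrite /nsq ler_norml; apply/andP; split; sq_tac.
Qed.
Lemma cL2_ae f g : cmeas g -> {ae mu, forall t, circ t -> nsq (g t) <= nsq (f t)} ->
  cL2 f -> cL2 g.
Proof.
move=> mg fg [mf f2]; split => //; apply/integrableP; split.
  by apply/measurable_EFinP; exact: cmeas_nsq.
move/integrableP: f2 => [m2]; apply: le_lt_trans.
apply: ae_ge0_le_integral => //.
- by apply: measurableT_comp => //; apply/measurable_EFinP; exact: cmeas_nsq.
- by apply: measurableT_comp => //; apply/measurable_EFinP; exact: cmeas_nsq.
apply: aeC_imp fg => t _ h /=.
by rewrite lee_fin !ger0_norm ?nsq_ge0.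
Qed.

Lemma cexpiD (a b : R) : cexpi (a + b) = cexpi a * cexpi b.
Proof.
by apply: complex_ext; rewrite !cRI /= ?cosD ?sinD // [RHS]addrC.
Qed.
Lemma cexpi0 : cexpi (0 : R) = 1.
Proof. by rewrite /cexpi cos0 sin0. Qed.
Lemma cexpiJ (a : R) : conjc (cexpi a) = cexpi (- a).
Proof. by rewrite /cexpi cosN sinN. Qed.
Lemma nsq_cexpi (a : R) : nsq (cexpi a) = 1.
Proof. by rewrite /nsq /= cos2Dsin2. Qed.
Lemma cexpi_neq0 (a : R) : cexpi a != 0.
Proof.
apply/eqP => h; have := nsq_cexpi a; rewrite h /nsq /= expr0n addr0 => /eqP.
by rewrite eq_sym oner_eq0.
Qed.
Lemma cexpiV (a : R) : (cexpi a)^-1 = cexpi (- a).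
Proof.
apply: (mulfI (cexpi_neq0 a)); rewrite mulfV ?cexpi_neq0//.
by rewrite -cexpiD subrr cexpi0.
Qed.
Lemma cexpi_pi2 : cexpi (pi *+ 2 : R) = 1.
Proof. by rewrite /cexpi cos2pi sin2pi. Qed.
Lemma cexpiM (k : int) (a : R) : cexpi (k%:~R * a) = cexpi a ^ k.
Proof.
have nat n : cexpi (n%:R * a) = cexpi a ^+ n.
  elim: n => [|n IH]; first by rewrite mul0r cexpi0.
  by rewrite exprS -natr1 mulrDl mul1r addrC cexpiD IH.
case: k => n; first exact: nat.
by rewrite NegzE -exprnN mulrNz mulNr -cexpiV nat.
Qed.

End scalar_functions.
#[global] Hint Resolve measurable_circ mcirc circ_fin : core.

(** * Square integrable matrix functions *)
Section matrix_functions.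
Variable R : realType.
Local Notation C := R[i].
Local Notation mu := (@lebesgue_measure R).

Lemma mxsqE m n (A : 'M[C]_(m, n)) : mxsq A = \sum_i \sum_j nsq (A i j).
Proof. by []. Qed.
Lemma mxsq_ge0 m n (A : 'M[C]_(m, n)) : 0 <= mxsq A.
Proof. by apply: sumr_ge0 => i _; apply: sumr_ge0 => j _; exact: nsq_ge0. Qed.
Lemma nsq_le_mxsq m n (A : 'M[C]_(m, n)) i j : nsq (A i j) <= mxsq A.
Proof.
rewrite mxsqE (bigD1 i)//= (bigD1 j)//= -addrA lerDl addr_ge0//.
  by apply: sumr_ge0 => ? _; exact: nsq_ge0.
by apply: sumr_ge0 => ? _; apply: sumr_ge0 => ? _; exact: nsq_ge0.
Qed.
Lemma mxsq_eq0 m n (A : 'M[C]_(m, n)) : mxsq A = 0 -> A = 0.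
Proof.
move=> h; apply/matrixP => i j; rewrite mxE; apply: nsq_eq0; apply/eqP.
by rewrite eq_le nsq_ge0 andbT -h nsq_le_mxsq.
Qed.

Lemma mxsq_meas m n (f : mfun R m n) : fmeas f ->
  measurable_fun circ (fun t => mxsq (f t)).
Proof.
move=> mf; apply: (@measurable_sum _ _ _ _ _ _ (fun i t => \sum_j nsq (f t i j))) => i.
apply: (@measurable_sum _ _ _ _ _ _ (fun j t => nsq (f t i j))) => j.
exact: cmeas_nsq.
Qed.

Lemma L2_rint m n (f : mfun R m n) : L2 f -> rint (fun t => mxsq (f t)).
Proof.
move=> [mf f2]; apply/integrableP; split.
  by apply/measurable_EFinP; exact: mxsq_meas.
apply: le_lt_trans f2; apply: ge0_le_integral => //=.
- exact: mcirc.
- by apply/measurable_EFinP; apply: measurableT_comp => //; exact: mxsq_meas.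
- by apply/measurable_EFinP; exact: mxsq_meas.
- by move=> t _; rewrite lee_fin ger0_norm ?mxsq_ge0.
Qed.

Lemma L2P m n (f : mfun R m n) : L2 f <-> forall i j, cL2 (fun t => f t i j).
Proof.
split=> [Lf i j|h].
  have [mf _] := Lf; apply: (cL2_le _ (L2_rint Lf)); first exact: mf.
  by move=> t _; exact: nsq_le_mxsq.
split; first by move=> i j; case: (h i j).
have : rint (fun t => mxsq (f t)).
  rewrite /rint.
  have -> : EFin \o (fun t => mxsq (f t)) =
    (fun t => \sum_i \sum_j (nsq (f t i j))%:E)%E.
    by apply/funext => t /=; rewrite mxsqE -sumEFin; under [in RHS]eq_bigr do rewrite sumEFin.
  apply: integrable_sum => // i _; apply: integrable_sum => // j _.
  by case: (h i j).
move/integrable_lty; exact.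
Qed.

Lemma L2_fmeas m n (f : mfun R m n) : L2 f -> fmeas f. Proof. by case. Qed.

Lemma L2D m n (f g : mfun R m n) : L2 f -> L2 g -> L2 (fun t => f t + g t).
Proof.
move=> /L2P hf /L2P hg; apply/L2P => i j; under eq_fun do rewrite mxE.
exact: cL2D.
Qed.
Lemma L2Z m n (z : C) (f : mfun R m n) : L2 f -> L2 (fun t => z *: f t).
Proof.
move=> /L2P hf; apply/L2P => i j; under eq_fun do rewrite mxE.
exact: cL2Z.
Qed.
Lemma L2N m n (f : mfun R m n) : L2 f -> L2 (fun t => - f t).
Proof.
move=> /(L2Z (-1)); by under eq_fun do rewrite scaleN1r.
Qed.
Lemma L2B m n (f g : mfun R m n) : L2 f -> L2 g -> L2 (fun t => f t - g t).
Proof. by move=> hf hg; apply: L2D => //; exact: L2N. Qed.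
Lemma L2_cst m n (A : 'M[C]_(m, n)) : L2 (fun=> A).
Proof. by apply/L2P => i j; exact: cL2_cst. Qed.
Lemma L2_zf m n : L2 (@zf R m n).
Proof. exact: L2_cst. Qed.
Lemma L2_sum m n (I : Type) (r : seq I) (F : I -> mfun R m n) :
  (forall i, L2 (F i)) -> L2 (fun t => \sum_(i <- r) F i t).
Proof.
move=> mF; elim: r => [|i r IH].
  by under eq_fun do rewrite big_nil; exact: L2_cst.
by under eq_fun do rewrite big_cons; exact: L2D.
Qed.
Lemma L2_expi m n (f : mfun R m n) (a : R) : L2 f -> L2 (fun t => cexpi (a * t) *: f t).
Proof.
move=> /L2P hf; apply/L2P => i j; under eq_fun do rewrite mxE.
apply: (cL2Mb (K := 1)) => //; first exact: cmeas_cexpi.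
by move=> t _; rewrite nsq_cexpi.
Qed.
Lemma L2_Vmul m (f : mfun R m 1) : L2 f -> L2 (Vmul f).
Proof.
by move=> /(L2_expi 1); under eq_fun do rewrite mul1r.
Qed.
Lemma L2_mulmxl m n p (A : 'M[C]_(p, m)) (f : mfun R m n) : L2 f ->
  L2 (fun t => A *m f t).
Proof.
move=> /L2P hf; apply/L2P => i j; under eq_fun do rewrite mxE.
by apply: cL2_sum => k; exact: cL2Z.
Qed.
Lemma L2_mulmxr m n p (A : 'M[C]_(n, p)) (f : mfun R m n) : L2 f ->
  L2 (fun t => f t *m A).
Proof.
move=> /L2P hf; apply/L2P => i j; under eq_fun do rewrite mxE.
by apply: cL2_sum => k; under eq_fun do rewrite mulrC; exact: cL2Z.
Qed.

(** Entrywise form of [Linf]: products are estimated entry by entry, without the supremum in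
    [mxnorm]. The equivalence is [Linf_ebdd] with [ebdd_Linf]. *)
Definition ebdd m n (A : mfun R m n) := fmeas A /\
  exists K : R, 0 <= K /\ aeC (fun t => forall i j, nsq (A t i j) <= K).

Lemma L2_mul m n p (A : mfun R p m) (f : mfun R m n) : ebdd A -> L2 f ->
  L2 (fun t => A t *m f t).
Proof.
move=> [mA [K [K0 AK]]] /L2P hf; apply/L2P => i j; under eq_fun do rewrite mxE.
apply: cL2_sum => k; apply: (cL2_ae (f := fun t => rC (Num.sqrt K) * f t k j)).
- by apply: cmeasM; [exact: mA|case: (hf k j)].
- apply: aeC_imp AK => t _ h; rewrite !nsqM ler_wpM2r ?nsq_ge0//.
  by rewrite {2}/nsq /= expr0n addr0 sqr_sqrtr.
- exact: cL2Z.
Qed.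

Lemma ebdd_L2 m n (A : mfun R m n) : ebdd A -> L2 A.
Proof.
by move=> /(@L2_mul _ _ _ A (fun=> 1%:M)) /(_ (L2_cst _)); under eq_fun do rewrite mulmx1.
Qed.

Lemma aeq_refl m n (f : mfun R m n) : aeq f f.
Proof. exact: aeC_all. Qed.
Lemma aeq_sym m n (f g : mfun R m n) : aeq f g -> aeq g f.
Proof. by apply: aeC_imp. Qed.
Lemma aeq_trans m n (g f h : mfun R m n) : aeq f g -> aeq g h -> aeq f h.
Proof. by apply: aeC_imp2 => t _ ->. Qed.
Lemma aeqB m n (f g f' g' : mfun R m n) : aeq f f' -> aeq g g' ->
  aeq (fun t => f t - g t) (fun t => f' t - g' t).
Proof. by apply: aeC_imp2 => t _ -> ->. Qed.
Lemma aeqV m (f f' : mfun R m 1) : aeq f f' -> aeq (Vmul f) (Vmul f').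
Proof. by apply: aeC_imp => t _; rewrite /Vmul => ->. Qed.
Lemma aeqM m n p (A : mfun R p m) (f f' : mfun R m n) : aeq f f' ->
  aeq (fun t => A t *m f t) (fun t => A t *m f' t).
Proof. by apply: aeC_imp => t _ ->. Qed.
Lemma aeqB0 m n (f g : mfun R m n) : aeq (fun t => f t - g t) zf <-> aeq f g.
Proof.
split; apply: aeC_imp => t _; rewrite /zf; last by move=> ->; rewrite subrr.
by move/eqP; rewrite subr_eq0 => /eqP.
Qed.

Section inner.
Variable m : nat.
Implicit Types f g h : mfun R m 1.

Lemma inner_int f g i : L2 f -> L2 g -> cL1 (fun t => f t i 0 * conjc (g t i 0)).
Proof. by move=> /L2P hf /L2P hg; exact: cL2M. Qed.

Lemma innerC f g : L2 f -> L2 g -> inner g f = conjc (inner f g).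
Proof.
move=> hf hg; rewrite /inner rmorphM /= conjc_rC; congr (_ * _).
rewrite -cintJ; last by apply: cL1_sum => i; exact: inner_int.
congr cint; apply/funext => t; rewrite rmorph_sum; apply: eq_bigr => i _.
by rewrite rmorphM /= conjcK mulrC.
Qed.

Lemma innerDl f g h : L2 f -> L2 g -> L2 h ->
  inner (fun t => f t + g t) h = inner f h + inner g h.
Proof.
move=> hf hg hh; rewrite /inner -mulrDr -cintD;
 [|by apply: cL1_sum => i; exact: inner_int..].
congr (_ * cint _); apply/funext => t; rewrite -big_split; apply: eq_bigr => i _ /=.
by rewrite mxE mulrDl.
Qed.
Lemma innerZl (z : C) f h : L2 f -> L2 h ->
  inner (fun t => z *: f t) h = z * inner f h.
Proof.
move=> hf hh; rewrite /inner mulrCA; congr (_ * _).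
rewrite -cintZ; last by apply: cL1_sum => i; exact: inner_int.
congr cint; apply/funext => t; rewrite mulr_sumr; apply: eq_bigr => i _ /=.
by rewrite mxE mulrA.
Qed.
Lemma innerDr f g h : L2 f -> L2 g -> L2 h ->
  inner h (fun t => f t + g t) = inner h f + inner h g.
Proof.
move=> hf hg hh; rewrite innerC ?innerDl ?conjcD//; last exact: L2D.
by rewrite -!innerC.
Qed.
Lemma innerZr (z : C) f h : L2 f -> L2 h ->
  inner h (fun t => z *: f t) = conjc z * inner h f.
Proof.
move=> hf hh; rewrite innerC//; last exact: L2Z.
by rewrite innerZl// conjcM -innerC.
Qed.
Lemma innerNl f h : L2 f -> L2 h -> inner (fun t => - f t) h = - inner f h.
Proof.
move=> hf hh; have -> : (fun t => - f t) = (fun t => (-1) *: f t).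
  by apply/funext => t; rewrite scaleN1r.
by rewrite innerZl// mulN1r.
Qed.
Lemma innerNr f h : L2 f -> L2 h -> inner h (fun t => - f t) = - inner h f.
Proof.
move=> hf hh; rewrite innerC ?innerNl ?conjcN//; last exact: L2N.
by rewrite -!innerC.
Qed.
Lemma innerBl f g h : L2 f -> L2 g -> L2 h ->
  inner (fun t => f t - g t) h = inner f h - inner g h.
Proof.
move=> hf hg hh; rewrite -innerNl// -innerDl//; exact: L2N.
Qed.
Lemma innerBr f g h : L2 f -> L2 g -> L2 h ->
  inner h (fun t => f t - g t) = inner h f - inner h g.
Proof.
move=> hf hg hh; rewrite -innerNr// -innerDr//; exact: L2N.
Qed.
Lemma inner0l h : inner (@zf R m 1) h = 0.
Proof.
rewrite /inner /zf; under eq_fun do (under eq_bigr do rewrite mxE mul0r; rewrite big1//).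
by rewrite cint0 mulr0.
Qed.
Lemma inner0r h : L2 h -> inner h (@zf R m 1) = 0.
Proof. by move=> hh; rewrite innerC ?inner0l ?conjc0//; exact: L2_zf. Qed.
Lemma inner_suml (I : Type) (r : seq I) (F : I -> mfun R m 1) h :
  (forall i, L2 (F i)) -> L2 h ->
  inner (fun t => \sum_(i <- r) F i t) h = \sum_(i <- r) inner (F i) h.
Proof.
move=> mF hh; elim: r => [|i r IH].
  by under eq_fun do rewrite big_nil; rewrite big_nil -(inner0l h).
under eq_fun do rewrite big_cons; rewrite big_cons innerDl// ?IH//.
exact: L2_sum.
Qed.
Lemma inner_sumr (I : Type) (r : seq I) (F : I -> mfun R m 1) h :
  (forall i, L2 (F i)) -> L2 h ->
  inner h (fun t => \sum_(i <- r) F i t) = \sum_(i <- r) inner h (F i).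
Proof.
move=> mF hh; rewrite innerC//; last exact: L2_sum.
by rewrite inner_suml// conjc_sum; apply: eq_bigr => i _; rewrite -innerC.
Qed.

Lemma inner_aeq f f' g g' : L2 f -> L2 f' -> L2 g -> L2 g' ->
  aeq f f' -> aeq g g' -> inner f g = inner f' g'.
Proof.
move=> hf hf' hg hg' ff gg; rewrite /inner; congr (_ * _).
apply: ae_eq_cint.
- by apply: cL1_meas; apply: cL1_sum => i; exact: inner_int.
- by apply: cL1_meas; apply: cL1_sum => i; exact: inner_int.
by apply: aeC_imp2 ff gg => t _ -> ->.
Qed.

(** The squared norm; nearly all estimates are made on it, free of square roots. *)
Definition nrm2 f : R := complex.Re (inner f f).

Lemma nrm2E f : nrm2 f = (pi *+ 2)^-1 * Rintegral mu circ (fun t => mxsq (f t)).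
Proof.
rewrite /nrm2 /inner cRe_rCM; congr (_ * _).
apply: eq_Rintegral => t _; rewrite Re_sum mxsqE; apply: eq_bigr => i _.
by rewrite big_ord1 mulCJ.
Qed.
Lemma inner_nrm2 f : L2 f -> inner f f = rC (nrm2 f).
Proof.
move=> hf; apply: complex_ext => //=.
have := innerC hf hf => /(congr1 (@complex.Im _)); rewrite cImJ.
by move/eqP; rewrite -addr_eq0 -mulr2n mulrn_eq0 /= => /eqP.
Qed.
Lemma nrm2_ge0 f : 0 <= nrm2 f.
Proof.
rewrite nrm2E mulr_ge0//; first by rewrite invr_ge0 mulrn_wge0 ?pi_ge0.
by apply: Rintegral_ge0 => t _; exact: mxsq_ge0.
Qed.
Lemma l2normE f : l2norm f = Num.sqrt (nrm2 f).
Proof. by rewrite /l2norm nrm2E mulrC. Qed.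
Lemma l2norm_ge0 f : 0 <= l2norm f.
Proof. by rewrite l2normE sqrtr_ge0. Qed.
Lemma sqr_l2norm f : l2norm f ^+ 2 = nrm2 f.
Proof. by rewrite l2normE sqr_sqrtr ?nrm2_ge0. Qed.
Lemma nrm2_eq0 f : L2 f -> nrm2 f = 0 -> aeq f zf.
Proof.
move=> Lf; rewrite nrm2E => /eqP; rewrite mulf_eq0 invr_eq0 mulrn_eq0 /=.
rewrite gt_eqF ?pi_gt0//= => /eqP h.
have : (\int[mu]_(t in circ) `|(mxsq (f t))%:E| = 0)%E.
  transitivity (\int[mu]_(t in circ) (mxsq (f t))%:E)%E.
    by apply: eq_integral => t _; rewrite gee0_abs// lee_fin mxsq_ge0.
  rewrite -[LHS]fineK; first by rewrite -/(Rintegral _ _ _) h.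
  by apply: integrable_fin_num => //; exact: L2_rint.
have mm : measurable_fun (circ : set (measurableTypeR R)) (EFin \o (fun t => mxsq (f t))).
  by apply/measurable_EFinP; apply: mxsq_meas; case: Lf.
move/(ae_eq_integral_abs mu (@mcirc R) mm).
by apply: aeC_imp => t _ [] /mxsq_eq0.
Qed.
Lemma nrm2_aeq f g : L2 f -> L2 g -> aeq f g -> nrm2 f = nrm2 g.
Proof. by move=> hf hg fg; rewrite /nrm2 (inner_aeq hf hg hf hg). Qed.
Lemma nrm2_zf : nrm2 (@zf R m 1) = 0.
Proof. by rewrite /nrm2 inner0l. Qed.
Lemma nrm2Z (z : C) f : L2 f -> nrm2 (fun t => z *: f t) = nsq z * nrm2 f.
Proof.
move=> hf; rewrite /nrm2 innerZl//; last exact: L2Z.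
by rewrite innerZr// (mulrA z) mulCJ cRe_rCM.
Qed.
Lemma nrm2D f g : L2 f -> L2 g ->
  nrm2 (fun t => f t + g t) = nrm2 f + nrm2 g + 2 * complex.Re (inner f g).
Proof.
move=> hf hg; rewrite /nrm2 innerDl ?innerDr//; last exact: L2D.
rewrite (innerC hf hg) !cRI; ring.
Qed.
Lemma nrm2N f : L2 f -> nrm2 (fun t => - f t) = nrm2 f.
Proof.
by move=> hf; rewrite /nrm2 innerNl ?innerNr ?opprK//; exact: L2N.
Qed.
Lemma nrm2B f g : L2 f -> L2 g ->
  nrm2 (fun t => f t - g t) = nrm2 f + nrm2 g - 2 * complex.Re (inner f g).
Proof.
move=> hf hg; rewrite nrm2D ?nrm2N ?innerNr ?cRI ?mulrN//; exact: L2N.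
Qed.
Lemma nrm2D_orth f g : L2 f -> L2 g -> inner f g = 0 ->
  nrm2 (fun t => f t + g t) = nrm2 f + nrm2 g.
Proof. by move=> hf hg fg; rewrite nrm2D// fg mulr0 addr0. Qed.
Lemma nrm2D_le f g : L2 f -> L2 g ->
  nrm2 (fun t => f t + g t) <= 2 * nrm2 f + 2 * nrm2 g.
Proof.
move=> hf hg; have := nrm2_ge0 (fun t => f t - g t).
by rewrite nrm2B// nrm2D//; lra.
Qed.

Lemma cauchy_schwarz f g : L2 f -> L2 g -> nsq (inner f g) <= nrm2 f * nrm2 g.
Proof.
move=> hf hg; have g0 := nrm2_ge0 g.
have [g00|gn0] := eqVneq (nrm2 g) 0.
  rewrite (@inner_aeq f f g zf)//; last exact: nrm2_eq0.
  - by rewrite inner0r// g00 mulr0 /nsq /= expr0n addr0.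
  - exact: L2_zf.
  - exact: aeq_refl.
(* Up to the factor |g|^2 this is the component of f orthogonal to g; the scaling avoids a
   division. *)
have := nrm2_ge0 (fun t => rC (nrm2 g) *: f t - inner f g *: g t).
rewrite nrm2B ?nrm2Z ?innerZl ?innerZr//; [|exact: L2Z..].
have -> : nsq (rC (nrm2 g)) = nrm2 g ^+ 2 by rewrite /nsq /= expr0n addr0.
have -> : complex.Re (rC (nrm2 g) * (conjc (inner f g) * inner f g)) =
          nrm2 g * nsq (inner f g).
  by rewrite [conjc _ * _]mulrC mulCJ cRe_rCM.
have gt0 : 0 < nrm2 g by rewrite lt_def gn0.
have -> : nrm2 g ^+ 2 * nrm2 f + nsq (inner f g) * nrm2 g -
  2 * (nrm2 g * nsq (inner f g)) = nrm2 g * (nrm2 f * nrm2 g - nsq (inner f g)).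
  by ring.
by rewrite pmulr_rge0// subr_ge0.
Qed.

Lemma cabsE (z : C) : cabs z = Num.sqrt (nsq z). Proof. by []. Qed.
Lemma Re_le_cabs (z : C) : complex.Re z <= cabs z.
Proof.
rewrite cabsE; apply: le_trans (ler_norm _) _; rewrite -sqrtr_sqr.
by apply: ler_wsqrtr; rewrite /nsq lerDl sqr_ge0.
Qed.

Lemma l2norm_aeq f g : L2 f -> L2 g -> aeq f g -> l2norm f = l2norm g.
Proof. by move=> hf hg fg; rewrite !l2normE (nrm2_aeq hf hg fg). Qed.

End inner.

End matrix_functions.

(** * Fourier coefficients *)
Section fourier.
Variable R : realType.
Local Notation C := R[i].
Local Notation mu := (@lebesgue_measure R).

Lemma mulrz_sin_2pi (k : int) : sin (k%:~R * (pi *+ 2 : R)) = 0.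
Proof.
have := cexpiM k (pi *+ 2 : R); rewrite cexpi_pi2 exp1rz.
by move/(congr1 (@complex.Im _)).
Qed.
Lemma mulrz_cos_2pi (k : int) : cos (k%:~R * (pi *+ 2 : R)) = 1.
Proof.
have := cexpiM k (pi *+ 2 : R); rewrite cexpi_pi2 exp1rz.
by move/(congr1 (@complex.Re _)).
Qed.

Lemma pi2_gt0 : 0 < pi *+ 2 :> R.
Proof. by rewrite mulrn_wgt0 ?pi_gt0. Qed.

Lemma Rint_FTC (f F : R -> R) : continuous f -> (forall x : R, is_derive x (1 : R) F (f x)) ->
  Rintegral mu circ f = F (pi *+ 2) - F 0.
Proof.
move=> cf dF.
have cF : continuous F.
  by move=> x; apply: differentiable_continuous; apply/derivable1_diffP; case: (dF x).
rewrite /Rintegral (@continuous_FTC2 _ f F) ?pi2_gt0//.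
- by apply: continuous_subspaceT.
- split.
  + by move=> x _; case: (dF x).
  + by apply: cvg_at_right_filter; exact: cF.
  + by apply: cvg_at_left_filter; exact: cF.
- by move=> x _; rewrite derive1E; case: (dF x) => _ ->.
Qed.

Lemma cint_expi (k : int) : k != 0 -> cint (fun t : R => cexpi (k%:~R * t)) = 0.
Proof.
move=> k0; have k0' : (k%:~R : R) != 0 by rewrite intr_eq0.
have dl (x : R) : is_derive x (1 : R) (fun t : R => k%:~R * t) (k%:~R : R).
  by have := is_deriveZ (k%:~R : R) (is_derive_id x (1 : R)); rewrite /GRing.scale /= mulr1.
have cl : continuous (fun t : R => k%:~R * t) by move=> x; exact: mulrl_continuous.
have c_cos : continuous (fun t : R => cos (k%:~R * t)).
  by move=> x; apply: continuous_comp; [exact: cl|exact: continuous_cos].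
have c_sin : continuous (fun t : R => sin (k%:~R * t)).
  by move=> x; apply: continuous_comp; [exact: cl|exact: continuous_sin].
have d_sin (x : R) : is_derive x (1 : R) (fun t => (k%:~R)^-1 * sin (k%:~R * t)) (cos (k%:~R * x)).
  have := is_deriveZ (k%:~R^-1 : R) (is_derive1_comp (is_derive_sin _) (dl x)).
  by rewrite /GRing.scale /= mulrCA mulVf// mulr1.
have d_cos (x : R) : is_derive x (1 : R) (fun t => - (k%:~R)^-1 * cos (k%:~R * t)) (sin (k%:~R * x)).
  have := is_deriveZ (- k%:~R^-1 : R) (is_derive1_comp (is_derive_cos _) (dl x)).
  by rewrite /GRing.scale /= mulrA mulrNN mulrC mulrA mulfV// mul1r.
apply: complex_ext => /=.
- by rewrite (Rint_FTC c_cos d_sin) mulrz_sin_2pi !mulr0 sin0 mulr0 subrr.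
- by rewrite (Rint_FTC c_sin d_cos) mulrz_cos_2pi !mulr0 cos0 subrr.
Qed.

Lemma cint_cst (z : C) : cint (fun=> z) = rC (pi *+ 2) * z.
Proof.
have h x : Rintegral mu circ (fun=> x) = pi *+ 2 * x.
  rewrite Rintegral_cst; last exact: mcirc.
  rewrite mulrC; congr (_ * x); exact: (congr1 fine (mu_circ R)).
by apply: complex_ext; rewrite !cRI Re_rC Im_rC mul0r ?subr0 ?addr0 /=; exact: h.
Qed.

Lemma rC_pi2K : rC (pi *+ 2)^-1 * rC (pi *+ 2) = 1 :> C.
Proof.
apply: complex_ext; rewrite !cRI !Re_rC !Im_rC !(mul0r, mulr0, subr0, addr0)//=.
by rewrite mulVf// gt_eqF// pi2_gt0.
Qed.

Lemma fc_entry m n (f : mfun R m n) k i j :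
  fc f k i j = rC (pi *+ 2)^-1 * cint (fun t => cexpi (- (k%:~R * t)) * f t i j).
Proof.
rewrite !mxE; congr (_ * cint _); apply/funext => t; by rewrite mxE.
Qed.

Lemma L2_fc m n (f : mfun R m n) (k : int) i j : L2 f ->
  cL1 (fun t => cexpi (- (k%:~R * t)) * f t i j).
Proof.
move=> Lf; have := L2_expi (- k%:~R) Lf => /L2P/(_ i j)/cL2_L1.
by under eq_fun do rewrite mxE mulNr.
Qed.

Lemma fcD m n (f g : mfun R m n) k : L2 f -> L2 g ->
  fc (fun t => f t + g t) k = fc f k + fc g k.
Proof.
move=> Lf Lg; apply/matrixP => i j; rewrite [RHS]mxE !fc_entry -mulrDr -cintD.
- by congr (_ * cint _); apply/funext => t; rewrite mxE mulrDr.
- exact: L2_fc.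
- exact: L2_fc.
Qed.
Lemma fcZ m n (z : C) (f : mfun R m n) k : L2 f ->
  fc (fun t => z *: f t) k = z *: fc f k.
Proof.
move=> Lf; apply/matrixP => i j; rewrite [RHS]mxE !fc_entry [RHS]mulrCA -(cintZ z (L2_fc k i j Lf)).
by congr (_ * cint _); apply/funext => t; rewrite mxE mulrCA.
Qed.
Lemma fcN m n (f : mfun R m n) k : L2 f -> fc (fun t => - f t) k = - fc f k.
Proof.
move=> Lf; have -> : (fun t => - f t) = (fun t => (-1) *: f t).
  by apply/funext => t; rewrite scaleN1r.
by rewrite fcZ// scaleN1r.
Qed.
Lemma fcB m n (f g : mfun R m n) k : L2 f -> L2 g ->
  fc (fun t => f t - g t) k = fc f k - fc g k.
Proof. by move=> Lf Lg; rewrite fcD ?fcN//; exact: L2N. Qed.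
Lemma fc_cst m n (A : 'M[C]_(m, n)) k : fc (fun=> A) k = if k == 0 then A else 0.
Proof.
apply/matrixP => i j; rewrite fc_entry; case: eqVneq => [->|k0].
  under eq_fun do rewrite mul0r oppr0 cexpi0 mul1r.
  by rewrite cint_cst mulrA rC_pi2K mul1r.
rewrite mxE; under eq_fun do rewrite mulrC -mulNr -mulrNz.
rewrite cintZ ?cint_expi ?oppr_eq0 ?mulr0//.
apply: cL2_L1; apply: (cL2_le (cmeas_cexpi _) (rint_cst 1)) => t _.
by rewrite nsq_cexpi.
Qed.
Lemma fc_zf m n k : fc (@zf R m n) k = 0.
Proof. by rewrite /zf fc_cst; case: ifP. Qed.
Lemma fc_sum m n (I : Type) (r : seq I) (F : I -> mfun R m n) k :
  (forall i, L2 (F i)) ->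
  fc (fun t => \sum_(i <- r) F i t) k = \sum_(i <- r) fc (F i) k.
Proof.
move=> mF; elim: r => [|i r IH].
  by under eq_fun do rewrite big_nil; rewrite big_nil fc_zf.
under eq_fun do rewrite big_cons; rewrite big_cons fcD// ?IH//.
exact: L2_sum.
Qed.
Lemma fc_mulmxl m n p (A : 'M[C]_(p, m)) (f : mfun R m n) k : L2 f ->
  fc (fun t => A *m f t) k = A *m fc f k.
Proof.
move=> Lf; apply/matrixP => i j; rewrite [RHS]mxE fc_entry.
transitivity (\sum_l rC (pi *+ 2)^-1 *
    cint (fun t => A i l * (cexpi (- (k%:~R * t)) * f t l j))); last first.
  by apply: eq_bigr => l _; rewrite cintZ; [rewrite fc_entry mulrCA|exact: L2_fc].
rewrite -mulr_sumr -cint_sum; last by move=> l; apply: cL1Z; exact: L2_fc.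
congr (_ * cint _); apply/funext => t; rewrite mxE mulr_sumr.
by apply: eq_bigr => l _; rewrite mulrCA.
Qed.
Lemma fc_mulmxr m n p (A : 'M[C]_(n, p)) (f : mfun R m n) k : L2 f ->
  fc (fun t => f t *m A) k = fc f k *m A.
Proof.
move=> Lf; apply/matrixP => i j; rewrite [RHS]mxE fc_entry.
transitivity (\sum_l rC (pi *+ 2)^-1 *
    cint (fun t => A l j * (cexpi (- (k%:~R * t)) * f t i l))); last first.
  by apply: eq_bigr => l _; rewrite cintZ; [rewrite fc_entry mulrCA mulrC|exact: L2_fc].
rewrite -mulr_sumr -cint_sum; last by move=> l; apply: cL1Z; exact: L2_fc.
congr (_ * cint _); apply/funext => t; rewrite mxE mulr_sumr.
by apply: eq_bigr => l _; rewrite mulrA mulrC.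
Qed.
Lemma fc_aeq m n (f g : mfun R m n) k : L2 f -> L2 g -> aeq f g -> fc f k = fc g k.
Proof.
move=> Lf Lg fg; apply/matrixP => i j; rewrite !fc_entry; congr (_ * _).
apply: ae_eq_cint; [by apply: cL1_meas; exact: L2_fc..|].
by apply: aeC_imp fg => t _ ->.
Qed.
Lemma fc_expi m n (f : mfun R m n) (j k : int) :
  fc (fun t => cexpi (j%:~R * t) *: f t) k = fc f (k - j).
Proof.
apply/matrixP => a b; rewrite !fc_entry; congr (_ * cint _); apply/funext => t.
rewrite mxE mulrA -cexpiD; congr (cexpi _ * _).
by rewrite rmorphB /=; ring.
Qed.
Lemma fc_Vmul m (f : mfun R m 1) k : fc (Vmul f) k = fc f (k - 1).
Proof.
have -> : Vmul f = (fun t => cexpi (1%:~R * t) *: f t).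
  by apply/funext => t; rewrite mul1r.
exact: fc_expi.
Qed.
Lemma fc_expi_cst m n (A : 'M[C]_(m, n)) (j k : int) :
  fc (fun t => cexpi (j%:~R * t) *: A) k = if k == j then A else 0.
Proof. by rewrite (fc_expi (fun=> A)) fc_cst subr_eq0. Qed.

Lemma inner_expi m (f : mfun R m 1) (k : int) u : L2 f ->
  inner f (fun t => cexpi (k%:~R * t) *: u) = cinner (fc f k) u.
Proof.
move=> Lf; rewrite /inner /cinner.
under eq_fun do under eq_bigr do rewrite mxE conjcM cexpiJ mulrA [_ * conjc (u _ _)]mulrC [f _ _ _ * _]mulrC.
rewrite cint_sum; last by move=> i; apply: cL1Z; exact: L2_fc.
rewrite mulr_sumr; apply: eq_bigr => i _.
by rewrite cintZ; [rewrite fc_entry mulrCA mulrC|exact: L2_fc].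
Qed.

(** * Trigonometric polynomials and their bounded limits *)

Inductive trig : (R -> C) -> Prop :=
| trig_expi (k : int) : trig (fun t => cexpi (k%:~R * t))
| trigD f g : trig f -> trig g -> trig (fun t => f t + g t)
| trigZ z f : trig f -> trig (fun t => z * f t).

Lemma trig_cst z : trig (fun=> z).
Proof.
have := trigZ z (trig_expi 0); congr trig; apply/funext => t.
by rewrite mul0r cexpi0 mulr1.
Qed.
Lemma trigM f g : trig f -> trig g -> trig (fun t => f t * g t).
Proof.
move=> tf tg; elim: tf => [k|f1 f2 _ h1 _ h2|z f1 _ h1].
- elim: tg => [l|g1 g2 _ h1 _ h2|z g1 _ h1].
  + have := trig_expi (k + l); congr trig; apply/funext => t.
    by rewrite rmorphD mulrDl cexpiD.
  + by under eq_fun do rewrite mulrDr; exact: trigD.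
  + by under eq_fun do rewrite mulrCA; exact: trigZ.
- by under eq_fun do rewrite mulrDl; exact: trigD.
- by under eq_fun do rewrite -mulrA; exact: trigZ.
Qed.
Lemma trigX f n : trig f -> trig (fun t => f t ^+ n).
Proof.
move=> tf; elim: n => [|n IH]; first by under eq_fun do rewrite expr0; exact: trig_cst.
by under eq_fun do rewrite exprS; exact: trigM.
Qed.
Lemma trigB f g : trig f -> trig g -> trig (fun t => f t - g t).
Proof.
move=> tf tg; under eq_fun do rewrite -mulN1r; by apply: trigD => //; exact: trigZ.
Qed.
Lemma rCD (x y : R) : rC (x + y) = rC x + rC y.
Proof. by apply: complex_ext; rewrite !cRI /= ?addr0. Qed.
Lemma rCM (x y : R) : rC (x * y) = rC x * rC y.
Proof. by apply: complex_ext; rewrite !cRI /= !(mul0r, mulr0, subr0, addr0). Qed.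
Lemma rCN (x : R) : rC (- x) = - rC x.
Proof. by apply: complex_ext; rewrite !cRI /= ?oppr0. Qed.
Lemma rCX (x : R) n : rC (x ^+ n) = rC x ^+ n.
Proof. by elim: n => [|n IH]; rewrite ?expr0// !exprS rCM IH. Qed.
Lemma trig_sin (a : R) : trig (fun t => rC (sin (t - a))).
Proof.
(* c = 1/(2i), from sin x = (e^{ix} - e^{-ix}) / (2i). *)
pose c := Complex 0 (- 2^-1) : C.
have := trigB (trigZ (c * cexpi (- a)) (trig_expi 1))
              (trigZ (c * cexpi a) (trig_expi (-1))).
congr trig; apply/funext => t; rewrite mul1r mulN1r -!mulrA -!cexpiD -mulrBr.
rewrite [- a + t]addrC -[a - t]opprB; move: (t - a) => x.
apply: complex_ext; rewrite /c /cexpi sinN cosN !cRI /= !(mul0r, mulr0, subr0, addr0).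
  by field.
by ring.
Qed.

(* By Bernoulli's inequality these polynomials tend on [0, 1] to the indicator of
   [y < 1/2]. *)
Definition bump_poly n (y : R) : R := (1 - y ^+ n) ^+ (n * 2 ^ n).

Lemma bump_poly01 n y : 0 <= y <= 1 -> 0 <= bump_poly n y <= 1.
Proof.
move=> /andP[y0 y1]; have yn1 : y ^+ n <= 1 by rewrite exprn_ile1.
have yn0 : 0 <= y ^+ n by rewrite exprn_ge0.
apply/andP; split; first by rewrite exprn_ge0// subr_ge0.
by rewrite exprn_ile1 ?subr_ge0// gerBl.
Qed.

Lemma bernoulli_ineq (x : R) n : -1 <= x -> 1 + n%:R * x <= (1 + x) ^+ n.
Proof.
move=> x1; elim: n => [|n IH]; first by rewrite mul0r addr0 expr0.
rewrite exprS; apply: le_trans (_ : (1 + x) * (1 + n%:R * x) <= _).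
  rewrite -natr1; have : 0 <= n%:R * x ^+ 2 by rewrite mulr_ge0 ?sqr_ge0.
  rewrite expr2; lra.
by rewrite ler_wpM2l//; lra.
Qed.

(** With s the square root of q, q^n = s^n s^n, and Bernoulli's inequality for 1/s bounds n s^n by
    1/(1 - s); the remaining factor s^n tends to 0. *)
Lemma cvg_mulrn_geom (q : R) : 0 <= q < 1 -> (fun n => n%:R * q ^+ n) @ \oo --> (0 : R).
Proof.
move=> /andP[q0 q1].
have s0 : 0 <= Num.sqrt q by exact: sqrtr_ge0.
have s1 : Num.sqrt q < 1 by rewrite -sqrtr1 ltr_sqrt.
set s := Num.sqrt q in s0 s1.
have qE : q = s ^+ 2 by rewrite sqr_sqrtr.
have ub n : n%:R * q ^+ n <= (1 - s)^-1 * s ^+ n.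
  rewrite qE -exprM mul2n -addnn exprD mulrA ler_wpM2r ?exprn_ge0//.
  rewrite -[leRHS]mul1r ler_pdivlMr ?subr_gt0// .
  have [->|sn0] := eqVneq s 0.
    by case: n => [|n]; rewrite ?mul0r// exprS mul0r mulr0 mul0r.
  have sp : 0 < s by rewrite lt_def sn0.
  have := @bernoulli_ineq (s^-1 - 1) n.
  have : 1 <= s^-1 by rewrite invf_ge1// ltW.
  move=> h1 h2; have {h2} h2 := h2 ltac:(lra).
  have e : 1 + (s^-1 - 1) = s^-1 by ring.
  rewrite e in h2.
  have spn : 0 < s ^+ n by rewrite exprn_gt0.
  have : (1 + n%:R * (s^-1 - 1)) * s ^+ n <= 1.
    apply: le_trans (_ : (s^-1) ^+ n * s ^+ n <= _); first by rewrite ler_pM2r.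
    by rewrite -exprMn mulVf// expr1n.
  move=> h3; have h4 : n%:R * (s^-1 - 1) * s ^+ n <= 1.
    by apply: le_trans h3; rewrite mulrDl mul1r lerDr ltW.
  apply: le_trans h4; rewrite -!mulrA ler_wpM2l// [leRHS]mulrC ler_wpM2l ?(ltW spn)//.
  rewrite -subr_ge0; have -> : s^-1 - 1 - (1 - s) = s^-1 * (1 - s) ^+ 2 by field.
  by rewrite mulr_ge0 ?sqr_ge0// invr_ge0 ltW.
apply: (@squeeze_cvgr _ _ _ _ (fun=> 0) (fun n => (1 - s)^-1 * s ^+ n)).
- by near=> n; rewrite ub andbT mulr_ge0// exprn_ge0.
- exact: cvg_cst.
- rewrite -[X in _ --> X](mulr0 (1 - s)^-1); apply: cvgMr; apply: cvg_expr.
  by rewrite ger0_norm.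
Unshelve. all: by end_near. Qed.

(** Bernoulli's inequality bounds the polynomial below by 1 - n (2y)^n; here 2y < 1 is what the base
    2 in the exponent is tuned to. *)
Lemma bump_poly_cvg1 (y : R) : 0 <= y < 2^-1 -> bump_poly n y @[n --> \oo] --> (1 : R).
Proof.
move=> /andP[y0 y1].
have q01 : 0 <= 2 * y < 1 by apply/andP; split; lra.
apply: (@squeeze_cvgr _ _ _ _ (fun n => 1 - n%:R * (2 * y) ^+ n) (fun=> 1)).
- near=> n; have /andP[_ ->] := @bump_poly01 n y ltac:(apply/andP; split; lra).
  rewrite andbT /bump_poly; apply: le_trans (bernoulli_ineq _ _).
    by rewrite mulrN lerD2l lerN2 natrM natrX exprMn mulrA.
  by rewrite lerN2 exprn_ile1//; lra.
- rewrite -[X in _ --> X](subr0 1); apply: cvgB; first exact: cvg_cst.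
  exact: cvg_mulrn_geom.
- exact: cvg_cst.
Unshelve. all: by end_near. Qed.

(** The product of the polynomial with (1 + y^n)^(n 2^n) is at most 1, and that factor is at least 1
    + n because (2y)^n >= 1. The factor n in the exponent gives convergence even at y = 1/2. *)
Lemma bump_poly_cvg0 (y : R) : 2^-1 <= y <= 1 -> bump_poly n y @[n --> \oo] --> (0 : R).
Proof.
move=> /andP[y0 y1].
apply: (@squeeze_cvgr _ _ _ _ (fun=> 0) (fun n => (n.+1%:R)^-1)).
- near=> n; have /andP[-> /= _] := @bump_poly01 n y ltac:(apply/andP; split; lra).
  have yn0 : 0 <= y ^+ n by rewrite exprn_ge0//; lra.
  have yn1 : y ^+ n <= 1 by rewrite exprn_ile1//; lra.
  have : bump_poly n y * (1 + y ^+ n) ^+ (n * 2 ^ n) <= 1.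
    rewrite /bump_poly -exprMn exprn_ile1//.
      by rewrite mulr_ge0//; lra.
    by rewrite -subr_sqr expr1n gerBl sqr_ge0.
  have : n.+1%:R <= (1 + y ^+ n) ^+ (n * 2 ^ n).
    apply: le_trans (bernoulli_ineq _ _); last lra.
    rewrite -natr1 addrC lerD2l natrM -mulrA ler_peMr// natrX -exprMn exprn_ege1//.
    lra.
  move=> h1 h2; rewrite -[leRHS]mul1r ler_pdivlMr//.
  apply: le_trans h2; rewrite ler_wpM2l//.
  by case/andP: (@bump_poly01 n y ltac:(apply/andP; split; lra)).
- exact: cvg_cst.
- exact: cvg_harmonic.
Unshelve. all: by end_near. Qed.

Lemma cvg_EFin_seq (u : nat -> R) l : u @ \oo --> l -> (fun n => (u n)%:E) @ \oo --> l%:E.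
Proof. by move=> h; apply: cvg_EFin; [exact: nearW|exact: h]. Qed.

(* [halfsin s a t < 1/2] iff [(-1)^s sin (t - a) > 0]: two such half circles cut out
   an arc, whose indicator is a bounded limit of the trigonometric polynomials
   [arc n] below. *)
Definition halfsin (s : bool) (a t : R) : R := (1 - (-1) ^+ s * sin (t - a)) / 2.

Lemma halfsin01 s a t : 0 <= halfsin s a t <= 1.
Proof.
have /andP[h1 h2] : -1 <= sin (t - a) <= 1 by rewrite sin_geN1 sin_le1.
by rewrite /halfsin; case: s; rewrite ?expr0 ?expr1; apply/andP; split; lra.
Qed.

Lemma trig_halfsin s a : trig (fun t => rC (halfsin s a t)).
Proof.
have := trigZ (rC 2^-1) (trigB (trig_cst 1) (trigZ (rC ((-1) ^+ s)) (trig_sin a))).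
congr trig; apply/funext => t; rewrite /halfsin [in RHS]mulrC !(rCM, rCD, rCN).
by [].
Qed.

Definition arc n s1 a s2 b t : R :=
  bump_poly n (halfsin s1 a t) * bump_poly n (halfsin s2 b t).

Definition arc_lim s1 a s2 b t : bool :=
  (halfsin s1 a t < 2^-1) && (halfsin s2 b t < 2^-1).

Lemma trig_arc n s1 a s2 b : trig (fun t => rC (arc n s1 a s2 b t)).
Proof.
have bp s c : trig (fun t => rC (bump_poly n (halfsin s c t))).
  under eq_fun do rewrite /bump_poly rCX rCD rCN rCX.
  apply: trigX; apply: trigB; first exact: trig_cst.
  by apply: trigX; exact: trig_halfsin.
by under eq_fun do rewrite /arc rCM; exact: trigM.
Qed.

Lemma bump_cvg s a t : bump_poly n (halfsin s a t) @[n --> \oo] -->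
  ((halfsin s a t < 2^-1)%R%:R : R).
Proof.
have /andP[h0 h1] := halfsin01 s a t.
case: (ltP (halfsin s a t) 2^-1) => h.
  by apply: bump_poly_cvg1; rewrite h0.
by apply: bump_poly_cvg0; rewrite h.
Qed.

Lemma arc_cvg s1 a s2 b t :
  arc n s1 a s2 b t @[n --> \oo] --> ((arc_lim s1 a s2 b t)%:R : R).
Proof.
have -> : (arc_lim s1 a s2 b t)%:R =
  (halfsin s1 a t < 2^-1)%R%:R * (halfsin s2 b t < 2^-1)%R%:R :> R.
  by rewrite /arc_lim -natrM mulnb.
by apply: cvgM; exact: bump_cvg.
Qed.

Lemma arc01 n s1 a s2 b t : 0 <= arc n s1 a s2 b t <= 1.
Proof.
have /andP[u0 u1] := bump_poly01 n (halfsin01 s1 a t).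
have /andP[v0 v1] := bump_poly01 n (halfsin01 s2 b t).
by rewrite /arc mulr_ge0//= mulr_ile1.
Qed.

Lemma trig_meas f : trig f -> cmeas f.
Proof.
elim=> [k|f1 f2 _ h1 _ h2|z f1 _ h1]; first exact: cmeas_cexpi.
  exact: cmeasD.
by apply: cmeasM => //; exact: cmeas_cst.
Qed.

(** * A square integrable function orthogonal to every exponential vanishes *)

Section annihilator.
Variable g : R -> C.
Hypothesis g2 : cL2 g.
Hypothesis g0 : forall k : int, cint (fun t => cexpi (k%:~R * t) * g t) = 0.

Lemma trig_ann f : trig f -> cL2 (fun t => f t * g t) /\ cint (fun t => f t * g t) = 0.
Proof.
elim=> [k|f1 f2 _ [h1 e1] _ [h2 e2]|z f1 _ [h1 e1]].
- split => //; apply: (cL2Mb (K := 1)) => //; first exact: cmeas_cexpi.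
  by move=> t _; rewrite nsq_cexpi.
- under eq_fun do rewrite mulrDl; split; first exact: cL2D.
  by rewrite cintD ?e1 ?e2 ?addr0//; exact: cL2_L1.
- under eq_fun do rewrite -mulrA; split; first exact: cL2Z.
  by rewrite cintZ ?e1 ?mulr0//; exact: cL2_L1.
Qed.

Let r t := complex.Re (g t).
Let rr : rint r. Proof. by case: (cL2_L1 g2). Qed.

Lemma arc_meas n s1 a s2 b : measurable_fun circ (arc n s1 a s2 b).
Proof. by have [] := trig_meas (trig_arc n s1 a s2 b). Qed.

Lemma arc_int0 n s1 a s2 b :
  Rintegral mu circ (fun t => arc n s1 a s2 b t * r t) = 0.
Proof.
have [_ /(congr1 (@complex.Re _)) /= e] := trig_ann (trig_arc n s1 a s2 b).
by rewrite -[RHS]e; apply: eq_Rintegral => t _; rewrite cRe_rCM.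
Qed.

Lemma arc_rint n s1 a s2 b : rint (fun t => arc n s1 a s2 b t * r t).
Proof.
apply: (rint_le (h := fun t => `|r t|)).
- by apply: measurable_funM; [exact: arc_meas|exact: rint_meas].
- exact: integrable_norm.
- move=> t _; rewrite normrM ger0_norm; last by case/andP: (arc01 n s1 a s2 b t).
  by rewrite ler_piMl//; case/andP: (arc01 n s1 a s2 b t).
Qed.

Lemma arc_lim_meas s1 a s2 b : measurable_fun circ (fun t => (arc_lim s1 a s2 b t)%:R : R).
Proof.
apply: (@measurable_fun_cvg _ _ _ circ (fun n => arc n s1 a s2 b)).
- by move=> n; exact: arc_meas.
- by move=> t _; exact: arc_cvg.
Qed.

(** Dominated convergence with bound |r|, since the polynomials [arc n] stay between 0 and 1. *)
Lemma arc_lim_int0 s1 a s2 b :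
  rint (fun t => (arc_lim s1 a s2 b t)%:R * r t) /\
  Rintegral mu circ (fun t => (arc_lim s1 a s2 b t)%:R * r t) = 0.
Proof.
have := @dominated_convergence _ _ _ mu circ (@mcirc R)
  (fun n t => (arc n s1 a s2 b t * r t)%:E)
  (fun t => ((arc_lim s1 a s2 b t)%:R * r t)%:E) (fun t => `|r t|%:E).
case.
- by move=> n; apply/measurable_EFinP; exact: rint_meas (arc_rint n s1 a s2 b).
- apply/measurable_EFinP; apply: measurable_funM; first exact: arc_lim_meas.
  exact: rint_meas.
- apply: aeC_all => t _; apply: cvg_EFin_seq; apply: cvgMl; exact: arc_cvg.
- exact: integrable_norm.
- apply: aeW => t n _; rewrite /= lee_fin normrM ger0_norm.
    by rewrite ler_piMl//; case/andP: (arc01 n s1 a s2 b t).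
  by case/andP: (arc01 n s1 a s2 b t).
move=> i1 _ c; split=> //.
have : (fun n => \int[mu]_(t in circ) (arc n s1 a s2 b t * r t)%:E)%E @ \oo --> (0 : \bar R).
  apply: cvg_near_cst; near=> n.
  rewrite -[LHS]fineK; last first.
    by apply: integrable_fin_num; [exact: mcirc|exact: arc_rint].
  by congr EFin; exact: arc_int0.
move=> c0; rewrite /Rintegral.
by have -> := cvg_unique _ c c0.
Unshelve. all: by end_near. Qed.

Lemma halfsin0_lt a t : (halfsin false a t < 2^-1) = (0 < sin (t - a)).
Proof. by rewrite /halfsin expr0; apply/idP/idP; lra. Qed.
Lemma halfsin1_lt a t : (halfsin true a t < 2^-1) = (sin (t - a) < 0).
Proof. by rewrite /halfsin expr1; apply/idP/idP; lra. Qed.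

Lemma sin_pi_sub (t : R) : sin t = - sin (t - pi).
Proof. by rewrite -[in LHS](subrK pi t) sinDpi. Qed.

Lemma circP (t : R) : circ t -> 0 <= t <= pi *+ 2.
Proof. by rewrite /circ /= in_itv. Qed.

(** The arc from 0 to x is an intersection of two half circles only while x < pi; beyond pi its
    complement is one, which is the case of [arc_high]. The excluded points form a null set. *)
Lemma arc_low (x t : R) : 0 < x < pi -> circ t -> t != 0 -> t != x ->
  arc_lim false 0 true x t = (t <= x).
Proof.
move=> /andP[x0 xpi] /circP/andP[t0 t2] tn0 tnx.
have tp : 0 < t by rewrite lt_def tn0.
rewrite /arc_lim halfsin0_lt halfsin1_lt subr0; case: (leP t x) => tx.
  have tx' : t < x by rewrite lt_neqAle tnx.
  apply/andP; split; first by apply: sin_gt0_pi; apply/andP; split; lra.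
  by rewrite -opprB sinN oppr_lt0; apply: sin_gt0_pi; apply/andP; split; lra.
apply/negbTE; rewrite negb_and -!leNgt.
case: (leP pi t) => tpi.
  rewrite sin_pi_sub oppr_le0 sin_ge0_pi//; apply/andP; split; first lra.
  by rewrite mulr2n in t2; lra.
by rewrite orbC sin_ge0_pi//; apply/andP; split; lra.
Qed.

Lemma arc_high (x t : R) : pi < x < pi *+ 2 -> circ t -> t != pi *+ 2 ->
  arc_lim true 0 false x t = (x < t).
Proof.
move=> /andP[x0 xpi] /circP/andP[t0 t2] tn2; rewrite mulr2n in xpi t2 tn2.
have tp : t < pi + pi by rewrite lt_neqAle tn2.
rewrite /arc_lim halfsin0_lt halfsin1_lt subr0; case: (ltP x t) => tx.
  apply/andP; split; last by apply: sin_gt0_pi; apply/andP; split; lra.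
  by rewrite sin_pi_sub oppr_lt0; apply: sin_gt0_pi; apply/andP; split; lra.
apply/negbTE; rewrite negb_and -!leNgt.
case: (leP t pi) => tpi; first by rewrite sin_ge0_pi//; apply/andP; split; lra.
by rewrite orbC -opprB sinN oppr_le0 sin_ge0_pi//; apply/andP; split; lra.
Qed.

Lemma aeC_neq (c : R) : aeC (fun t => t != c).
Proof.
exists [set c]; split; first exact: measurable_set1.
  exact: lebesgue_measure_set1.
move=> t /= /not_implyP[_ /negP]; rewrite negbK => /eqP ->.
by [].
Qed.

Lemma Rint_ae (h1 h2 : R -> R) : rint h1 -> rint h2 -> aeC (fun t => h1 t = h2 t) ->
  Rintegral mu circ h1 = Rintegral mu circ h2.
Proof.
move=> i1 i2 e; congr fine; apply: ae_eq_integral.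
- exact: mcirc.
- exact: measurable_int i1.
- exact: measurable_int i2.
- by apply: aeC_imp e => t _ ->.
Qed.

(** A primitive of [r], cut off outside the circle and integrated from minus infinity, as [FTC1Ny]
    expects. *)
Definition cumul (x : R) := Rintegral mu [set` `]-oo, x]] (r \_ circ).

Lemma cumulE (x : R) : cumul x = Rintegral mu circ (fun t => (t <= x)%R%:R * r t).
Proof.
rewrite /cumul Rintegral_mkcond [RHS]Rintegral_mkcond; apply: eq_Rintegral => t _.
have e : (t \in [set` `]-oo, x]]) = (t <= x) by rewrite mem_setE in_itv.
rewrite /patch e; case: (t \in circ); case: (t <= x) => //.
  by rewrite mul1r.
by rewrite mul0r.
Qed.

Lemma le_rint (x : R) : rint (fun t => (t <= x)%R%:R * r t).
Proof.
apply: (rint_le (h := fun t => `|r t|)); last 1 first.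
- by move=> t _; case: (leP t x) => _; rewrite ?mul1r// mul0r normr0 normr_ge0.
- apply: measurable_funM; last exact: rint_meas.
  have -> : (fun t => (t <= x)%R%:R) = \1_[set` `]-oo, x]] :> (R -> R).
    by apply/funext => t; rewrite indicE mem_setE in_itv.
  exact: measurable_indic.
- exact: integrable_norm.
Qed.

Lemma r_int0 : Rintegral mu circ r = 0.
Proof.
transitivity (complex.Re (cint (fun t => cexpi (0%:~R * t) * g t))); last by rewrite g0.
by apply: eq_Rintegral => t _; rewrite mul0r cexpi0 mul1r.
Qed.

Lemma cumul0 (x : R) : 0 < x < pi \/ pi < x < pi *+ 2 -> cumul x = 0.
Proof.
rewrite cumulE => -[xi|xi].
  have [i1 <-] := arc_lim_int0 false 0 true x.
  apply: Rint_ae => //; first exact: le_rint.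
  apply: aeC_imp2 (aeC_neq 0) (aeC_neq x) => t ct tn0 tnx.
  by rewrite arc_low.
have [i1 e1] := arc_lim_int0 true 0 false x.
have : Rintegral mu circ r - Rintegral mu circ (fun t => (arc_lim true 0 false x t)%:R * r t) = 0.
  by rewrite r_int0 e1 subr0.
rewrite -(RintegralB (@mcirc R) rr i1) => <-; apply: Rint_ae; [exact: le_rint|exact: rintB|].
apply: aeC_imp (aeC_neq (pi *+ 2)) => t ct tn.
by rewrite arc_high//; case: leP => _; rewrite ?mul1r ?mul0r ?subr0 ?subrr.
Qed.

(** The primitive vanishes on the open intervals from 0 to pi and from pi to 2 pi, hence so does its
    derivative, which is almost everywhere the real part of g. *)
Lemma Re_ann0 : aeC (fun t => complex.Re (g t) = 0).
Proof.
have rT : mu.-integrable setT (EFin \o (r \_ circ)).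
  rewrite -restrict_EFin; apply/(integrable_mkcond _ (@mcirc R)).1; exact: rr.
have rS (y : R) : mu.-integrable `]-oo, y] (EFin \o (r \_ circ)).
  by apply: integrableS rT => //; exact: measurable_itv.
have /= := @FTC1Ny R (r \_ circ) rS (integrable_locally (@mcirc R) rr).
move=> F; have {}F : aeC (fun t => derive1 cumul t = (r \_ circ) t).
  apply: filterS F; first exact: (@ae_filter_ringOfSetsType _ (measurableTypeR R) R mu).
  by move=> t [].
have cum_open (a b t : R) : a < t < b ->
    (forall x, a < x < b -> cumul x = 0) -> derive1 cumul t = 0.
  move=> /andP[at_ tb] h; rewrite derive1E.
  have -> : 'D_1 cumul t = 'D_1 (fun=> 0 : R) t.
    apply: near_eq_derive; near=> x; apply: h.
    by apply/andP; split; near: x; [exact: lt_nbhsr|exact: lt_nbhsl].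
  by rewrite derive_cst.
apply: aeC_imp2 (aeC_and F (aeC_neq 0)) (aeC_and (aeC_neq pi) (aeC_neq (pi *+ 2))).
move=> t ct [e tn0] [tnpi tn2].
move: e; rewrite patchT ?mem_set// /r => <-.
have /andP[t0 t2] := circP ct.
have {}t0 : 0 < t by rewrite lt_def tn0.
have {}t2 : t < pi *+ 2 by rewrite lt_neqAle tn2.
have [tpi|pit|tE] := ltgtP t pi.
- by apply: (cum_open 0 pi); [rewrite t0|move=> x xi; apply: cumul0; left].
- by apply: (cum_open pi (pi *+ 2)); [rewrite pit|move=> x xi; apply: cumul0; right].
- by rewrite tE eqxx in tnpi.
Unshelve. all: by end_near. Qed.

End annihilator.

Lemma ann0 (g : R -> C) : cL2 g ->
  (forall k : int, cint (fun t => cexpi (k%:~R * t) * g t) = 0) ->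
  aeC (fun t => g t = 0).
Proof.
move=> g2 g0.
have h1 := Re_ann0 g2 g0.
(* The real part of i g is minus the imaginary part of g. *)
have h2 : aeC (fun t => complex.Re ('i%C * g t) = 0).
  apply: Re_ann0 => [|k]; first exact: cL2Z.
  under eq_fun do rewrite mulrCA.
  rewrite cintZ ?g0 ?mulr0//; apply: cL2_L1; apply: (cL2Mb (K := 1)) => //.
    exact: cmeas_cexpi.
  by move=> t _; rewrite nsq_cexpi.
apply: aeC_imp2 h1 h2 => t _ e1 e2; apply: complex_ext; first by rewrite e1.
by move: e2; rewrite cReM /= mul0r sub0r mul1r => /eqP; rewrite oppr_eq0 => /eqP.
Qed.

Lemma fourier_uniqueness m n (f : mfun R m n) : L2 f ->
  (forall k, fc f k = 0) -> aeq f zf.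
Proof.
move=> Lf f0.
suff : aeC (fun t => forall i, forall j, f t i j = 0).
  by apply: aeC_imp => t _ h; apply/matrixP => i j; rewrite h mxE.
apply: aeC_forall => i; apply: aeC_forall => j; apply: ann0.
  by move/L2P: Lf.
move=> k; have /matrixP/(_ i j) := f0 (- k); rewrite fc_entry mxE => h.
have := congr1 (fun z => rC (pi *+ 2) * z) h; rewrite mulr0 mulrA.
rewrite [rC _ * rC _]mulrC rC_pi2K mul1r => <-.
by congr cint; apply/funext => t; rewrite mulrNz mulNr opprK.
Qed.

End fourier.

(** * Completeness and the projection onto K^2 *)
Section completeness.
Variable R : realType.
Local Notation C := R[i].
Local Notation mu := (@lebesgue_measure R).

Lemma limn_einf_le_cst (u : nat -> \bar R) M N :
  (forall k, (N <= k)%N -> (u k <= M)%E) -> (limn_einf u <= M)%E.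
Proof.
move=> h; rewrite limn_einf_lim; apply: lime_le; first exact: is_cvg_einfs.
apply: nearW => j; apply: le_trans (h (maxn j N) (leq_maxr _ _)).
by apply: ereal_inf_lbound; exists (maxn j N) => //=; exact: leq_maxl.
Qed.
Lemma limn_einf_ge0 (u : nat -> \bar R) :
  (forall k, (0 <= u k)%E) -> (0 <= limn_einf u)%E.
Proof.
move=> h; rewrite limn_einf_lim; apply: lime_ge; first exact: is_cvg_einfs.
by apply: nearW => j; apply: le_ereal_inf_tmp => _ [k _ <-].
Qed.
Lemma measurable_limn_einf (f : nat -> R -> \bar R) :
  (forall n, measurable_fun circ (f n)) ->
  measurable_fun circ (fun t => limn_einf (f ^~ t)).
Proof.
move=> mf.
have -> : (fun t => limn_einf (f ^~ t)) = (fun t => - limn_esup (fun n => - f n t))%E.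
  apply/funext => t; rewrite -limn_einfN; congr limn_einf.
  by apply/funext => n /=; rewrite oppeK.
apply: measurableT_comp => //; apply: measurable_fun_limn_esup => n.
exact: measurableT_comp.
Qed.
Lemma cvg_bigsum (I : Type) (r : seq I) (f : I -> nat -> R) (l : I -> R) :
  (forall i, f i n @[n --> \oo] --> l i) ->
  (\sum_(i <- r) f i n) @[n --> \oo] --> \sum_(i <- r) l i.
Proof.
move=> h; elim: r => [|i r IH].
  by under eq_fun do rewrite big_nil; rewrite big_nil; exact: cvg_cst.
by under eq_fun do rewrite big_cons; rewrite big_cons; exact: cvgD.
Qed.

Lemma cvg_of_summable (u : nat -> R) (M : R) :
  (forall n, \sum_(k < n) `|u k.+1 - u k| <= M) -> cvgn u.
Proof.
move=> h; have -> : u = (fun n => u 0%N + series (telescope u) n).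
  by apply/funext => n; rewrite -eq_sum_telescope.
apply: is_cvgD; first exact: is_cvg_cst.
apply: normed_cvg; apply: nondecreasing_is_cvgn.
  by apply: nondecreasing_series => n _ _; exact: normr_ge0.
exists M => _ [n _ <-]; apply: le_trans (h n).
by rewrite /= seriesEord.
Qed.

Lemma rint_ae_lt (f : R -> \bar R) : mu.-integrable circ f ->
  aeC (fun t => (f t \is a fin_num)).
Proof. by move=> h; have := integrable_ae (@mcirc R) h. Qed.

(** The inequality d <= 2^-k + 2^k d^2 turns the geometric bound 4^-k on squared increments into a
    bound of order 2^-k on the increments themselves. Their sum is then integrable, so finite almost
    everywhere, and the sequence converges there. *)
Lemma fast_cauchy_ae (g : nat -> R -> R) (c : R) :
  (forall k, measurable_fun circ (g k)) ->
  (forall k, rint (fun t => (g k.+1 t - g k t) ^+ 2)) ->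
  (forall k, Rintegral mu circ (fun t => (g k.+1 t - g k t) ^+ 2) <= c * 4^-1 ^+ k) ->
  aeC (fun t => cvgn (g ^~ t)).
Proof.
move=> mg ig gc.
pose d k t := `|g k.+1 t - g k t|.
have md k : measurable_fun circ (d k).
  by apply: measurableT_comp => //; exact: measurable_funB.
have dub k t : d k t <= 2^-1 ^+ k + 2 ^+ k * (g k.+1 t - g k t) ^+ 2.
  rewrite /d; set x := g k.+1 t - g k t; set e : R := 2 ^+ k.
  have e0 : 0 < e by rewrite exprn_gt0.
  have -> : 2^-1 ^+ k = e^-1 by rewrite exprVn.
  have := sqr_ge0 (1 - e * `|x|); rewrite sqrrB expr1n mul1r exprMn real_normK ?num_real// => h.
  have {}h : 2 * e * `|x| <= 1 + e ^+ 2 * x ^+ 2 by move: h; rewrite -mulr_natl; lra.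
  rewrite -(ler_pM2l e0) mulrDr mulfV ?gt_eqF// mulrA -expr2.
  apply: le_trans h; rewrite -mulrA ler_peMl ?ler1n//.
  by rewrite mulr_ge0// ltW.
have iub k : rint (fun t => 2^-1 ^+ k + 2 ^+ k * (g k.+1 t - g k t) ^+ 2).
  by apply: rintD; [exact: rint_cst|exact: rintZ].
have id k : rint (d k).
  apply: rint_le (iub k) _ => // t _; rewrite ger0_norm ?dub//; exact: normr_ge0.
have dint k : Rintegral mu circ (d k) <= (pi *+ 2 + c) * 2^-1 ^+ k.
  apply: le_trans (_ : Rintegral mu circ (fun t => 2^-1 ^+ k + 2 ^+ k * (g k.+1 t - g k t) ^+ 2) <= _).
    by apply: (le_Rintegral (@mcirc R) (id k) (iub k)).
  rewrite (RintegralD (@mcirc R) (rint_cst _) (rintZ _ (ig k))).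
  rewrite (RintegralZl _ (@mcirc R) (ig k)).
  rewrite Rintegral_cst; last exact: mcirc.
  rewrite (_ : fine (mu circ) = pi *+ 2); last exact: (congr1 fine (mu_circ R)).
  rewrite [leRHS]mulrDl mulrC lerD2l.
  apply: le_trans (_ : 2 ^+ k * (c * 4^-1 ^+ k) <= _); first by rewrite ler_wpM2l// exprn_ge0.
  have c0 : 0 <= c.
    have := gc 0%N; rewrite expr0 mulr1; apply: le_trans.
    by apply: Rintegral_ge0 => t _; exact: sqr_ge0.
  rewrite mulrCA ler_wpM2l ?c0//.
  by rewrite -exprMn (_ : 2 * 4^-1 = 2^-1 :> R)//; field.
pose M : R := (pi *+ 2 + c) * 2.
have Mub n : \sum_(k < n) Rintegral mu circ (d k) <= M.
  apply: le_trans (_ : \sum_(k < n) (pi *+ 2 + c) * 2^-1 ^+ k <= _); first by apply: ler_sum.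
  have pc0 : 0 <= pi *+ 2 + c.
    have := gc 0%N; rewrite expr0 mulr1 => c0; apply: addr_ge0; first exact: (ltW (pi2_gt0 R)).
    by apply: le_trans c0; apply: Rintegral_ge0 => t _; exact: sqr_ge0.
  rewrite -mulr_sumr ler_wpM2l ?pc0//.
  suff -> : \sum_(k < n) 2^-1 ^+ k = 2 * (1 - 2^-1 ^+ n) :> R.
    by rewrite ler_piMr// gerBl exprn_ge0.
  elim: n => [|n IH]; first by rewrite big_ord0 expr0 subrr mulr0.
  by rewrite big_ord_recr /= IH exprS; field.
pose S t := (\sum_(0 <= k <oo) (d k t)%:E)%E.
have iS : mu.-integrable circ S.
  apply/integrableP; split.
    apply: ge0_emeasurable_sum.
      by move=> k t _ _; rewrite lee_fin; exact: normr_ge0.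
    by move=> k _; apply/measurable_EFinP; exact: md.
  under eq_integral => t _.
    rewrite gee0_abs; last by apply: nneseries_ge0 => k _ _; rewrite lee_fin normr_ge0.
    over.
  rewrite integral_nneseries; last first.
  - by move=> k t _; rewrite lee_fin normr_ge0.
  - by move=> k; apply/measurable_EFinP; exact: md.
  - exact: mcirc.
  apply: le_lt_trans (ltry M); apply: lime_le.
    by apply: is_cvg_nneseries => k _ _; apply: integral_ge0 => t _; rewrite lee_fin normr_ge0.
  apply: nearW => n; rewrite big_mkord.
  apply: le_trans (_ : (\sum_(k < n) Rintegral mu circ (d k))%:E <= _)%E; last by rewrite lee_fin.
  rewrite -sumEFin; apply: lee_sum => k _.
  by rewrite /Rintegral fineK//; exact: (integrable_fin_num (@mcirc R) (id k)).
apply: aeC_imp (rint_ae_lt iS) => t _ St.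
apply: (@cvg_of_summable _ (fine (S t))) => n.
rewrite -lee_fin fineK// -sumEFin -(big_mkord xpredT (fun k => (d k t)%:E)).
by apply: nneseries_lim_ge => k _ _; rewrite lee_fin normr_ge0.
Qed.

Lemma fast_cauchy_lim (g : nat -> R -> R) (c : R) :
  (forall k, measurable_fun circ (g k)) ->
  (forall k, rint (fun t => (g k.+1 t - g k t) ^+ 2)) ->
  (forall k, Rintegral mu circ (fun t => (g k.+1 t - g k t) ^+ 2) <= c * 4^-1 ^+ k) ->
  exists2 h : R -> R, measurable_fun circ h & aeC (fun t => g n t @[n --> \oo] --> h t).
Proof.
(* The upper limit is defined and measurable everywhere, and agrees with the limit wherever that
   exists. *)
move=> mg ig gc; exists (fun t => fine (limn_esup (fun n => (g n t)%:E))).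
  apply: measurableT_comp; first exact: fine_measurable.
  apply: measurable_fun_limn_esup => n; exact/measurable_EFinP.
apply: aeC_imp (fast_cauchy_ae mg ig gc) => t _ ct.
have := cvg_EFin_seq ct => /cvg_limn_einf_sup[_ ->].
exact: ct.
Qed.

Local Notation nu f := (\int[mu]_(t in circ) (mxsq (f t))%:E)%E.

Lemma nuE m (f : mfun R m 1) : L2 f -> nu f = (pi *+ 2 * nrm2 f)%:E.
Proof.
move=> Lf; rewrite nrm2E mulrA mulfV ?mul1r ?gt_eqF ?pi2_gt0//.
rewrite /Rintegral fineK//; apply: integrable_fin_num; first exact: mcirc.
exact: L2_rint.
Qed.

Lemma mxsq_cvg m n (F : nat -> 'M[C]_(m, n)) (A : 'M[C]_(m, n)) :
  (forall i j, complex.Re (F k i j) @[k --> \oo] --> complex.Re (A i j)) ->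
  (forall i j, complex.Im (F k i j) @[k --> \oo] --> complex.Im (A i j)) ->
  mxsq (F k) @[k --> \oo] --> mxsq A.
Proof.
move=> h1 h2; apply: cvg_bigsum => i; apply: cvg_bigsum => j.
rewrite !expr2; under eq_fun do rewrite !expr2.
by apply: cvgD; apply: cvgM.
Qed.

Lemma L2_fast_complete m (F : nat -> mfun R m 1) (c : R) : (forall k, L2 (F k)) ->
  (forall n k, (n <= k)%N -> nrm2 (fun t => F k t - F n t) <= c * 4^-1 ^+ n) ->
  exists2 h, L2 h & forall n, nrm2 (fun t => h t - F n t) <= c * 4^-1 ^+ n.
Proof.
move=> LF Fc.
have LFd n k : L2 (fun t => F k t - F n t) by exact: L2B.
have Fc' k : Rintegral mu circ (fun t => mxsq (F k.+1 t - F k t)) <= pi *+ 2 * c * 4^-1 ^+ k.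
  have := Fc k k.+1 (leqnSn k); rewrite nrm2E -mulrA ler_pdivrMl ?pi2_gt0//.
(* [part] stands for the real and for the imaginary part, treated alike. *)
have step (part : C -> R) : (forall z w, part (z - w) = part z - part w) ->
    (forall z, part z ^+ 2 <= nsq z) ->
    (forall f : mfun R m 1, fmeas f -> forall i, measurable_fun circ (fun t => part (f t i 0))) ->
  forall i : 'I_m, exists2 h : R -> R, measurable_fun circ h &
    aeC (fun t => part (F k t i 0) @[k --> \oo] --> h t).
  move=> pB psq pm i.
  have pi2 k : rint (fun t => (part (F k.+1 t i 0) - part (F k t i 0)) ^+ 2).
    apply: rint_le (L2_rint (LFd k k.+1)) _.
      by apply: measurable_funX; apply: measurable_funB; apply: pm; exact: L2_fmeas.
    move=> t _; rewrite ger0_norm ?sqr_ge0// -pB.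
    have := nsq_le_mxsq (F k.+1 t - F k t) i 0; rewrite !mxE; apply: le_trans; exact: psq.
  apply: (@fast_cauchy_lim (fun k t => part (F k t i 0)) (pi *+ 2 * c)) => //.
    by move=> k; apply: pm; case: (LF k).
  move=> k; apply: le_trans (Fc' k); apply: (le_Rintegral (@mcirc R)).
  - exact: pi2.
  - exact: L2_rint (LFd k k.+1).
  - move=> t _; rewrite -pB.
    have := nsq_le_mxsq (F k.+1 t - F k t) i 0; rewrite !mxE; apply: le_trans; exact: psq.
have /choice[hr hrP] i : exists h, measurable_fun circ h /\
    aeC (fun t => complex.Re (F k t i 0) @[k --> \oo] --> (h t : R)).
  have [||| h h1 h2] := step (@complex.Re R) _ _ _ i; last by exists h.
  - by move=> z w; rewrite !cRI.
  - by move=> z; rewrite lerDl sqr_ge0.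
  - by move=> f mf j; case: (mf j 0).
have /choice[hi hiP] i : exists h, measurable_fun circ h /\
    aeC (fun t => complex.Im (F k t i 0) @[k --> \oo] --> (h t : R)).
  have [||| h h1 h2] := step (@complex.Im R) _ _ _ i; last by exists h.
  - by move=> z w; rewrite !cRI.
  - by move=> z; rewrite lerDr sqr_ge0.
  - by move=> f mf j; case: (mf j 0).
pose h : mfun R m 1 := fun t => \col_i Complex (hr i t) (hi i t).
have mh : fmeas h.
  by move=> i j; split; under eq_fun do rewrite mxE /=; [case: (hrP i)|case: (hiP i)].
have cvF : aeC (fun t => forall i, complex.Re (F k t i 0) @[k --> \oo] --> hr i t /\
                         complex.Im (F k t i 0) @[k --> \oo] --> hi i t).
  by apply: aeC_forall => i; apply: aeC_and; [case: (hrP i)|case: (hiP i)].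
(* Fatou's lemma carries the bound on F k - F n to the limit in k, which also yields h - F n in
   L^2. *)
have fat n : (nu (fun t => h t - F n t)%R <= (pi *+ 2 * (c * 4^-1 ^+ n))%:E)%E.
  have mhn : measurable_fun circ (fun t => mxsq (h t - F n t)).
    apply: mxsq_meas => i j; split; under eq_fun do rewrite !mxE !cRI /=;
     apply: measurable_funB; by [case: (hrP i)|case: (hiP i)|case: (LF n) => /(_ i j)[]].
  apply: le_trans (_ : \int[mu]_(t in circ) limn_einf (fun k => (mxsq (F k t - F n t))%:E) <= _)%E.
    apply: ae_ge0_le_integral.
    - exact: mcirc.
    - by move=> t _; rewrite lee_fin mxsq_ge0.
    - exact/measurable_EFinP.
    - by move=> t _; apply: limn_einf_ge0 => k; rewrite lee_fin mxsq_ge0.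
    - apply: measurable_limn_einf => k; apply/measurable_EFinP.
      by apply: mxsq_meas; case: (LFd n k).
    apply: aeC_imp cvF => t _ ct.
    have e : (fun k => (mxsq (F k t - F n t))%:E) @ \oo --> (mxsq (h t - F n t))%:E.
      apply: cvg_EFin_seq; apply: mxsq_cvg => i j; under eq_fun do rewrite !mxE !cRI.
        rewrite !mxE !cRI /= ord1; apply: cvgB; last exact: cvg_cst.
        by case: (ct i).
      rewrite !mxE !cRI /= ord1; apply: cvgB; last exact: cvg_cst.
      by case: (ct i).
    by have [-> _] := cvg_limn_einf_sup e.
  apply: le_trans (fatou _ _ _ _) _.
  - exact: mcirc.
  - by move=> k; apply/measurable_EFinP; apply: mxsq_meas; case: (LFd n k).
  - by move=> k t _; rewrite lee_fin mxsq_ge0.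
  apply: (@limn_einf_le_cst _ _ n) => k nk; rewrite nuE//.
  by rewrite lee_fin ler_pM2l ?pi2_gt0// Fc.
have Lh n : L2 (fun t => h t - F n t).
  split.
    by move=> i j; split; under eq_fun do rewrite !mxE !cRI /=;
     apply: measurable_funB; by [case: (hrP i)|case: (hiP i)|case: (LF n) => /(_ i j)[]].
  by apply: le_lt_trans (fat n) _; exact: ltry.
exists h.
  have -> : h = (fun t => (h t - F 0%N t) + F 0%N t) by apply/funext => t; rewrite subrK.
  exact: L2D.
by move=> n; have := fat n; rewrite nuE// lee_fin ler_pM2l// pi2_gt0.
Qed.

Lemma L2_complete m (S : nat -> mfun R m 1) : (forall k, L2 (S k)) ->
  (forall e : R, 0 < e -> exists N, forall n k, (N <= n <= k)%N ->
     nrm2 (fun t => S k t - S n t) <= e) ->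
  exists2 h, L2 h & forall e : R, 0 < e -> exists N, forall n, (N <= n)%N ->
     nrm2 (fun t => h t - S n t) <= e.
Proof.
move=> LS SC.
have /choice[phi phiP] (j : nat) : exists N, forall n k, (N <= n <= k)%N ->
    nrm2 (fun t => S k t - S n t) <= 4^-1 ^+ j.
  by apply: SC; rewrite exprn_gt0.
(* Adding up the thresholds gives a monotone subsequence that still lies beyond each of them. *)
pose s j := (\sum_(i < j.+1) phi i)%N.
have phis j : (phi j <= s j)%N by rewrite /s big_ord_recr /= leq_addl.
have s_mono i j : (i <= j)%N -> (s i <= s j)%N.
  move=> ij; rewrite -(subnKC ij) /s -addSn big_split_ord /=.
  exact: leq_addr.
have [h Lh hP] : exists2 h, L2 h & forall n, nrm2 (fun t => h t - S (s n) t) <= 1 * 4^-1 ^+ n.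
  apply: (@L2_fast_complete m (fun j => S (s j))) => // n k nk.
  by rewrite mul1r; apply: phiP; rewrite phis s_mono.
exists h => // e e0.
(* The factor 4 comes from [nrm2D_le] applied to two terms of size at most 4^-j. *)
have [j je] : exists j, 4 * 4^-1 ^+ j <= e.
  have c : (4 * 4^-1 ^+ j : R) @[j --> \oo] --> (4 * 0 : R).
    by apply: cvgMr; apply: cvg_expr; rewrite ger0_norm//; lra.
  rewrite mulr0 in c.
  have := cvgr_le _ c _ e0.
  by case=> j _ /(_ j (leqnn j)) /= ?; exists j.
exists (s j) => n sn; apply: le_trans je.
have -> : (fun t => h t - S n t) = (fun t => (h t - S (s j) t) + - (S n t - S (s j) t)).
  by apply/funext => t; rewrite opprB addrA subrK.
have L1 : L2 (fun t => h t - S (s j) t) by exact: L2B.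
have L1' : L2 (fun t => S n t - S (s j) t) by exact: L2B.
apply: le_trans (nrm2D_le L1 (L2N L1')) _; rewrite nrm2N//.
have := hP j; have := phiP j (s j) n; rewrite phis sn => /(_ isT).
lra.
Qed.

(** Cauchy-Schwarz against a unit exponential. It makes Fourier coefficients continuous for the L^2
    norm. *)
Lemma nrm2_fc_le m (f : mfun R m 1) k i : L2 f -> nsq (fc f k i 0) <= nrm2 f.
Proof.
move=> Lf; pose g : mfun R m 1 := fun t => cexpi (k%:~R * t) *: delta_mx i 0.
have Lg : L2 g by apply: L2_expi; exact: L2_cst.
have cd (v : 'cV[C]_m) : cinner v (delta_mx i 0) = v i 0.
  rewrite /cinner (bigD1 i)//= big1 ?addr0; last first.
    by move=> j /negbTE ji; rewrite mxE ji /= conjc0 mulr0.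
  by rewrite mxE !eqxx /= conjc1 mulr1.
have e : inner f g = fc f k i 0 by rewrite inner_expi// cd.
have eg : nrm2 g = 1.
  by rewrite /nrm2 inner_expi// fc_expi_cst eqxx cd mxE !eqxx.
by have := cauchy_schwarz Lf Lg; rewrite e eg mulr1.
Qed.

Lemma cinner_mxsq m (v : 'cV[C]_m) : cinner v v = rC (mxsq v).
Proof.
rewrite /cinner mxsqE; apply: complex_ext.
  by rewrite Re_sum /=; apply: eq_bigr => i _; rewrite big_ord1 mulCJ.
by rewrite Im_sum big1// => i _; rewrite mulCJ.
Qed.

(** * Fourier series over a set of indices enumerated by [e] *)

Section riesz_fischer.
Variables (m : nat) (u : mfun R m 1) (e : nat -> int).
Hypothesis Lu : L2 u.
Hypothesis ei : injective e.

Definition psum (n : nat) : mfun R m 1 :=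
  fun t => \sum_(j < n) cexpi ((e j)%:~R * t) *: fc u (e j).

Lemma L2_term j : L2 (fun t => cexpi ((e j)%:~R * t) *: fc u (e j)).
Proof. by apply: L2_expi; exact: L2_cst. Qed.

Lemma L2_psum n : L2 (psum n).
Proof. by apply: L2_sum => j; exact: L2_term. Qed.

Lemma fc_psum n k : fc (psum n) k = \sum_(j < n) (if k == e j then fc u (e j) else 0).
Proof.
rewrite fc_sum; last by move=> j; exact: L2_term.
by apply: eq_bigr => j _; rewrite fc_expi_cst.
Qed.

Lemma fc_psum_in n i : (i < n)%N -> fc (psum n) (e i) = fc u (e i).
Proof.
move=> ilt; rewrite fc_psum (bigD1 (Ordinal ilt))//= eqxx big1 ?addr0// => j /eqP ji.
case: eqP => // /ei ij; case: ji; exact: val_inj.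
Qed.
Lemma fc_psum_out n k : (forall j, e j != k) -> fc (psum n) k = 0.
Proof.
by move=> ek; rewrite fc_psum big1// => j _; rewrite eq_sym (negbTE (ek j)).
Qed.

Lemma inner_psum (f : mfun R m 1) n : L2 f ->
  inner f (psum n) = \sum_(j < n) cinner (fc f (e j)) (fc u (e j)).
Proof.
move=> Lf; rewrite inner_sumr//; last by move=> j; exact: L2_term.
by apply: eq_bigr => j _; rewrite inner_expi.
Qed.

Definition bsum n : R := \sum_(j < n) mxsq (fc u (e j)).

Lemma inner_u_psum n : inner u (psum n) = rC (bsum n).
Proof.
rewrite inner_psum//; under eq_bigr do rewrite cinner_mxsq.
by rewrite /bsum; elim/big_rec2: _ => // i y1 y2 _ ->; rewrite -rCD.
Qed.
Lemma inner_psum_le n k : (n <= k)%N -> inner (psum k) (psum n) = rC (bsum n).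
Proof.
move=> nk; rewrite inner_psum; last exact: L2_psum.
have := inner_u_psum n; rewrite inner_psum// => <-; apply: eq_bigr => j _.
by rewrite fc_psum_in// (leq_trans (ltn_ord j)).
Qed.
Lemma nrm2_psum n : nrm2 (psum n) = bsum n.
Proof. by rewrite /nrm2 inner_psum_le. Qed.
Lemma nrm2_psumB n k : (n <= k)%N ->
  nrm2 (fun t => psum k t - psum n t) = bsum k - bsum n.
Proof.
move=> nk; rewrite nrm2B; [|exact: L2_psum..].
by rewrite !nrm2_psum inner_psum_le//=; ring.
Qed.
Lemma bessel n : bsum n <= nrm2 u.
Proof.
have := nrm2_ge0 (fun t => u t - psum n t); rewrite nrm2B//; last exact: L2_psum.
by rewrite nrm2_psum inner_u_psum Re_rC; lra.
Qed.
Lemma bsum_mono n k : (n <= k)%N -> bsum n <= bsum k.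
Proof. by move=> nk; rewrite -subr_ge0 -nrm2_psumB// nrm2_ge0. Qed.

(** The enumeration selects a part of the spectrum: [Negz] produces the projection onto K^2, [Posz]
    the approximation of an H^2 function by its partial sums. *)
Lemma riesz_fischer : exists h, [/\ L2 h,
  forall k : nat, fc h (e k) = fc u (e k),
  forall k, (forall j, e j != k) -> fc h k = 0 &
  forall d : R, 0 < d -> exists N, forall n, (N <= n)%N ->
    nrm2 (fun t => h t - psum n t) <= d].
Proof.
have [||h Lh hP] := @L2_complete m psum.
- exact: L2_psum.
(* [bsum] increases and is bounded by Bessel's inequality; beyond an index where it is within d of
   its supremum, the partial sums differ by at most d in squared norm. *)
- move=> d d0; have hs : has_sup (range bsum).
    by split; [exists (bsum 0), 0%N|exists (nrm2 u) => _ [n _ <-]; exact: bessel].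
  have [_ [N _ <-] hN] := sup_adherent d0 hs.
  exists N => n k /andP[Nn nk]; rewrite nrm2_psumB//.
  have : bsum k <= sup (range bsum) by apply: ub_le_sup; [case: hs|exists k].
  by have := bsum_mono Nn; lra.
have close k v : (exists N, forall n, (N <= n)%N -> fc (psum n) k = v) -> fc h k = v.
  move=> [N NP]; apply/matrixP => i j; rewrite ord1; apply/eqP; rewrite -subr_eq0; apply/eqP.
  apply: nsq_eq0; apply/eqP; rewrite eq_le nsq_ge0 andbT.
  apply/ler_addgt0Pr => d d0; rewrite add0r.
  have [N' N'P] := hP d d0.
  have := @nrm2_fc_le m (fun t => h t - psum (maxn N N') t) k i (L2B Lh (L2_psum _)).
  rewrite fcB//; last exact: L2_psum.
  rewrite NP ?leq_maxl// !mxE => /le_trans; apply; apply: N'P; exact: leq_maxr.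
exists h; split => //.
- by move=> k; apply: close; exists k.+1 => n kn; exact: fc_psum_in.
- by move=> k ek; apply: close; exists 0%N => n _; exact: fc_psum_out.
Qed.
End riesz_fischer.

(** The series over the negative indices is a decomposition, so the choice in [Pminus] never falls
    back on [zf] here. *)
Lemma PminusP m (u : mfun R m 1) : L2 u ->
  K2 (Pminus u) /\ H2 (fun t => u t - Pminus u t).
Proof.
move=> Lu; rewrite /Pminus /pickd; case: pselect => [h|]; first exact: (proj2_sig (cid h)).
case; have [h [Lh h1 h2 _]] := @riesz_fischer m u Negz Lu ltac:(by move=> i j []).
exists h; split; split => //.
- by case=> // k _; apply: h2.
- exact: L2B.
- by case=> // k _; rewrite fcB// h1 subrr.
Qed.

(** The series converges to some h with the same coefficients as f, and Fourier uniqueness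
    identifies h with f. *)
Lemma H2_approx m (f : mfun R m 1) : H2 f -> forall d : R, 0 < d ->
  exists N, forall n, (N <= n)%N ->
    nrm2 (fun t => f t - \sum_(j < n) cexpi ((j%:Z)%:~R * t) *: fc f j%:Z) <= d.
Proof.
move=> [Lf f0] d d0.
have [h [Lh h1 h2 h3]] := @riesz_fischer m f Posz Lf ltac:(by move=> i j []).
have hf : aeq f h.
  apply/aeqB0; apply: fourier_uniqueness; first exact: L2B.
  move=> k; rewrite fcB//; case: k => k; first by rewrite h1 subrr.
  by rewrite f0// h2// subrr.
have [N NP] := h3 d d0; exists N => n Nn; apply: le_trans (NP n Nn).
rewrite le_eqVlt; apply/orP; left; apply/eqP; apply: nrm2_aeq.
- by apply: L2B => //; apply: L2_sum => j; apply: L2_expi; exact: L2_cst.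
- by apply: L2B => //; apply: L2_psum.
- by apply: aeqB => //; exact: aeq_refl.
Qed.

(** Partial sums of f are orthogonal to g coefficient by coefficient; Cauchy-Schwarz passes to the
    limit. *)
Lemma H2_K2_orth m (f g : mfun R m 1) : H2 f -> K2 g -> inner f g = 0.
Proof.
move=> Hf [Lg g0]; have [Lf _] := Hf.
apply: nsq_eq0; apply/eqP; rewrite eq_le nsq_ge0 andbT.
apply/ler_addgt0Pr => d d0; rewrite add0r.
(* The summand 1 keeps the denominator positive when g vanishes. *)
have d1 : 0 < d / (nrm2 g + 1).
  by rewrite divr_gt0// ltr_wpDl// nrm2_ge0.
have [N /(_ N (leqnn N)) NP] := H2_approx Hf d1.
pose s : mfun R m 1 := fun t => \sum_(j < N) cexpi ((j%:Z)%:~R * t) *: fc f j%:Z.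
rewrite -/s in NP.
have Ls : L2 s by apply: L2_sum => j; apply: L2_expi; exact: L2_cst.
have sg : inner s g = 0.
  rewrite innerC// inner_sumr//; last by move=> j; apply: L2_expi; exact: L2_cst.
  rewrite big1 ?conjc0// => j _; rewrite inner_expi// g0// /cinner big1// => i _.
  by rewrite mxE mul0r.
have -> : inner f g = inner (fun t => f t - s t) g by rewrite innerBl// sg subr0.
apply: le_trans (cauchy_schwarz (L2B Lf Ls) Lg) _.
apply: le_trans (_ : d / (nrm2 g + 1) * nrm2 g <= _).
  by rewrite ler_wpM2r// nrm2_ge0.
rewrite -mulrA ler_piMr// ?(ltW d0)// mulrC ler_pdivrMr; last by rewrite ltr_wpDl// nrm2_ge0.
by rewrite mul1r lerDl.
Qed.

End completeness.

(** * State-space identities *)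
Section conjugate_transpose.
Variable R : realType.
Local Notation C := R[i].

Definition ctr m n (A : 'M[C]_(m, n)) : 'M[C]_(n, m) := (map_mx conjc A)^T.

Lemma ctrE m n (A : 'M[C]_(m, n)) i j : ctr A i j = conjc (A j i).
Proof. by rewrite !mxE. Qed.
Lemma ctrM m n p (A : 'M[C]_(m, n)) (B : 'M[C]_(n, p)) :
  ctr (A *m B) = ctr B *m ctr A.
Proof. by rewrite /ctr map_mxM trmx_mul. Qed.
Lemma ctrD m n (A B : 'M[C]_(m, n)) : ctr (A + B) = ctr A + ctr B.
Proof. by rewrite /ctr map_mxD linearD. Qed.
Lemma ctrN m n (A : 'M[C]_(m, n)) : ctr (- A) = - ctr A.
Proof. by rewrite /ctr map_mxN linearN. Qed.
Lemma ctrB m n (A B : 'M[C]_(m, n)) : ctr (A - B) = ctr A - ctr B.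
Proof. by rewrite ctrD ctrN. Qed.
Lemma ctrZ m n (z : C) (A : 'M[C]_(m, n)) : ctr (z *: A) = conjc z *: ctr A.
Proof. by apply/matrixP => i j; rewrite ctrE !mxE conjcM. Qed.
Lemma ctrK m n (A : 'M[C]_(m, n)) : ctr (ctr A) = A.
Proof. by apply/matrixP => i j; rewrite !ctrE conjcK. Qed.
Lemma ctr_scalar n (z : C) : ctr (z%:M : 'M[C]_n) = (conjc z)%:M.
Proof. by rewrite /ctr map_scalar_mx tr_scalar_mx. Qed.
Lemma ctr1 n : ctr (1%:M : 'M[C]_n) = 1%:M.
Proof. by rewrite ctr_scalar conjc1. Qed.
Lemma ctr_unit n (A : 'M[C]_n) : (ctr A \in unitmx) = (A \in unitmx).
Proof. by rewrite /ctr unitmx_tr map_unitmx. Qed.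
Lemma ctr_inv n (A : 'M[C]_n) : ctr (invmx A) = invmx (ctr A).
Proof. by rewrite /ctr map_invmx trmx_inv. Qed.

Lemma ctr_mulE m (u v : 'cV[C]_m) : (ctr v *m u) 0 0 = cinner u v.
Proof. by rewrite mxE; apply: eq_bigr => i _; rewrite ctrE mulrC. Qed.
Lemma ctr_mul_mxsq m (v : 'cV[C]_m) : (ctr v *m v) 0 0 = rC (mxsq v).
Proof.
rewrite ctr_mulE /cinner mxsqE; apply: complex_ext.
  by rewrite Re_sum /=; apply: eq_bigr => i _; rewrite big_ord1 mulCJ.
by rewrite Im_sum big1// => i _; rewrite mulCJ.
Qed.

Lemma mulmx_inj_unit n (A : 'M[C]_n) :
  (forall x : 'cV[C]_n, A *m x = 0 -> x = 0) -> A \in unitmx.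
Proof.
move=> h; rewrite -unitmx_tr -row_free_unit -kermx_eq0; apply/eqP/row_matrixP => i.
rewrite row0; apply: trmx_inj; rewrite trmx0; apply: h.
by rewrite -{1}[A]trmxK -trmx_mul -row_mul mulmx_ker row0 trmx0.
Qed.

Lemma unit_lcancel m n (U : 'M[C]_m) (X Y : 'M[C]_(m, n)) :
  U \in unitmx -> U *m X = U *m Y -> X = Y.
Proof. by move=> u /(congr1 (mulmx (invmx U))); rewrite !mulKmx. Qed.

Definition qf n (P : 'M[C]_n) (x : 'cV[C]_n) : R := complex.Re ((ctr x *m P *m x) 0 0).

Lemma qf_scalar n (a : R) (x : 'cV[C]_n) : qf (rC a)%:M x = a * mxsq x.
Proof.
rewrite /qf mul_mx_scalar -scalemxAl mxE ctr_mul_mxsq.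
by rewrite cRe_rCM.
Qed.
Lemma qfD n (P P' : 'M[C]_n) x : qf (P + P') x = qf P x + qf P' x.
Proof. by rewrite /qf mulmxDr mulmxDl mxE cReD. Qed.
Lemma qfN n (P : 'M[C]_n) x : qf (- P) x = - qf P x.
Proof. by rewrite /qf mulmxN mulNmx mxE cReN. Qed.
Lemma qfB n (P P' : 'M[C]_n) x : qf (P - P') x = qf P x - qf P' x.
Proof. by rewrite qfD qfN. Qed.
Lemma qf_conj m n (P : 'M[C]_n) (A : 'M[C]_(m, n)) x :
  qf (A *m P *m ctr A) x = qf P (ctr A *m x).
Proof. by rewrite /qf ctrM ctrK !mulmxA. Qed.
Lemma qf_gram m n (A : 'M[C]_(m, n)) x : qf (A *m ctr A) x = mxsq (ctr A *m x).
Proof.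
rewrite -[A in qf (A *m _)]mulmx1 qf_conj (_ : 1%:M = (rC 1)%:M)// qf_scalar.
by rewrite mul1r.
Qed.
Lemma qfZ n (P : 'M[C]_n) (z : C) x : qf P (z *: x) = nsq z * qf P x.
Proof.
by rewrite /qf ctrZ -!scalemxAl -!scalemxAr scalerA mxE [conjc z * z]mulrC mulCJ cRe_rCM.
Qed.
Lemma qf_sub n (P : 'M[C]_n) (x y : 'cV[C]_n) : ctr P = P ->
  qf P (x - y) = qf P x + qf P y - 2 * complex.Re ((ctr y *m P *m x) 0 0).
Proof.
move=> hP; have e : complex.Re ((ctr x *m P *m y) 0 0) = complex.Re ((ctr y *m P *m x) 0 0).
  by rewrite -[RHS]cReJ -ctrE !ctrM ctrK hP mulmxA.
rewrite /qf ctrB !mulmxBl !mulmxBr.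
move: e; move: (ctr x *m P *m x) (ctr x *m P *m y) => a b.
move: (ctr y *m P *m x) (ctr y *m P *m y) => c d e.
by rewrite !mxE !cRI e; ring.
Qed.

Lemma qfZl n (a : R) (P : 'M[C]_n) x : qf (rC a *: P) x = a * qf P x.
Proof. by rewrite /qf -scalemxAr -scalemxAl mxE cRe_rCM. Qed.

(** For w = P x the form at x - s w is s^2 <P w, w> - 2 s |w|^2, nonnegative for every real s; this
    forces w = 0. When <P w, w> > 0 the minimizing s is used. *)
Lemma psd_ker n (P : 'M[C]_n) x : ctr P = P -> (forall y, 0 <= qf P y) ->
  qf P x = 0 -> P *m x = 0.
Proof.
move=> hP psd x0; apply: mxsq_eq0; set w := P *m x.
have w0 := mxsq_ge0 w.
have h (s : R) : 0 <= s ^+ 2 * qf P w - 2 * s * mxsq w.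
  have := psd (x - rC s *: w); rewrite qf_sub// x0 add0r qfZ.
  rewrite ctrZ -!scalemxAl -mulmxA -/w mxE ctr_mul_mxsq conjc_rC.
  by rewrite cRe_rCM /= {1}/nsq /= expr0n addr0 mulrA.
have [wP|wP] := eqVneq (qf P w) 0.
  by have := h 1; rewrite wP; lra.
have wp : 0 < qf P w by rewrite lt_def wP psd.
have := h (mxsq w / qf P w).
rewrite (_ : _ - _ = - (mxsq w ^+ 2 / qf P w)); last by field.
rewrite oppr_ge0 pmulr_lle0 ?invr_gt0// => h'; apply/eqP.
by rewrite -sqrf_eq0 eq_le h' sqr_ge0.
Qed.

(** Expanding the square leaves |A A^* y|^2, bounded by |A^* y|^2 for a contraction. Besides the
    sign of |y|^2 - |A^* y|^2 it gives the equality case y = A A^* y. *)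
Lemma ctr_herm_qf m (A : 'M[C]_m) : (forall x : 'cV[C]_m, mxsq (A *m x) <= mxsq x) ->
  forall y : 'cV[C]_m, mxsq (y - A *m (ctr A *m y)) <= mxsq y - mxsq (ctr A *m y).
Proof.
move=> hA y; have := qf_sub y (A *m (ctr A *m y)) (ctr1 m).
have q1 (x : 'cV[C]_m) : qf 1%:M x = mxsq x.
  by rewrite (_ : 1%:M = (rC 1)%:M)// qf_scalar mul1r.
rewrite !q1 => ->; have := hA (ctr A *m y).
rewrite mulmx1 [ctr (A *m _)]ctrM -mulmxA ctr_mul_mxsq /=; lra.
Qed.

(** All eigenvalues lie in the open unit disc, phrased through eigenvectors because that is how it
    is proved. *)
Definition stable n (A : 'M[C]_n) :=
  forall (mu : C) (x : 'cV[C]_n), 1 <= nsq mu -> A *m x = mu *: x -> x = 0.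

Lemma stable_unit_sub n (A : 'M[C]_n) (z : C) : stable A -> 1 <= nsq z ->
  z%:M - A \in unitmx.
Proof.
move=> sA z1; apply: mulmx_inj_unit => x; rewrite mulmxBl mul_scalar_mx.
by move/eqP; rewrite subr_eq0 eq_sym => /eqP; exact: sA.
Qed.
Lemma stable_unit n (A : 'M[C]_n) (z : C) : stable A -> nsq z <= 1 ->
  1%:M - z *: A \in unitmx.
Proof.
move=> sA z1; apply: mulmx_inj_unit => x; rewrite mulmxBl mul1mx -scalemxAl.
move/eqP; rewrite subr_eq0 => /eqP e.
have [z0|z0] := eqVneq z 0; first by rewrite e z0 scale0r.
apply: (sA z^-1); last by rewrite [in RHS]e scalerA mulVf// scale1r.
have nz : 0 < nsq z.
  by rewrite lt_def nsq_ge0 andbT; apply: contra_neq z0; exact: nsq_eq0.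
rewrite -(ler_pM2l nz) mulr1 -nsqM mulfV//.
by rewrite [leRHS]/nsq /= expr1n expr0n addr0.
Qed.
Lemma stable_ctr_unit n (A : 'M[C]_n) (z : C) : stable A -> nsq z <= 1 ->
  1%:M - z *: ctr A \in unitmx.
Proof.
move=> sA z1; rewrite -ctr_unit ctrB ctr1 ctrZ ctrK; apply: stable_unit => //.
by rewrite nsqJ.
Qed.
End conjugate_transpose.

Section expansions.
Variables (R : realType) (n : nat).
Implicit Types U V D Q : 'M[R[i]]_n.

(** Used with U = z - A on the circle, where D is 1 - A^* A = C^* C; in [gramR_gen] D is Q - A Q A^*
    = B B^* instead. Between resolvents both leave three terms of the same kind, which is what makes
    the two Gram matrices comparable. *)
Lemma gramL_gen U V Uc Vc A Ac D : U *m V = 1%:M -> Vc *m Uc = 1%:M ->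
  D = Uc *m U + Uc *m A + Ac *m U -> Vc *m D *m V = 1%:M + A *m V + Vc *m Ac.
Proof.
move=> UV VU ->; rewrite !mulmxDr !mulmxDl !mulmxA VU !mul1mx UV.
by rewrite -[Vc *m Ac *m U *m V]mulmxA UV mulmx1.
Qed.
Lemma gramR_gen U V Uc Vc A Ac D Q : V *m U = 1%:M -> Uc *m Vc = 1%:M ->
  D = U *m Q *m Uc + A *m Q *m Uc + U *m (Q *m Ac) ->
  V *m D *m Vc = Q + V *m A *m Q + Q *m Ac *m Vc.
Proof.
move=> VU UV ->; rewrite !mulmxDr !mulmxDl !mulmxA VU !mul1mx.
by rewrite -[Q *m Uc *m Vc]mulmxA -[_ *m Q *m Uc *m Vc]mulmxA UV !mulmx1.
Qed.
End expansions.

(* [Ac], [Bc], [Cc], [Yc] play the roles of the conjugate transposes of [A], [B], [Cq],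
   [Y], and [S1], [S2], [V], [Vc] those of [(1 - z A^* )^-1], [(1 - z T)^-1],
   [(z - A)^-1], [(w - A^* )^-1] with [w] the conjugate of [z]; only the one-sided
   inverse relations listed are needed. *)
Section transfer.
Variable R : realType.
Local Notation C := R[i].
Variables (n p q : nat) (z g : C).
Variables (A Ac Q T S1 S2 V Vc : 'M[C]_n) (B Y : 'M[C]_(n, p)) (Bc Yc : 'M[C]_(p, n)).
Variables (Cq : 'M[C]_(q, n)) (Cc : 'M[C]_(n, q)).
Hypothesis BY : Bc *m Y = 1%:M.
Hypothesis TE : T = Ac - Ac *m Y *m Bc.
Hypothesis S1V : (1%:M - z *: Ac) *m S1 = 1%:M.
Hypothesis S1K : S1 *m (1%:M - z *: Ac) = 1%:M.
Hypothesis S2V : (1%:M - z *: T) *m S2 = 1%:M.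

(** Resolvent identity: 1 - z A^* and 1 - z T differ by the product z A^* Y B^*. *)
Lemma transfer_X : S1 *m (Ac *m Y) *m (1%:M - z *: (Bc *m (S2 *m (Ac *m Y)))) =
  S2 *m (Ac *m Y).
Proof.
have e2 : (1%:M - z *: Ac) *m (S2 *m (Ac *m Y)) =
    Ac *m Y - z *: (Ac *m Y *m Bc *m (S2 *m (Ac *m Y))).
  have -> : 1%:M - z *: Ac = 1%:M - z *: T - z *: (Ac *m Y *m Bc).
    by rewrite TE scalerBr opprB addrA addrAC addrK.
  by rewrite mulmxBl [(1%:M - _) *m (S2 *m _)]mulmxA S2V mul1mx -scalemxAl.
rewrite -[RHS]mul1mx -S1K -[RHS]mulmxA e2 -mulmxA; congr (_ *m _).
by rewrite mulmxBr mulmx1 -scalemxAr !mulmxA.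
Qed.

Lemma transfer_inv : (1%:M + z *: (Bc *m (S1 *m (Ac *m Y)))) *m
  (1%:M - z *: (Bc *m (S2 *m (Ac *m Y)))) = 1%:M.
Proof. by rewrite mulmxDl mul1mx -scalemxAl -mulmxA transfer_X subrK. Qed.

(** The identity is absorbed as B^* Y = 1, and S1 = 1 + z S1 A^*. In this form M is recognised below
    as the value of the functions W^* on the columns of Y. *)
Lemma transfer_M : 1%:M + z *: (Bc *m (S1 *m (Ac *m Y))) = Bc *m (S1 *m Y).
Proof.
rewrite -{1}BY scalemxAr -mulmxDr; congr (_ *m _).
have e : S1 *m ((1%:M - z *: Ac) *m Y) = Y by rewrite mulmxA S1K mul1mx.
by rewrite -{1}e mulmxBl mul1mx mulmxBr -scalemxAl -scalemxAr subrK.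
Qed.

Lemma transfer_S1A : S1 *m Ac = Ac *m S1.
Proof.
have c : Ac *m (1%:M - z *: Ac) = (1%:M - z *: Ac) *m Ac.
  by rewrite mulmxBr mulmxBl mulmx1 mul1mx -scalemxAl -scalemxAr.
by rewrite -[LHS]mulmx1 -S1V mulmxA -[S1 *m _ *m _]mulmxA c mulmxA S1K mul1mx.
Qed.

Hypothesis BBE : B *m Bc = Q - A *m Q *m Ac.
Hypothesis QY : Q *m Y = g *: Y.
Hypothesis VU : V *m (z%:M - A) = 1%:M.

(** Writing B B^* = (z - A) Q A^* + Q (1 - z A^* ) splits (z - A)^-1 B B^* (1 - z A^* )^-1 into
    partial fractions; the coanalytic one simplifies by Q Y = g Y. The result reads Phi M = G_- M +
    N. *)
Lemma transfer_interp : g *: (Cq *m V *m Y) =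
  Cq *m V *m B *m (Bc *m (S1 *m Y)) - Cq *m Q *m (S1 *m (Ac *m Y)).
Proof.
have D : B *m Bc = (z%:M - A) *m (Q *m Ac) + Q *m (1%:M - z *: Ac).
  rewrite BBE mulmxBl mulmxBr mulmx1 mul_scalar_mx -scalemxAr mulmxA.
  by rewrite addrACA [- (A *m _ *m _) + _]addrC addrACA subrr add0r.
have e : V *m (B *m Bc) *m S1 = Q *m Ac *m S1 + V *m Q.
  rewrite D mulmxDr mulmxDl mulmxA VU mul1mx; congr (_ + _).
  by rewrite -!mulmxA S1V mulmx1.
have -> : Cq *m V *m B *m (Bc *m (S1 *m Y)) = Cq *m (V *m (B *m Bc) *m S1) *m Y.
  by rewrite !mulmxA.
rewrite e mulmxDr mulmxDl.
have -> : Cq *m (V *m Q) *m Y = g *: (Cq *m V *m Y).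
  by rewrite -!mulmxA QY -!scalemxAr.
by rewrite [S1 *m (_ *m _)]mulmxA transfer_S1A !mulmxA addrAC subrr add0r.
Qed.

Variable w : C.
Hypothesis zw : w * z = 1.
Hypothesis S1E : S1 = w *: Vc.
Hypothesis UV : (z%:M - A) *m V = 1%:M.
Hypothesis VcU : Vc *m (w%:M - Ac) = 1%:M.
Hypothesis UVc : (w%:M - Ac) *m Vc = 1%:M.
Hypothesis CE : Ac *m A + Cc *m Cq = 1%:M.
Hypothesis YQ : Yc *m Q = g *: Yc.

(** Source of Phi^* Phi = gamma^2. Both sides expand into the three terms 1, A (z - A)^-1 and its
    adjoint between Y^* and Y, and Q acts as g on Y from either side. *)
Lemma transfer_gram : g *: (Yc *m (Vc *m Cc) *m (Cq *m V *m Y)) =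
  Yc *m (z *: V *m B) *m (Bc *m (S1 *m Y)).
Proof.
have VA : V *m A = A *m V.
  have c : A *m (z%:M - A) = (z%:M - A) *m A.
    by rewrite mulmxBr mulmxBl mul_scalar_mx mul_mx_scalar.
  by rewrite -[LHS]mulmx1 -UV mulmxA -[V *m _ *m _]mulmxA c mulmxA VU mul1mx.
have VAc : Vc *m Ac = Ac *m Vc.
  have c : Ac *m (w%:M - Ac) = (w%:M - Ac) *m Ac.
    by rewrite mulmxBr mulmxBl mul_scalar_mx mul_mx_scalar.
  by rewrite -[LHS]mulmx1 -UVc mulmxA -[Vc *m _ *m _]mulmxA c mulmxA VcU mul1mx.
have eL : Vc *m (Cc *m Cq) *m V = 1%:M + A *m V + Vc *m Ac.
  apply: gramL_gen UV VcU _.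
  rewrite -mulmxDr subrK mul_mx_scalar scalerBr scale_scalar_mx [z * w]mulrC zw.
  rewrite mulmxBr mul_mx_scalar.
  by rewrite addrA subrK -CE [_ + Cc *m _]addrC addrK.
have eR : V *m (B *m Bc) *m Vc = Q + V *m A *m Q + Q *m Ac *m Vc.
  apply: gramR_gen VU UVc _.
  rewrite BBE -mulmxDl -mulmxDl subrK mul_scalar_mx mulmxBr mul_mx_scalar.
  rewrite scalerA zw scale1r -scalemxAl mulmxBl mul_scalar_mx !mulmxA.
  by rewrite addrA subrK.
transitivity (g *: (Yc *m (Vc *m (Cc *m Cq) *m V) *m Y)); first by rewrite !mulmxA.
transitivity (Yc *m (V *m (B *m Bc) *m Vc) *m Y); last first.
  have -> : Yc *m (z *: V *m B) = z *: (Yc *m (V *m B)) by rewrite -scalemxAl -scalemxAr.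
  have -> : Bc *m (S1 *m Y) = w *: (Bc *m (Vc *m Y)).
    by rewrite S1E -scalemxAl -scalemxAr.
  by rewrite -scalemxAl -scalemxAr scalerA [z * w]mulrC zw scale1r !mulmxA.
rewrite eL eR VAc !mulmxDr !mulmxDl !scalerDr mulmx1; congr (_ + _ + _).
- by rewrite YQ scalemxAl.
- by rewrite -VA -!mulmxA QY -!scalemxAr.
- by rewrite !mulmxA YQ -!scalemxAl.
Qed.
End transfer.

(* In an orthonormal basis of X the paper's operators are
   Z = [A], WE = [B], Pi = [Cq], WW^* = [Q], Xi = [Xm], Delta = [Dm],
   Delta^-1 WE = [Ym], Z^* Delta^-1 Xi = [Tm], with gamma^2 = [g2]. *)
Section state_space.
Variable R : realType.
Local Notation C := R[i].
Variables (n p q : nat) (A : 'M[C]_n) (B : 'M[C]_(n, p)) (Cq : 'M[C]_(q, n)).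
Variables (Q : 'M[C]_n) (g2 : R) (K : 'M[C]_(n, p)).

Definition Xm := (rC g2)%:M - Q.
Definition Dm := (rC g2)%:M - A *m Q *m ctr A.
Definition Ym := invmx Dm *m B.
Definition Tm := ctr A *m (invmx Dm *m Xm).

Hypothesis g2_ge0 : 0 <= g2.
Hypothesis Qherm : ctr Q = Q.
Hypothesis QE : Q = A *m Q *m ctr A + B *m ctr B.
Hypothesis CE : ctr A *m A + ctr Cq *m Cq = 1%:M.
Hypothesis stA : stable A.
Hypothesis psd : forall x, 0 <= qf Xm x.
Hypothesis Dinj : forall x : 'cV[C]_n, Dm *m x = 0 -> x = 0.
Hypothesis QK : Q *m K = rC g2 *: K.
Hypothesis Kinj : forall v : 'cV[C]_p, K *m v = 0 -> v = 0.

Lemma Dm_unit : Dm \in unitmx. Proof. exact: mulmx_inj_unit. Qed.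

Lemma DmE : Dm = Xm + B *m ctr B.
Proof.
rewrite /Dm /Xm; have -> : A *m Q *m ctr A = Q - B *m ctr B by rewrite {2}QE addrK.
by rewrite opprB addrA addrAC.
Qed.

Lemma BBE : B *m ctr B = Q - A *m Q *m ctr A.
Proof. by rewrite {1}QE addrAC subrr add0r. Qed.

Lemma DmE2 : Dm = rC g2 *: (1%:M - A *m ctr A) + A *m Xm *m ctr A.
Proof.
rewrite /Xm mulmxBr mulmxBl mul_mx_scalar -scalemxAl scalerBr scalemx1.
by rewrite addrA subrK.
Qed.

Lemma A_contr (x : 'cV[C]_n) : mxsq (A *m x) <= mxsq x.
Proof.
have := qf_scalar 1 x; rewrite mul1r => <-; rewrite (_ : (rC 1)%:M = 1%:M)//.
have e m (M : 'M[C]_(m, n)) : qf (ctr M *m M) x = mxsq (M *m x).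
  by have := qf_gram (ctr M) x; rewrite ctrK.
by rewrite -CE qfD !e lerDl mxsq_ge0.
Qed.

Lemma Xm_herm : ctr Xm = Xm.
Proof. by rewrite ctrB ctr_scalar conjc_rC Qherm. Qed.

Lemma Tm_stable : stable Tm.
Proof.
(* With [y = Delta^-1 Xi x] and [A^* y = mu x], computing [<Delta y, y>] in two ways
   gives [(1 - |mu|^2) <Xi x, x> = <Xi (x - y), x - y> + |B^* y|^2
   + g2 (|y|^2 - |A^* y|^2)], a sum of nonnegative terms. *)
move=> mu x mu1 Tx; set y := invmx Dm *m (Xm *m x).
have Ay : ctr A *m y = mu *: x by rewrite -Tx /Tm -!mulmxA.
have Dy : Dm *m y = Xm *m x by rewrite mulKVmx ?Dm_unit.
have x0 : Xm *m x = 0 -> x = 0.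
  move=> e; have y0 : y = 0 by rewrite /y e mulmx0.
  move: Ay; rewrite y0 mulmx0 => /esym/eqP; rewrite scaler_eq0 => /orP[/eqP m0|/eqP//].
  by move: mu1; rewrite m0 /nsq /= expr0n addr0 ler10.
set a := qf Xm x; have a0 : 0 <= a := psd x.
set b := qf Dm y.
have b1 : b = qf Xm y + mxsq (ctr B *m y) by rewrite /b DmE qfD qf_gram.
have b2 : b = complex.Re ((ctr y *m Xm *m x) 0 0) by rewrite /b /qf -!mulmxA Dy.
have b3 : b = g2 * (mxsq y - mxsq (ctr A *m y)) + nsq mu * a.
  rewrite /b DmE2 qfD qf_conj Ay qfZ scalerBr scalemx1 qfB qf_scalar; congr (_ + _).
  by rewrite qfZl qf_gram -mulrBr Ay.
have c1 : qf Xm (x - y) = a - b - mxsq (ctr B *m y).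
  have -> : mxsq (ctr B *m y) = b - qf Xm y by rewrite b1 addrAC subrr add0r.
  by rewrite qf_sub ?Xm_herm// -b2 -/a; ring.
have c1p := psd (x - y); have Bp := mxsq_ge0 (ctr B *m y).
have Ap := ctr_herm_qf A_contr y; have Ap0 := mxsq_ge0 (y - A *m (ctr A *m y)).
have gp : 0 <= g2 * (mxsq y - mxsq (ctr A *m y)) by rewrite mulr_ge0// (le_trans Ap0 Ap).
have mua : a <= nsq mu * a by rewrite ler_peMl.
have [e1 e2 e3] : [/\ qf Xm (x - y) = 0,
    g2 * (mxsq y - mxsq (ctr A *m y)) = 0 & nsq mu * a = a].
  move: c1 c1p Bp gp mua b3; clear; clearbody a b.
  move: (qf Xm (x - y)) (mxsq (ctr B *m y)) (g2 * (mxsq y - mxsq (ctr A *m y))) (nsq mu * a).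
  by move=> r1 r2 r3 r4 *; split; lra.
have Xxy : Xm *m x = Xm *m y.
  by apply/eqP; rewrite -subr_eq0 -mulmxBr psd_ker// Xm_herm.
apply: x0; have [a00|an0] := eqVneq a 0; first by apply: psd_ker; rewrite ?Xm_herm.
have mu2 : nsq mu = 1 by apply: (mulIf an0); rewrite mul1r.
(* Equality everywhere makes Xi x an eigenvector of A for the conjugate of mu, of modulus 1, unless
   it is zero; stability of A excludes the former. *)
apply: (stA (mu := conjc mu)); first by rewrite nsqJ mu2.
have eX : Xm *m x = mu *: (A *m (Xm *m x)).
  rewrite -{1}Dy DmE2 mulmxDl -!mulmxA Ay -!scalemxAr -[RHS]add0r; congr (_ + _).
  have [g0|gn0] := eqVneq g2 0.
    by rewrite g0 (_ : rC 0 = 0)// scale0r mul0mx.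
  have ey : y = A *m (ctr A *m y).
    apply/eqP; rewrite -subr_eq0; apply/eqP; apply: mxsq_eq0; apply/eqP.
    rewrite eq_le Ap0 andbT; apply: le_trans Ap _.
    by move/eqP: e2; rewrite mulf_eq0 (negbTE gn0) => /eqP ->.
  by rewrite -scalemxAl mulmxBl mul1mx -mulmxA -ey subrr scaler0.
by rewrite [in RHS]eX scalerA [conjc mu * mu]mulrC mulCJ mu2 scale1r.
Qed.

(** Since Xi K = 0 and Delta = Xi + B B^*, one has Delta K = B (B^* K): a kernel vector of B^* K is
    sent by K into the kernel of Delta. *)
Lemma BK_unit : ctr B *m K \in unitmx.
Proof.
apply: mulmx_inj_unit => v; rewrite -mulmxA => e; apply: Kinj; apply: Dinj.
rewrite DmE mulmxDl -[B *m _ *m _]mulmxA e mulmx0 addr0.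
by rewrite mulmxBl mul_scalar_mx mulmxA QK -scalemxAl subrr.
Qed.

(** The relation Delta K = B (B^* K) solved for Delta^-1 B; Y is the basis K of the eigenspace
    normalised by B^* Y = 1. *)
Lemma YmE : Ym = K *m invmx (ctr B *m K).
Proof.
rewrite /Ym; apply: (unit_lcancel Dm_unit); rewrite mulKVmx ?Dm_unit//.
rewrite mulmxA DmE mulmxDl mulmxBl mul_scalar_mx QK subrr add0r -mulmxA.
by rewrite -[RHS]mulmxA [ctr B *m (_ *m _)]mulmxA mulmxV ?BK_unit// mulmx1.
Qed.

Lemma QY : Q *m Ym = rC g2 *: Ym.
Proof. by rewrite YmE mulmxA QK scalemxAl. Qed.
Lemma BY : ctr B *m Ym = 1%:M.
Proof. by rewrite YmE mulmxA mulmxV ?BK_unit. Qed.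

Lemma TmE : Tm = ctr A - ctr A *m Ym *m ctr B.
Proof.
rewrite /Tm (_ : Xm = Dm - B *m ctr B); last by rewrite DmE addrK.
by rewrite mulmxBr mulVmx ?Dm_unit// mulmxBr mulmx1 /Ym !mulmxA.
Qed.

Lemma YQ : ctr Ym *m Q = rC g2 *: ctr Ym.
Proof. by rewrite -{1}Qherm -ctrM QY ctrZ conjc_rC. Qed.

Section point.
Variable z : C.
Hypothesis z1 : nsq z <= 1.

Definition S1 := invmx (1%:M - z *: ctr A).
Definition S2 := invmx (1%:M - z *: Tm).
Definition X1 := S1 *m (ctr A *m Ym).
Definition X2 := S2 *m (ctr A *m Ym).
Definition Mm := 1%:M + z *: (ctr B *m X1).
Definition Mi := 1%:M - z *: (ctr B *m X2).

Lemma S1V : (1%:M - z *: ctr A) *m S1 = 1%:M.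
Proof. by rewrite /S1 mulmxV ?stable_ctr_unit. Qed.
Lemma S1K : S1 *m (1%:M - z *: ctr A) = 1%:M.
Proof. by rewrite /S1 mulVmx ?stable_ctr_unit. Qed.
Lemma Tm_unit : 1%:M - z *: Tm \in unitmx.
Proof. apply: stable_unit => //; exact: Tm_stable. Qed.
Lemma S2V : (1%:M - z *: Tm) *m S2 = 1%:M.
Proof. by rewrite /S2 mulmxV ?Tm_unit. Qed.

Lemma X1Mi : X1 *m Mi = X2.
Proof. by rewrite /X1 /Mi /X2; apply: transfer_X; [exact: TmE|exact: S1K|exact: S2V]. Qed.
Lemma MmMi : Mm *m Mi = 1%:M.
Proof. by rewrite /Mm /X1 /Mi /X2; apply: transfer_inv; [exact: TmE|exact: S1K|exact: S2V]. Qed.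
Lemma Mm_unit : Mm \in unitmx.
Proof. by have [] := mulmx1_unit MmMi. Qed.
Lemma invMm : invmx Mm = Mi.
Proof. by rewrite -[LHS]mulmx1 -MmMi mulKmx ?Mm_unit. Qed.
Lemma MmE : Mm = ctr B *m (S1 *m Ym).
Proof. exact: transfer_M BY S1K. Qed.
End point.

Section circle_point.
Variable z : C.
Hypothesis z1 : nsq z = 1.
Let z1' : nsq z <= 1. Proof. by rewrite z1. Qed.

Definition Rz := invmx (z%:M - A).
Let uR : z%:M - A \in unitmx.
Proof. by apply: stable_unit_sub => //; rewrite z1. Qed.
Let uRc : (conjc z)%:M - ctr A \in unitmx.
Proof. by rewrite -ctr_scalar -ctrB ctr_unit. Qed.
Let zz : conjc z * z = 1.
Proof. by rewrite mulrC mulCJ z1. Qed.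
Let RzK : Rz *m (z%:M - A) = 1%:M. Proof. by rewrite /Rz mulVmx. Qed.
Let RzV : (z%:M - A) *m Rz = 1%:M. Proof. by rewrite /Rz mulmxV. Qed.
Let RcK : ctr Rz *m ((conjc z)%:M - ctr A) = 1%:M.
Proof. by rewrite -ctr_scalar -ctrB -ctrM RzV ctr1. Qed.
Let RcV : ((conjc z)%:M - ctr A) *m ctr Rz = 1%:M.
Proof. by rewrite -ctr_scalar -ctrB -ctrM RzK ctr1. Qed.

(** On the circle the conjugate of z is 1/z, so 1 - z A^* is z times the adjoint of z - A. *)
Lemma S1_Rz : S1 z = conjc z *: ctr Rz.
Proof.
have e : (1%:M - z *: ctr A) = z *: ((conjc z)%:M - ctr A).
  by rewrite scalerBr scale_scalar_mx [z * _]mulrC zz.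
rewrite -[LHS]mulmx1 -RcV mulmxA; have := S1K z1'; rewrite e -scalemxAr => h.
have -> : S1 z *m ((conjc z)%:M - ctr A) = (conjc z)%:M.
  by rewrite -[LHS]scale1r -zz -scalerA h scalemx1.
by rewrite mul_scalar_mx.
Qed.

Lemma interp : rC g2 *: (Cq *m Rz *m Ym) =
  Cq *m Rz *m B *m Mm z - Cq *m Q *m X1 z.
Proof.
rewrite (MmE z1').
rewrite /X1; apply: transfer_interp; [exact: S1V|exact: S1K|exact: BBE|exact: QY|exact: RzK].
Qed.

Lemma gram : rC g2 *: (ctr (Cq *m Rz *m Ym) *m (Cq *m Rz *m Ym)) =
  ctr (Mm z) *m Mm z.
Proof.
rewrite (MmE z1') [ctr (Cq *m Rz *m Ym)]ctrM [ctr (Cq *m Rz)]ctrM.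
rewrite [ctr (ctr B *m _)]ctrM [ctr (S1 z *m _)]ctrM ctrK -[ctr Ym *m _ *m B]mulmxA.
have -> : ctr (S1 z) = z *: Rz by rewrite S1_Rz ctrZ conjcK ctrK.
by apply: transfer_gram; [exact: BBE|exact: QY|exact: RzK|exact: zz|exact: S1_Rz|exact: RzV|exact: RcK|exact: RcV|exact: CE|exact: YQ].
Qed.

Definition Phi := rC g2 *: (Cq *m Rz *m Ym) *m invmx (Mm z).

(** The first term is G_-, the second is Phi_+ written with the stable matrix T. *)
Lemma PhiE : Phi = Cq *m Rz *m B - Cq *m Q *m X2 z.
Proof.
rewrite /Phi interp mulmxBl mulmxK ?Mm_unit// -(X1Mi z1') -(invMm z1').
by rewrite !mulmxA.
Qed.
Lemma Phi_gram : ctr Phi *m Phi = (rC g2)%:M.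
Proof.
have u := Mm_unit z1'.
rewrite /Phi [ctr (_ *m invmx _)]ctrM ctrZ conjc_rC -mulmxA [(_ *: ctr _) *m _]mulmxA.
rewrite -scalemxAl -scalemxAr gram -scalemxAl -scalemxAr ctr_inv !mulmxA mulVmx ?ctr_unit//.
by rewrite mul1mx mulmxV// scalemx1.
Qed.
Lemma Phi_Mm : Phi *m Mm z = rC g2 *: (Cq *m Rz *m Ym).
Proof. by rewrite /Phi mulmxKV ?Mm_unit. Qed.
End circle_point.
End state_space.

(** * Operator norms, bounded functions and resolvents *)
Section operator_norm.
Variable R : realType.
Local Notation C := R[i].
Local Notation mu := (@lebesgue_measure R).

Lemma nsq_sum_le (I : Type) (r : seq I) (F : I -> C) :
  nsq (\sum_(i <- r) F i) <= 2 ^+ size r * \sum_(i <- r) nsq (F i).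
Proof.
elim: r => [|i r IH]; first by rewrite !big_nil /nsq /= expr0n addr0 mulr0.
rewrite !big_cons /= exprS; apply: le_trans (nsqD _ _) _.
have h : nsq (F i) <= 2 ^+ size r * nsq (F i).
  by rewrite ler_peMl ?nsq_ge0// exprn_ege1// ler1n.
apply: le_trans (lerD (_ : _ <= 2 * (2 ^+ size r * nsq (F i)))
  (_ : _ <= 2 * (2 ^+ size r * \sum_(j <- r) nsq (F j)))) _.
- by rewrite ler_pM2l.
- by rewrite ler_pM2l.
by rewrite -mulrDr -mulrDr mulrA.
Qed.

(* Only finiteness of the constant matters. *)
Lemma mxsq_mul_le m n p (A : 'M[C]_(m, n)) (B : 'M[C]_(n, p)) :
  mxsq (A *m B) <= 2 ^+ n * mxsq A * mxsq B.
Proof.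
rewrite -mulrA [mxsq A]mxsqE mulr_suml mulr_sumr mxsqE; apply: ler_sum => i _.
have -> : mxsq B = \sum_k \sum_j nsq (B j k) by rewrite exchange_big.
rewrite [in leRHS]mulr_sumr mulr_sumr; apply: ler_sum => k _.
rewrite mxE; apply: le_trans (nsq_sum_le _ _) _.
rewrite [size _](_ : _ = n); last by rewrite -[RHS](card_ord n) cardE enumT.
rewrite ler_pM2l ?exprn_gt0//.
rewrite mulr_suml; apply: ler_sum => j _; rewrite nsqM ler_wpM2l ?nsq_ge0//.
rewrite (bigD1 j)//= lerDl sumr_ge0// => *; exact: nsq_ge0.
Qed.

Lemma mxsqZ m n (z : C) (A : 'M[C]_(m, n)) : mxsq (z *: A) = nsq z * mxsq A.
Proof.
rewrite !mxsqE mulr_sumr; apply: eq_bigr => i _; rewrite mulr_sumr.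
by apply: eq_bigr => j _; rewrite mxE nsqM.
Qed.
Lemma mxsq0 m n : mxsq (0 : 'M[C]_(m, n)) = 0.
Proof.
by rewrite mxsqE big1// => i _; rewrite big1// => j _; rewrite mxE /nsq /= expr0n addr0.
Qed.
Lemma nsq_rC (x : R) : nsq (rC x) = x ^+ 2.
Proof. by rewrite /nsq /= expr0n addr0. Qed.

Lemma mxnorm_has_sup m n (A : 'M[C]_(m, n)) :
  has_sup [set Num.sqrt (mxsq (A *m v)) | v in [set v : 'cV[C]_n | mxsq v <= 1]].
Proof.
split; first by exists (Num.sqrt (mxsq (A *m (0 : 'cV_n)))), 0; rewrite //= mxsq0.
exists (Num.sqrt (2 ^+ n * mxsq A)) => _ [v /= v1 <-]; apply: ler_wsqrtr.
apply: le_trans (mxsq_mul_le A v) _; rewrite ler_piMr// mulr_ge0 ?mxsq_ge0//.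
Qed.

Lemma mxnorm_ge0 m n (A : 'M[C]_(m, n)) : 0 <= mxnorm A.
Proof.
have [_ ub] := mxnorm_has_sup A.
apply: le_trans (_ : Num.sqrt (mxsq (A *m (0 : 'cV_n))) <= _); first exact: sqrtr_ge0.
by apply: ub_le_sup => //; exists 0; rewrite //= mxsq0.
Qed.

Lemma mxnormP m n (A : 'M[C]_(m, n)) (v : 'cV[C]_n) :
  mxsq (A *m v) <= mxnorm A ^+ 2 * mxsq v.
Proof.
have [_ ub] := mxnorm_has_sup A.
have [v0|vn0] := eqVneq (mxsq v) 0.
  by rewrite (mxsq_eq0 v0) mulmx0 !mxsq0 mulr0.
have vp : 0 < mxsq v by rewrite lt_def vn0 mxsq_ge0.
set c := (Num.sqrt (mxsq v))^-1.
have c2 : c ^+ 2 * mxsq v = 1 by rewrite exprVn sqr_sqrtr ?mxsq_ge0// mulVf.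
have : Num.sqrt (mxsq (A *m (rC c *: v))) <= mxnorm A.
  by apply: ub_le_sup => //; exists (rC c *: v); rewrite //= mxsqZ nsq_rC c2.
rewrite -scalemxAr mxsqZ nsq_rC -(ler_pXn2r (n := 2)) ?nnegrE ?sqrtr_ge0 ?mxnorm_ge0//.
rewrite sqr_sqrtr ?(mulr_ge0 (sqr_ge0 c) (mxsq_ge0 _))// => h.
rewrite -(ler_pM2l (_ : 0 < c ^+ 2)); last by rewrite exprn_gt0// invr_gt0 sqrtr_gt0.
by rewrite mulrCA c2 mulr1.
Qed.

Lemma mxnorm_le m n (A : 'M[C]_(m, n)) (M : R) : 0 <= M ->
  (forall v : 'cV[C]_n, mxsq (A *m v) <= M ^+ 2 * mxsq v) -> mxnorm A <= M.
Proof.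
move=> M0 h; apply: ge_sup; first by case: (mxnorm_has_sup A).
move=> _ [v /= v1 <-]; rewrite -(ler_pXn2r (n := 2)) ?nnegrE ?sqrtr_ge0//.
rewrite sqr_sqrtr ?mxsq_ge0//; apply: le_trans (h v) _.
by rewrite ler_piMr// sqr_ge0.
Qed.

Lemma nsq_le_mxnorm m n (A : 'M[C]_(m, n)) i j : nsq (A i j) <= mxnorm A ^+ 2.
Proof.
have := mxnormP A (delta_mx j 0); have -> : mxsq (delta_mx j 0 : 'cV[C]_n) = 1.
  have z0 : forall k, k != j -> \sum_j0 nsq ((delta_mx j 0 : 'cV[C]_n) k j0) = 0.
    by move=> k /negbTE kj; rewrite big_ord1 mxE kj /nsq /= expr0n addr0.
  rewrite mxsqE (bigD1 j)//= [X in _ + X]big1 // addr0 big_ord1 mxE !eqxx /nsq /=.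
  by rewrite expr1n expr0n addr0.
rewrite mulr1; apply: le_trans; have := nsq_le_mxsq (A *m (delta_mx j 0 : 'cV_n)) i 0.
by rewrite -colE mxE.
Qed.

Lemma Linf_ebdd m n (A : mfun R m n) : Linf A -> ebdd A.
Proof.
move=> [mA [M AM]]; split=> //; exists (M ^+ 2); split; first exact: sqr_ge0.
apply: aeC_imp (AM : aeC _) => t _ AtM i j; apply: le_trans (nsq_le_mxnorm _ _ _) _.
by rewrite ler_pXn2r ?nnegrE ?mxnorm_ge0// (le_trans _ AtM) ?mxnorm_ge0.
Qed.

Lemma ebdd_Linf m n (A : mfun R m n) : ebdd A -> Linf A.
Proof.
move=> [mA [K [K0 AK]]]; split => //.
exists (Num.sqrt (2 ^+ n * (\sum_(i < m) \sum_(j < n) K))).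
apply: (aeC_imp _ AK) => t _ AtK; apply: mxnorm_le; first exact: sqrtr_ge0.
have S0 : 0 <= \sum_(i < m) \sum_(j < n) K.
  by apply: sumr_ge0 => i _; apply: sumr_ge0.
move=> v; rewrite sqr_sqrtr ?mulr_ge0 ?exprn_ge0//.
apply: le_trans (mxsq_mul_le _ _) _; rewrite ler_wpM2r ?mxsq_ge0//.
rewrite ler_pM2l ?exprn_gt0// mxsqE; apply: ler_sum => i _; apply: ler_sum => j _.
exact: AtK.
Qed.

Lemma Rint_ae_le (g h : R -> R) : rint g -> rint h ->
  (forall t, 0 <= g t) -> (forall t, 0 <= h t) -> aeC (fun t => g t <= h t) ->
  Rintegral mu circ g <= Rintegral mu circ h.
Proof.
move=> ig ih g0 h0 gh; apply: fine_le.
- exact: (integrable_fin_num (@mcirc R) ig).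
- exact: (integrable_fin_num (@mcirc R) ih).
apply: ae_ge0_le_integral.
- exact: mcirc.
- by move=> t _; rewrite lee_fin.
- exact: measurable_int ig.
- by move=> t _; rewrite lee_fin.
- exact: measurable_int ih.
- by apply: aeC_imp gh => t _; rewrite lee_fin.
Qed.

Lemma nrm2_mul_le m n (A : mfun R m n) (M : R) (f : mfun R n 1) : ebdd A -> 0 <= M ->
  aeC (fun t => mxnorm (A t) <= M) -> L2 f ->
  nrm2 (fun t => A t *m f t) <= M ^+ 2 * nrm2 f.
Proof.
move=> bA M0 AM Lf; rewrite !nrm2E mulrCA ler_pM2l ?invr_gt0 ?pi2_gt0//.
rewrite -(RintegralZl _ (@mcirc R) (L2_rint Lf)).
apply: Rint_ae_le.
- exact: L2_rint (L2_mul bA Lf).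
- exact: rintZ (L2_rint Lf).
- by move=> t; exact: mxsq_ge0.
- by move=> t; rewrite mulr_ge0 ?sqr_ge0 ?mxsq_ge0.
apply: aeC_imp AM => t _ AtM; apply: le_trans (mxnormP _ _) _.
by rewrite ler_wpM2r ?mxsq_ge0// ler_pXn2r ?nnegrE ?mxnorm_ge0.
Qed.

(** For an exponential of index l >= 0 the k-th coefficient of the product is a coefficient of A of
    index k - l < 0. Partial sums and continuity of coefficients do the rest. *)
Lemma H2_HInf_mul m n (A : mfun R m n) (f : mfun R n 1) : HInf A -> H2 f ->
  H2 (fun t => A t *m f t).
Proof.
move=> [LA A0] Hf; have [Lf _] := Hf; have bA := Linf_ebdd LA.
have [_ [M0 AM0]] := LA.
pose M := `|M0|; have AM : aeC (fun t => mxnorm (A t) <= M).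
  by apply: aeC_imp (AM0 : aeC _) => t _ /le_trans; apply; exact: ler_norm.
split; first exact: L2_mul.
move=> k k0; apply/matrixP => i j; rewrite ord1 [RHS]mxE; apply: nsq_eq0; apply/eqP.
rewrite eq_le nsq_ge0 andbT; apply/ler_addgt0Pr => d d0; rewrite add0r.
have d1 : 0 < d / (M ^+ 2 + 1) by rewrite divr_gt0// ltr_wpDl// sqr_ge0.
have [N /(_ N (leqnn N)) NP] := H2_approx Hf d1.
pose s : mfun R n 1 := fun t => \sum_(j < N) cexpi ((j%:Z)%:~R * t) *: fc f j%:Z.
rewrite -/s in NP.
have Ls : L2 s by apply: L2_sum => l; apply: L2_expi; exact: L2_cst.
have As0 : fc (fun t => A t *m s t) k = 0.
  have -> : (fun t => A t *m s t) =
      (fun t => \sum_(l < N) cexpi ((l%:Z)%:~R * t) *: (A t *m fc f l%:Z)).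
    by apply/funext => t; rewrite mulmx_sumr; apply: eq_bigr => l _; rewrite -scalemxAr.
  rewrite fc_sum; last by move=> l; apply: L2_expi; apply: L2_mul => //; exact: L2_cst.
  rewrite big1// => l _; rewrite fc_expi fc_mulmxr; last exact: ebdd_L2.
  by rewrite A0 ?mul0mx//; rewrite subr_lt0 (lt_le_trans k0).
have Lfs : L2 (fun t => f t - s t) by exact: L2B.
have -> : fc (fun t => A t *m f t) k i 0 = fc (fun t => A t *m (f t - s t)) k i 0.
  have -> : (fun t => A t *m (f t - s t)) = (fun t => A t *m f t - A t *m s t).
    by apply/funext => t; rewrite mulmxBr.
  by rewrite fcB; [rewrite As0 subr0|exact: L2_mul|exact: L2_mul].
apply: le_trans (nrm2_fc_le _ _ (L2_mul bA Lfs)) _.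
apply: le_trans (nrm2_mul_le bA (normr_ge0 M0) AM Lfs) _.
apply: le_trans (_ : M ^+ 2 * (d / (M ^+ 2 + 1)) <= _); first by rewrite ler_wpM2l ?sqr_ge0.
rewrite mulrCA ler_piMr ?(ltW d0)// ler_pdivrMr ?mul1r ?lerDl//.
by rewrite ltr_wpDl// sqr_ge0.
Qed.
End operator_norm.

(** * Resolvents of stable matrices as bounded analytic functions *)

Section resolvent.
Variable R : realType.
Local Notation C := R[i].

(** Closed under sums, products and inverses of functions bounded away from 0, hence under the
    cofactor formula for the inverse matrix. *)
Definition bmeas (f : R -> C) := cmeas f /\ exists K : R, forall t, nsq (f t) <= K.

Lemma bmeas_cst z : bmeas (fun=> z).
Proof. by split; [exact: cmeas_cst|exists (nsq z)]. Qed.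
Lemma bmeasD f g : bmeas f -> bmeas g -> bmeas (fun t => f t + g t).
Proof.
move=> [mf [K fK]] [mg [L gL]]; split; first exact: cmeasD.
exists (2 * K + 2 * L) => t; apply: le_trans (nsqD _ _) _.
by apply: lerD; rewrite ler_pM2l.
Qed.
Lemma bmeasM f g : bmeas f -> bmeas g -> bmeas (fun t => f t * g t).
Proof.
move=> [mf [K fK]] [mg [L gL]]; split; first exact: cmeasM.
by exists (K * L) => t; rewrite nsqM ler_pM ?nsq_ge0.
Qed.
Lemma bmeas_sum (I : Type) (r : seq I) (F : I -> R -> C) :
  (forall i, bmeas (F i)) -> bmeas (fun t => \sum_(i <- r) F i t).
Proof.
move=> mF; elim: r => [|i r IH].
  by under eq_fun do rewrite big_nil; exact: bmeas_cst.
by under eq_fun do rewrite big_cons; exact: bmeasD.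
Qed.
Lemma bmeas_prod (I : Type) (r : seq I) (F : I -> R -> C) :
  (forall i, bmeas (F i)) -> bmeas (fun t => \prod_(i <- r) F i t).
Proof.
move=> mF; elim: r => [|i r IH].
  by under eq_fun do rewrite big_nil; exact: bmeas_cst.
by under eq_fun do rewrite big_cons; exact: bmeasM.
Qed.
Lemma bmeas_expi : bmeas (fun t => cexpi t).
Proof.
split; last by exists 1 => t; rewrite nsq_cexpi.
by have := cmeas_cexpi (1 : R); under eq_fun do rewrite mul1r.
Qed.
Lemma bmeas_det n (A : mfun R n n) : (forall i j, bmeas (fun t => A t i j)) ->
  bmeas (fun t => \det (A t)).
Proof.
move=> bA; apply: bmeas_sum => s; apply: bmeasM; first exact: bmeas_cst.
by apply: bmeas_prod => i; exact: bA.
Qed.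

Lemma cinvE (z : C) : z^-1 = rC (nsq z)^-1 * conjc z.
Proof.
have [->|z0] := eqVneq z 0; first by rewrite invr0 conjc0 mulr0.
apply: (mulfI z0); rewrite mulfV// mulrCA mulCJ -rCM mulVf//.
by apply: contra_neq z0; exact: nsq_eq0.
Qed.
Lemma nsqV (z : C) : nsq z^-1 = (nsq z)^-1.
Proof.
have [->|z0] := eqVneq z 0; first by rewrite invr0 /nsq /= expr0n addr0 invr0.
have nz : nsq z != 0 by apply: contra_neq z0; exact: nsq_eq0.
apply: (mulfI nz); rewrite mulfV// -nsqM mulfV//.
by rewrite /nsq /= expr1n expr0n addr0.
Qed.

Lemma bmeasV f (d : R) : bmeas f -> 0 < d -> (forall t, d <= nsq (f t)) ->
  bmeas (fun t => (f t)^-1).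
Proof.
move=> [mf _] d0 fd; split; last first.
  by exists d^-1 => t; rewrite nsqV lef_pV2 ?posrE// (lt_le_trans d0).
under eq_fun do rewrite cinvE; apply: cmeasM; last exact: cmeasJ.
apply: cmeas_rC; have -> : (fun t => (nsq (f t))^-1) = (fun t => nsq (f t) `^ (-1)).
  by apply/funext => t; rewrite powR_inv1// nsq_ge0.
by apply: measurableT_comp (@measurable_powR R (-1)) _; exact: cmeas_nsq.
Qed.

Lemma char_poly_horner n (T : 'M[C]_n) (z : C) :
  (char_poly T).[z] = \det (z%:M - T).
Proof.
rewrite horner_sum; apply: eq_bigr => s _.
rewrite hornerM horner_exp !hornerE; congr (_ * _).
rewrite (big_morph _ (fun p q => hornerM p q z) (hornerC 1 z)).
by apply: eq_bigr => i _; rewrite !mxE !(hornerE, hornerMn).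
Qed.

Lemma stable_root n (T : 'M[C]_n) (z : C) :
  stable T -> root (char_poly T) z -> nsq z < 1.
Proof.
move=> sT; rewrite rootE char_poly_horner ltNge => /eqP dT; apply/negP => z1.
by have := stable_unit_sub sT z1; rewrite unitmxE dT unitr0.
Qed.

Lemma stable_roots n (T : 'M[C]_n) : stable T -> exists2 s : seq C,
  char_poly T = \prod_(z <- s) ('X - z%:P) & forall z, z \in s -> nsq z < 1.
Proof.
move=> sT; have [s sE] := closed_field_poly_normal (char_poly T : {poly C}).
move: sE; rewrite (monicP (char_poly_monic T)) scale1r => sE.
by exists s => // z zs; apply: stable_root sT _; rewrite sE root_prod_XsubC.
Qed.

(** Each factor satisfies |w - a| >= 1 - |a| on the circle. *)
Lemma nsq_prod_lower (s : seq C) : (forall z, z \in s -> nsq z < 1) ->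
  exists2 d : R, 0 < d & forall w, nsq w = 1 -> d <= nsq (\prod_(z <- s) (w - z)).
Proof.
elim: s => [|a s IH] hs.
  by exists 1 => // w _; rewrite big_nil /nsq /= expr1n expr0n addr0.
have [z zs|d d0 hd] := IH; first by apply: hs; rewrite inE zs orbT.
have a1 : Num.sqrt (nsq a) < 1.
  by rewrite -sqrtr1 ltr_sqrt// hs// mem_head.
exists ((1 - Num.sqrt (nsq a)) ^+ 2 * d).
  by rewrite mulr_gt0// exprn_gt0// subr_gt0.
move=> w w1; rewrite big_cons nsqM ler_pM ?sqr_ge0 ?hd ?(ltW d0)//.
have h1 : complex.Re (w * conjc a) <= Num.sqrt (nsq a).
  apply: le_trans (Re_le_cabs _) _; rewrite cabsE nsqM nsqJ w1 mul1r //.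
have : nsq (w - a) = nsq w + nsq a - 2 * complex.Re (w * conjc a).
  rewrite /nsq; move: w a {w1 a1 h1 hs} => [w1 w2] [a1 a2] /=; ring.
move=> ->; have := sqr_sqrtr (nsq_ge0 a); rewrite w1.
move: h1; generalize (Num.sqrt (nsq a)) (nsq a) (complex.Re (w * conjc a)) => x y v; nra.
Qed.

(** Up to a unimodular factor this determinant is the characteristic polynomial of T at e^{-it},
    whose roots stay inside the disc. *)
Lemma resolvent_det n (T : 'M[C]_n) : stable T ->
  exists2 d : R, 0 < d & forall t, d <= nsq (\det (1%:M - cexpi t *: T)).
Proof.
move=> /stable_roots[s sE /nsq_prod_lower[d d0 hd]]; exists d => // t.
have -> : 1%:M - cexpi t *: T = cexpi t *: ((cexpi t)^-1%:M - T).
  by rewrite scalerBr scale_scalar_mx mulfV// cexpi_neq0.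
rewrite detZ -char_poly_horner nsqM sE horner_prod.
have -> : nsq (cexpi t ^+ n) = 1.
  by elim: n {T sE} => [|n IH]; rewrite ?expr0 ?exprS ?nsqM ?nsq_cexpi ?IH ?mulr1//
     /nsq /= expr1n expr0n addr0.
rewrite mul1r; under eq_bigr do rewrite !hornerE.
by apply: hd; rewrite nsqV nsq_cexpi invr1.
Qed.

Definition resolv n (T : 'M[C]_n) : mfun R n n := fun t => invmx (1%:M - cexpi t *: T).

Lemma resolvent_bmeas n (T : 'M[C]_n) : stable T ->
  forall i j, bmeas (fun t => resolv T t i j).
Proof.
move=> sT i j; have [d d0 hd] := resolvent_det sT.
have bT : forall i j, bmeas (fun t => (1%:M - cexpi t *: T) i j).
  move=> k l; have -> : (fun t => (1%:M - cexpi t *: T) k l) =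
      (fun t => (1%:M : 'M[C]_n) k l + cexpi t * - T k l).
    by apply/funext => t; rewrite [LHS]mxE; congr (_ + _); rewrite 2!mxE mulrN.
  apply: bmeasD; first exact: bmeas_cst.
  by apply: bmeasM; [exact: bmeas_expi|exact: bmeas_cst].
have -> : (fun t => resolv T t i j) = (fun t =>
    (\det (1%:M - cexpi t *: T))^-1 * cofactor (1%:M - cexpi t *: T) j i).
  apply/funext => t; rewrite /resolv /invmx stable_unit ?nsq_cexpi//.
  by rewrite mxE [X in _ * X]mxE.
apply: bmeasM; first by apply: bmeasV d0 hd; exact: bmeas_det.
apply: bmeasM; first exact: bmeas_cst.
apply: bmeas_det => k l; have -> : (fun t => row' j (col' i (1%:M - cexpi t *: T)) k l) =
   (fun t => (1%:M - cexpi t *: T) (lift j k) (lift i l)) by apply/funext => t; rewrite 2!mxE.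
exact: bT.
Qed.

Lemma bmeas_ebdd m n (A : mfun R m n) : (forall i j, bmeas (fun t => A t i j)) -> ebdd A.
Proof.
move=> bA; split; first by move=> i j; have [] := bA i j.
have [K KP] : exists K : 'I_m -> 'I_n -> R, forall i j t, nsq (A t i j) <= K i j.
  have /choice[K KP] : forall ij : 'I_m * 'I_n, exists k : R, forall t, nsq (A t ij.1 ij.2) <= k.
    by move=> [i j]; have [_ ] := bA i j.
  by exists (fun i j => K (i, j)) => i j t; exact: (KP (i, j)).
have K0 i j : 0 <= K i j by apply: le_trans (KP i j 0); exact: nsq_ge0.
exists (\sum_i \sum_j K i j); split.
  by apply: sumr_ge0 => i _; apply: sumr_ge0.
apply: aeC_all => t _ i j; apply: le_trans (KP i j t) _.
rewrite (bigD1 i)//= (bigD1 j)//= -addrA lerDl addr_ge0// sumr_ge0// => *.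
by rewrite sumr_ge0.
Qed.

(* The Fourier coefficients of negative index of [(1 - z T)^-1] form such an orbit. *)
Lemma backward_orbit_0 n (T : 'M[C]_n) (s : seq C) (v : nat -> 'cV[C]_n) (K : R) :
  (forall z, z \in s -> nsq z < 1) ->
  (forall m, mxsq (v m) <= K) -> (forall m, v m = T *m v m.+1) ->
  (forall m, foldr (fun z x => (T - z%:M) *m x) (v m) s = 0) -> forall m, v m = 0.
Proof.
elim/last_ind: s v K => [//|s a IH] v K hs vK vT vs.
(* The orbit (T - a) v is bounded too and is annihilated by one root fewer. Once it vanishes, v_m =
   a v_{m+1}, so v_m = a^N v_{m+N} is arbitrarily small. *)
have w0 : forall m, (T - a%:M) *m v m = 0.
  apply: (IH _ (2 ^+ n * mxsq (T - a%:M) * K)) => [z zs|m|m|m].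
  - by apply: hs; rewrite mem_rcons inE zs orbT.
  - apply: le_trans (mxsq_mul_le _ _) _; rewrite ler_wpM2l//.
    by rewrite mulr_ge0 ?exprn_ge0// mxsq_ge0.
  - rewrite {1}vT !mulmxA; congr (_ *m _).
    by rewrite mulmxBl mulmxBr mul_scalar_mx mul_mx_scalar.
  - by have := vs m; rewrite -cats1 foldr_cat.
have va m : v m = a *: v m.+1.
  by rewrite {1}vT; have := w0 m.+1; rewrite mulmxBl mul_scalar_mx => /eqP; rewrite subr_eq0 => /eqP.
have a1 : nsq a < 1 by apply: hs; rewrite mem_rcons mem_head.
have vN N m : mxsq (v m) = nsq a ^+ N * mxsq (v (m + N)%N).
  elim: N => [|N IHN]; first by rewrite addn0 expr0 mul1r.
  by rewrite IHN va mxsqZ mulrA exprSr addnS.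
have K0 : 0 <= K by apply: le_trans (vK 0); exact: mxsq_ge0.
move=> m; apply: mxsq_eq0; apply/eqP; rewrite eq_le mxsq_ge0 andbT.
have cv : (fun N => nsq a ^+ N * K) @ \oo --> (0 : R).
  rewrite -(mul0r K); apply: cvgM; last exact: cvg_cst.
  by apply: cvg_expr; rewrite ger0_norm ?nsq_ge0.
apply/ler_addgt0Pr => e e0; rewrite add0r.
have [N _ /(_ N (leqnn N)) hN] := cvgr_le _ cv _ e0.
by apply: le_trans hN; rewrite (vN N) ler_wpM2l// exprn_ge0// nsq_ge0.
Qed.

Lemma foldr_horner n (T : 'M[C]_n.+1) (s : seq C) (x : 'cV[C]_n.+1) :
  horner_mx T (\prod_(z <- s) ('X - z%:P)) *m x =
  foldr (fun z x => (T - z%:M) *m x) x s.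
Proof.
elim: s => [|a s IH] /=; first by rewrite big_nil rmorph1 mul1mx.
by rewrite big_cons rmorphM rmorphB /= horner_mx_X horner_mx_C -mulmxA IH.
Qed.

(** From R = 1 + z T R the coefficients of negative index satisfy R_k = T R_{k-1}. They are bounded,
    and Cayley-Hamilton annihilates them, so [backward_orbit_0] applies to each column. *)
Lemma resolv_HInf m n p (T : 'M[C]_n) (A1 : 'M[C]_(m, n)) (A2 : 'M[C]_(n, p)) :
  stable T -> HInf (fun t => A1 *m resolv T t *m A2).
Proof.
move=> sT; have bR := bmeas_ebdd (resolvent_bmeas sT).
split.
  apply: ebdd_Linf; apply: bmeas_ebdd => i j.
  have -> : (fun t => (A1 *m resolv T t *m A2) i j) =
      (fun t => \sum_k (\sum_l A1 i l * resolv T t l k) * A2 k j).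
    apply/funext => t; rewrite mxE; apply: eq_bigr => k _; congr (_ * _).
    by rewrite mxE.
  apply: bmeas_sum => k; apply: bmeasM; last exact: bmeas_cst.
  apply: bmeas_sum => l; apply: bmeasM; first exact: bmeas_cst.
  exact: resolvent_bmeas.
move=> k k0; have -> : fc (fun t => A1 *m resolv T t *m A2) k = A1 *m fc (resolv T) k *m A2.
  by rewrite fc_mulmxr ?fc_mulmxl//; [exact: ebdd_L2|apply: L2_mulmxl; exact: ebdd_L2].
suff -> : fc (resolv T) k = 0 by rewrite mulmx0 mul0mx.
apply/matrixP => i j; rewrite [RHS]mxE.
case: n => [|n] in T A1 A2 sT bR i j *; first by case: i.
have LR := ebdd_L2 bR.
have ZR : forall k : int, k < 0 -> fc (resolv T) k = T *m fc (resolv T) (k - 1).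
  move=> l l0; have this : resolv T = (fun t => 1%:M + T *m (cexpi t *: resolv T t)).
    apply/funext => t; rewrite -scalemxAr scalemxAl; apply/eqP; rewrite -subr_eq; apply/eqP.
    rewrite -[X in X - _]mul1mx -mulmxBl mulmxV//.
    by rewrite stable_unit// nsq_cexpi.
  rewrite {1}this fcD; last first.
  - by apply: L2_mulmxl; have := L2_expi 1 LR; under eq_fun do rewrite mul1r.
  - exact: L2_cst.
  rewrite fc_cst (lt_eqF l0) add0r fc_mulmxl; last first.
    by have := L2_expi 1 LR; under eq_fun do rewrite mul1r.
  have -> : (fun t => cexpi t *: resolv T t) = (fun t => cexpi (1%:~R * t) *: resolv T t).
    by apply/funext => t; rewrite mul1r.
  by rewrite fc_expi.
pose u : mfun R n.+1 1 := fun t => resolv T t *m delta_mx j 0.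
have Lu : L2 u by exact: L2_mulmxr.
have uE l : fc u l = fc (resolv T) l *m delta_mx j 0 by rewrite fc_mulmxr.
have [s sE hs] := stable_roots sT.
have v0 := @backward_orbit_0 _ T s (fun m => fc u (- m.+1%:Z))
  (\sum_(i < n.+1) \sum_(j < 1) nrm2 u) hs.
have [k' ->] : exists k' : nat, k = - k'.+1%:Z.
  by case: k k0 => // k' _; exists k'; rewrite NegzE.
have : fc u (- k'.+1%:Z) = 0.
  apply: v0 => l.
  - rewrite mxsqE; apply: ler_sum => a _; apply: ler_sum => b _; rewrite ord1.
    exact: nrm2_fc_le.
  - rewrite !uE ZR ?mulmxA; last by rewrite oppr_lt0.
    by have -> : - l.+1%:Z - 1 = - l.+2%:Z by lia.
  - by rewrite -foldr_horner -sE Cayley_Hamilton mul0mx.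
rewrite uE -colE => /(congr1 (fun M : 'cV_n.+1 => M i 0)).
by rewrite mxE => ->; rewrite mxE.
Qed.
End resolvent.

(** * Hardy spaces and Hankel operators *)
Section hardy.
Variable R : realType.
Local Notation C := R[i].

Lemma H2D m n (f g : mfun R m n) : H2 f -> H2 g -> H2 (fun t => f t + g t).
Proof.
move=> [Lf f0] [Lg g0]; split; first exact: L2D.
by move=> k k0; rewrite fcD// f0// g0// addr0.
Qed.
Lemma H2Z m n (z : C) (f : mfun R m n) : H2 f -> H2 (fun t => z *: f t).
Proof.
move=> [Lf f0]; split; first exact: L2Z.
by move=> k k0; rewrite fcZ// f0// scaler0.
Qed.
Lemma H2B m n (f g : mfun R m n) : H2 f -> H2 g -> H2 (fun t => f t - g t).
Proof.
move=> [Lf f0] [Lg g0]; split; first exact: L2B.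
by move=> k k0; rewrite fcB// f0// g0// subr0.
Qed.
Lemma K2D m n (f g : mfun R m n) : K2 f -> K2 g -> K2 (fun t => f t + g t).
Proof.
move=> [Lf f0] [Lg g0]; split; first exact: L2D.
by move=> k k0; rewrite fcD// f0// g0// addr0.
Qed.
Lemma K2Z m n (z : C) (f : mfun R m n) : K2 f -> K2 (fun t => z *: f t).
Proof.
move=> [Lf f0]; split; first exact: L2Z.
by move=> k k0; rewrite fcZ// f0// scaler0.
Qed.
Lemma K2B m n (f g : mfun R m n) : K2 f -> K2 g -> K2 (fun t => f t - g t).
Proof.
move=> [Lf f0] [Lg g0]; split; first exact: L2B.
by move=> k k0; rewrite fcB// f0// g0// subr0.
Qed.
Lemma H2_mulmxr m n p (M : 'M[C]_(n, p)) (f : mfun R m n) :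
  H2 f -> H2 (fun t => f t *m M).
Proof.
move=> [Lf f0]; split; first exact: L2_mulmxr.
by move=> k k0; rewrite fc_mulmxr// f0// mul0mx.
Qed.
Lemma K2_mulmxr m n p (M : 'M[C]_(n, p)) (f : mfun R m n) :
  K2 f -> K2 (fun t => f t *m M).
Proof.
move=> [Lf f0]; split; first exact: L2_mulmxr.
by move=> k k0; rewrite fc_mulmxr// f0// mul0mx.
Qed.
Lemma H2_cst m n (M : 'M[C]_(m, n)) : H2 (fun=> M).
Proof.
split; first exact: L2_cst.
by move=> k k0; rewrite fc_cst lt_eqF.
Qed.
Lemma HInf_H2 m n (f : mfun R m n) : HInf f -> H2 f.
Proof. by move=> [Lf f0]; split=> //; apply: ebdd_L2; exact: Linf_ebdd. Qed.
Lemma H2_aeq m n (f g : mfun R m n) : L2 g -> aeq f g -> H2 f -> H2 g.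
Proof.
move=> Lg fg [Lf f0]; split=> // k k0; rewrite -(fc_aeq (f := f))//; exact: f0.
Qed.
Lemma H2_Vmul m (f : mfun R m 1) : H2 f -> H2 (Vmul f).
Proof.
move=> [Lf f0]; split; first exact: L2_Vmul.
by move=> k k0; rewrite fc_Vmul f0//; lia.
Qed.
Lemma H2_K2_0 m n (f : mfun R m n) : H2 f -> K2 f -> aeq f zf.
Proof.
move=> [Lf f0] [_ f1]; apply: fourier_uniqueness => // k.
by case: (ltP k 0) => k0; [exact: f0|exact: f1].
Qed.

Lemma cols_ext m n (A B : 'M[C]_(m, n)) :
  (forall j, A *m (delta_mx j 0 : 'cV_n) = B *m delta_mx j 0) -> A = B.
Proof.
move=> h; apply/matrixP => i j; have := h j; rewrite -!colE.
by move=> /(congr1 (fun M : 'cV_m => M i 0)); rewrite !mxE.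
Qed.
Lemma mul_cols n k (c : 'I_k -> 'cV[C]_n) j :
  (\matrix_(i, l) c l i 0) *m (delta_mx j 0 : 'cV_k) = c j.
Proof. by rewrite -colE; apply/matrixP => i l; rewrite ord1 !mxE. Qed.

Lemma L2_cols m n (f : mfun R m n) :
  (forall j, L2 (fun t => f t *m (delta_mx j 0 : 'cV_n))) -> L2 f.
Proof.
move=> h; apply/L2P => i j; have /L2P/(_ i 0) := h j.
by under eq_fun do rewrite -colE mxE.
Qed.
Lemma H2_cols m n (f : mfun R m n) :
  (forall j, H2 (fun t => f t *m (delta_mx j 0 : 'cV_n))) -> H2 f.
Proof.
move=> h; have Lf : L2 f by apply: L2_cols => j; have [] := h j.
split=> // k k0; apply: cols_ext => j; have [_ /(_ k k0)] := h j.
by rewrite fc_mulmxr// mul0mx.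
Qed.
Lemma K2_cols m n (f : mfun R m n) :
  (forall j, K2 (fun t => f t *m (delta_mx j 0 : 'cV_n))) -> K2 f.
Proof.
move=> h; have Lf : L2 f by apply: L2_cols => j; have [] := h j.
split=> // k k0; apply: cols_ext => j; have [_ /(_ k k0)] := h j.
by rewrite fc_mulmxr// mul0mx.
Qed.
Lemma aeq_cols m n (f g : mfun R m n) :
  (forall j, aeq (fun t => f t *m (delta_mx j 0 : 'cV_n)) (fun t => g t *m delta_mx j 0)) ->
  aeq f g.
Proof.
move=> h; have := aeC_forall (h : forall j : 'I_n, aeC _).
by apply: aeC_imp => t _ ht; exact: cols_ext.
Qed.

Lemma ebddB m n (f g : mfun R m n) : ebdd f -> ebdd g -> ebdd (fun t => f t - g t).
Proof.
move=> bf bg; have [mf [a [a0 ha]]] := bf; have [mg [c [c0 hc]]] := bg.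
split; first by have [] : L2 (fun t => f t - g t) by apply: L2B; exact: ebdd_L2.
exists (2 * a + 2 * c); split; first by lra.
apply: aeC_imp2 ha hc => t _ ga fb i j.
have -> : (f t - g t) i j = f t i j - g t i j by rewrite mxE [X in _ + X]mxE.
apply: le_trans (nsqD _ _) _; rewrite nsqN.
by move: (ga i j) (fb i j); move: (nsq _) (nsq _) => x y; lra.
Qed.
(** A negative bound holds at no point, so the circle would be a null set; the mean of the constant
    1 refutes this. *)
Lemma ae_mxnorm_bound_ge0 m n (f : mfun R m n) (M : R) :
  aeC (fun t => mxnorm (f t) <= M) -> 0 <= M.
Proof.
move=> hM; rewrite leNgt; apply/negP => Mn.
have one0 : aeq (fun=> 1%:M : 'M[C]_1) (zf : mfun R 1 1).
  apply: aeC_imp hM => t _ h; have := le_lt_trans h Mn.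
  by rewrite ltNge mxnorm_ge0.
have := fc_aeq 0 (L2_cst (1%:M : 'M[C]_1)) (L2_zf _ _ _) one0.
rewrite fc_cst fc_zf eqxx => /matrixP/(_ 0 0); rewrite !mxE => /eqP.
by rewrite oner_eq0.
Qed.

(** The way values of [Pminus] and [Hank] are computed below: any decomposition will do, since two
    of them differ by an element of both H^2 and K^2. *)
Lemma Pminus_uniq m (u g : mfun R m 1) : K2 g -> H2 (fun t => u t - g t) ->
  aeq (Pminus u) g.
Proof.
move=> Kg Hu; have Lu : L2 u.
  have -> : u = (fun t => g t + (u t - g t)) by apply/funext => t; rewrite addrC subrK.
  by apply: L2D; [case: Kg|case: Hu].
have [KP HP] := PminusP Lu; apply/aeqB0; apply: H2_K2_0; last exact: K2B.
have -> : (fun t => Pminus u t - g t) = (fun t => (u t - g t) - (u t - Pminus u t)).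
  by apply/funext => t; rewrite opprB [RHS]addrC addrA subrK.
exact: H2B.
Qed.
Lemma nrm2_Pminus m (u : mfun R m 1) : L2 u -> nrm2 (Pminus u) <= nrm2 u.
Proof.
move=> Lu; have [KP HP] := PminusP Lu; have [LP _] := KP; have [LH _] := HP.
have -> : nrm2 u = nrm2 (fun t => (u t - Pminus u t) + Pminus u t).
  by congr nrm2; apply/funext => t; rewrite subrK.
by rewrite nrm2D_orth ?lerDr ?nrm2_ge0// H2_K2_orth.
Qed.
Lemma Pminus_aeq m (u v : mfun R m 1) : L2 u -> L2 v -> aeq u v ->
  aeq (Pminus u) (Pminus v).
Proof.
move=> Lu Lv uv; have [KP HP] := PminusP Lv; refine (Pminus_uniq KP _).
apply: H2_aeq HP; first by apply: L2B => //; case: KP.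
by apply: aeqB; [exact: aeq_sym|exact: aeq_refl].
Qed.

Lemma cinner_ext m n (A B : 'M[C]_(m, n)) :
  (forall (c : 'cV[C]_n) (d : 'cV[C]_m), cinner (A *m c) d = cinner (B *m c) d) -> A = B.
Proof.
move=> h; apply: cols_ext => j; apply/eqP; rewrite -subr_eq0; apply/eqP.
apply: mxsq_eq0; set e := _ - _.
have : cinner e e = 0.
  rewrite /e -mulmxBl mulmxBl; set d := _ - _.
  have := h (delta_mx j 0) d; rewrite /cinner => /eqP; rewrite -subr_eq0 -sumrB => /eqP {2}<-.
  by apply: eq_bigr => i _; rewrite -mulrBl; congr (_ * _); rewrite !mxE.
by rewrite cinner_mxsq => /(congr1 (@complex.Re _)).
Qed.
Lemma cinnerC m (u v : 'cV[C]_m) : cinner v u = conjc (cinner u v).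
Proof.
by rewrite /cinner conjc_sum; apply: eq_bigr => i _; rewrite conjcM conjcK mulrC.
Qed.
Lemma cinner_ctr m n (A : 'M[C]_(m, n)) u v : cinner (A *m u) v = cinner u (ctr A *m v).
Proof. by rewrite -!ctr_mulE ctrM ctrK mulmxA. Qed.
Lemma cinnerDl m (u v w : 'cV[C]_m) : cinner (u + v) w = cinner u w + cinner v w.
Proof. by rewrite -!ctr_mulE mulmxDr mxE. Qed.
Lemma cinnerDr m (u v w : 'cV[C]_m) : cinner w (u + v) = cinner w u + cinner w v.
Proof. by rewrite -!ctr_mulE ctrD mulmxDl mxE. Qed.
Lemma cinnerBl m (u v w : 'cV[C]_m) : cinner (u - v) w = cinner u w - cinner v w.
Proof. by rewrite -!ctr_mulE mulmxBr !mxE. Qed.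
Lemma cinnerZl m (z : C) (u w : 'cV[C]_m) : cinner (z *: u) w = z * cinner u w.
Proof. by rewrite -!ctr_mulE -scalemxAr mxE. Qed.
Lemma cinnerZr m (z : C) (u w : 'cV[C]_m) : cinner w (z *: u) = conjc z * cinner w u.
Proof. by rewrite -!ctr_mulE ctrZ -scalemxAl mxE. Qed.

Lemma inner_cst_r m (f : mfun R m 1) u : L2 f -> inner f (fun=> u) = cinner (fc f 0) u.
Proof.
move=> Lf; rewrite -inner_expi//; congr inner; apply/funext => t.
by rewrite mul0r cexpi0 scale1r.
Qed.
Lemma inner_Vmul m (f g : mfun R m 1) : inner (Vmul f) (Vmul g) = inner f g.
Proof.
rewrite /inner; congr (_ * cint _); apply/funext => t; apply: eq_bigr => i _.
rewrite !mxE conjcM mulrACA mulCJ nsq_cexpi [rC 1](_ : _ = 1)// mul1r //.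
Qed.
Lemma nrm2_Vmul m (f : mfun R m 1) : nrm2 (Vmul f) = nrm2 f.
Proof. by rewrite /nrm2 inner_Vmul. Qed.
Lemma PiE m (f : mfun R m 1) : Pi f = fc f (-1).
Proof.
rewrite /Pi /fc; congr (_ *: mcint _); apply/funext => t.
by rewrite mulN1r opprK.
Qed.
(** The adjoint of the embedding of constants is the mean value; nondegeneracy of [cinner] shows
    that the chosen vector is this one. *)
Lemma EstarE m (h : mfun R m 1) : L2 h -> Estar h = fc h 0.
Proof.
move=> Lh; rewrite /Estar /pickd.
have hv v : inner (Econst v) h = cinner v (fc h 0).
  by rewrite innerC// ?inner_cst_r// -?cinnerC//; exact: L2_cst.
case: pselect => [e|[]]; last by exists (fc h 0).
have P := proj2_sig (cid e); move: (proj1_sig _) P => u P.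
have : mxsq (u - fc h 0) = 0.
  have : cinner (u - fc h 0) (u - fc h 0) = 0.
    rewrite cinnerBl [cinner u _]cinnerC [cinner (fc _ _) _]cinnerC.
    by rewrite -hv P subrr.
  by rewrite cinner_mxsq => /(congr1 (@complex.Re _)).
by move/mxsq_eq0/eqP; rewrite subr_eq0 => /eqP.
Qed.
End hardy.

(** * The Hankel operator and its norm *)

Section hankel.
Variables (R : realType) (p q : nat) (G : mfun R q p).
Local Notation C := R[i].
Hypothesis LG : Linf G.
Let bG : ebdd G := Linf_ebdd LG.

Lemma Hank_prod_L2 (f : mfun R p 1) : H2 f -> L2 (fun t => G t *m f t).
Proof. by move=> [Lf _]; exact: L2_mul. Qed.
Lemma Hank_K2 f : H2 f -> K2 (Hank G f).
Proof. by move=> /Hank_prod_L2/PminusP[]. Qed.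
Lemma Hank_L2 f : H2 f -> L2 (Hank G f).
Proof. by move=> /Hank_K2[]. Qed.
Lemma Hank_H2 f : H2 f -> H2 (fun t => G t *m f t - Hank G f t).
Proof. by move=> /Hank_prod_L2/PminusP[]. Qed.
Lemma Hank_aeq f g : H2 f -> H2 g -> aeq f g -> aeq (Hank G f) (Hank G g).
Proof.
move=> Hf Hg fg; apply: Pminus_aeq; [exact: Hank_prod_L2..|exact: aeqM].
Qed.
Lemma HankZ z f : H2 f -> aeq (Hank G (fun t => z *: f t)) (fun t => z *: Hank G f t).
Proof.
move=> Hf; apply: Pminus_uniq; first exact: K2Z (Hank_K2 Hf).
have -> : (fun t => G t *m (z *: f t) - z *: Hank G f t) =
    (fun t => z *: (G t *m f t - Hank G f t)).
  by apply/funext => t; rewrite scalerBr -scalemxAr.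
exact: H2Z (Hank_H2 Hf).
Qed.
Lemma HankD f g : H2 f -> H2 g ->
  aeq (Hank G (fun t => f t + g t)) (fun t => Hank G f t + Hank G g t).
Proof.
move=> Hf Hg; apply: Pminus_uniq; first by apply: K2D; exact: Hank_K2.
have -> : (fun t => G t *m (f t + g t) - (Hank G f t + Hank G g t)) =
    (fun t => (G t *m f t - Hank G f t) + (G t *m g t - Hank G g t)).
  by apply/funext => t; rewrite mulmxDr opprD addrACA.
by apply: H2D; exact: Hank_H2.
Qed.
(** The intertwining H S = V_- H: multiplying the H^2 function G f - H f by e^{it} leaves it in H^2,
    so only e^{it} H f contributes. *)
Lemma HankV f : H2 f -> aeq (Hank G (Vmul f)) (Vminus (Hank G f)).
Proof.
move=> Hf; have LV : L2 (Vmul (Hank G f)) by apply: L2_Vmul; exact: Hank_L2.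
have [KP HP] := PminusP LV; refine (Pminus_uniq KP _).
have -> : (fun t => G t *m Vmul f t - Vminus (Hank G f) t) =
    (fun t => Vmul (fun s => G s *m f s - Hank G f s) t +
      (Vmul (Hank G f) t - Vminus (Hank G f) t)).
  by apply/funext => t; rewrite /Vmul scalerBr -scalemxAr subrKA.
by apply: H2D HP; apply: H2_Vmul; exact: Hank_H2.
Qed.
Lemma Hank_adj f y : H2 f -> K2 y ->
  inner (Hank G f) y = inner (fun t => G t *m f t) y.
Proof.
move=> Hf Ky; have := H2_K2_orth (Hank_H2 Hf) Ky.
rewrite innerBl//; [|exact: Hank_prod_L2|exact: Hank_L2|by case: Ky].
by move/eqP; rewrite subr_eq0 => /eqP.
Qed.

(** The easy half of Nehari's theorem: F f lies in H^2, so H f is also the projection of (G - F) f.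
    With F = 0 it gives the boundedness of H. *)
Lemma nrm2_Hank_sub F (M : R) f : HInf F -> 0 <= M ->
  aeC (fun t => mxnorm (G t - F t) <= M) -> H2 f ->
  nrm2 (Hank G f) <= M ^+ 2 * nrm2 f.
Proof.
move=> HF M0 hM Hf; have [Lf _] := Hf; have [LF _] := HF.
have bD : ebdd (fun t => G t - F t) := ebddB bG (Linf_ebdd LF).
have e : aeq (Hank G f) (Pminus (fun t => (G t - F t) *m f t)).
  have [KP HP] := PminusP (L2_mul bD Lf); refine (Pminus_uniq KP _).
  have -> : (fun t => G t *m f t - Pminus (fun t => (G t - F t) *m f t) t) =
     (fun t => ((G t - F t) *m f t - Pminus (fun t => (G t - F t) *m f t) t) + F t *m f t).
    by apply/funext => t; rewrite mulmxBl addrAC subrK.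
  by apply: H2D HP _; exact: H2_HInf_mul.
have LP : L2 (Pminus (fun t => (G t - F t) *m f t)).
  by have [[]] := PminusP (L2_mul bD Lf).
rewrite (nrm2_aeq (Hank_L2 Hf) LP e).
apply: le_trans (nrm2_Pminus (L2_mul bD Lf)) _; exact: nrm2_mul_le.
Qed.

Lemma HInf0 : HInf (@zf R q p).
Proof.
split; last by move=> k _; exact: fc_zf.
apply: ebdd_Linf; apply: bmeas_ebdd => i j.
by under eq_fun do rewrite /zf mxE; exact: bmeas_cst.
Qed.

Let hset := [set l2norm (Hank G f) | f in [set f | H2 f /\ l2norm f <= 1]].
Lemma hnorm_has_sup : has_sup hset.
Proof.
split.
  exists (l2norm (Hank G zf)), zf => //; split; first exact: H2_cst.
  by rewrite l2normE nrm2_zf sqrtr0.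
have [_ [M0 hM0]] := LG.
exists `|M0| => _ [f [Hf f1] <-]; rewrite -(ler_pXn2r (n := 2)) ?nnegrE ?l2norm_ge0//.
rewrite sqr_l2norm; apply: le_trans (nrm2_Hank_sub HInf0 (normr_ge0 M0) _ Hf) _.
  apply: aeC_imp (hM0 : aeC _) => t _; rewrite subr0 => /le_trans; apply; exact: ler_norm.
by rewrite ler_piMr ?sqr_ge0// -sqr_l2norm expr_le1// l2norm_ge0.
Qed.
Lemma hnorm_ge0 : 0 <= hnorm G.
Proof.
have [_ ub] := hnorm_has_sup.
apply: le_trans (_ : l2norm (Hank G zf) <= _); first exact: l2norm_ge0.
apply: ub_le_sup => //; exists zf => //; split; first exact: H2_cst.
by rewrite l2normE nrm2_zf sqrtr0.
Qed.
Lemma nrm2_Hank f : H2 f -> nrm2 (Hank G f) <= hnorm G ^+ 2 * nrm2 f.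
Proof.
move=> Hf; have [Lf _] := Hf; have [_ ub] := hnorm_has_sup.
have [f0|fn0] := eqVneq (nrm2 f) 0.
  rewrite f0 mulr0.
  have fz : aeq f zf by exact: nrm2_eq0.
  have Hz : H2 (@zf R p 1) by exact: H2_cst.
  have [_ [M0 hM0]] := LG.
  apply: le_trans (nrm2_Hank_sub HInf0 (normr_ge0 M0) _ Hf) _; last by rewrite f0 mulr0.
  by apply: aeC_imp (hM0 : aeC _) => t _; rewrite subr0 => /le_trans; apply; exact: ler_norm.
have fp : 0 < nrm2 f by rewrite lt_def fn0 nrm2_ge0.
set c := (Num.sqrt (nrm2 f))^-1.
have c2 : c ^+ 2 * nrm2 f = 1 by rewrite exprVn sqr_sqrtr ?nrm2_ge0// mulVf.
have Hcf := H2Z (rC c) Hf.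
have : l2norm (Hank G (fun t => rC c *: f t)) <= hnorm G.
  apply: ub_le_sup => //; exists (fun t => rC c *: f t) => //; split=> //.
  by rewrite l2normE nrm2Z// nsq_rC c2 sqrtr1.
rewrite (l2norm_aeq (Hank_L2 Hcf) (L2Z (rC c) (Hank_L2 Hf)) (HankZ (rC c) Hf)).
rewrite -(ler_pXn2r (n := 2)) ?nnegrE ?l2norm_ge0 ?hnorm_ge0//.
rewrite sqr_l2norm nrm2Z ?nsq_rC; last exact: Hank_L2.
move=> h; rewrite -(ler_pM2l (_ : 0 < c ^+ 2)); last first.
  by rewrite exprn_gt0// invr_gt0 sqrtr_gt0.
by rewrite mulrCA c2 mulr1.
Qed.
Lemma hnorm_le (M : R) : 0 <= M -> (forall f, H2 f -> nrm2 (Hank G f) <= M ^+ 2 * nrm2 f) ->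
  hnorm G <= M.
Proof.
move=> M0 h; apply: ge_sup; first by case: hnorm_has_sup.
move=> _ [f [Hf f1] <-]; rewrite -(ler_pXn2r (n := 2)) ?nnegrE ?l2norm_ge0//.
rewrite sqr_l2norm; apply: le_trans (h f Hf) _.
by rewrite ler_piMr ?sqr_ge0// -sqr_l2norm expr_le1// l2norm_ge0.
Qed.
Lemma maxvecP h : H2 h -> ~ aeq h zf -> nrm2 (Hank G h) = hnorm G ^+ 2 * nrm2 h ->
  maxvec G h.
Proof.
move=> Hh h0 e; split=> //; split=> //.
rewrite !l2normE e sqrtrM ?sqr_ge0// sqrtr_sqr ger0_norm//; exact: hnorm_ge0.
Qed.
Lemma maxvec_nrm2 h : maxvec G h -> H2 h /\ nrm2 (Hank G h) = hnorm G ^+ 2 * nrm2 h.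
Proof. by move=> [Hh [_ e]]; split=> //; rewrite -!sqr_l2norm e exprMn. Qed.
End hankel.

(** * Orthonormal systems *)

Section orthonormal.
Variable R : realType.
Local Notation C := R[i].

(** A family of n functions is stored as the columns of one matrix function b, so that b c is the
    combination with coefficients c and linear maps become matrix products. *)
Definition crd q n (b : mfun R q n) (x : mfun R q 1) : 'cV[C]_n :=
  \col_i inner x (fun t => b t *m (delta_mx i 0 : 'cV_n)).

Lemma inner_crd q n (b : mfun R q n) x d : L2 b -> L2 x ->
  inner x (fun t => b t *m d) = cinner (crd b x) d.
Proof.
move=> Lb Lx.
have -> : (fun t => b t *m d) = (fun t => \sum_i d i 0 *: (b t *m (delta_mx i 0 : 'cV_n))).
  apply/funext => t; rewrite {1}(_ : d = \sum_i d i 0 *: delta_mx i 0).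
    by rewrite mulmx_sumr; apply: eq_bigr => i _; rewrite scalemxAr.
  by rewrite {1}[d]matrix_sum_delta; apply: eq_bigr => i _; rewrite big_ord1.
rewrite inner_sumr//; last by move=> i; apply: L2Z; exact: L2_mulmxr.
by apply: eq_bigr => i _; rewrite innerZr ?[crd _ _ _ _]mxE 1?mulrC//; exact: L2_mulmxr.
Qed.

Definition orthonormal q n (b : mfun R q n) :=
  forall c d, inner (fun t => b t *m c) (fun t => b t *m d) = cinner c d.

Lemma orthonormal_nrm2 q n (b : mfun R q n) c : orthonormal b ->
  nrm2 (fun t => b t *m c) = mxsq c.
Proof. by move=> ob; rewrite /nrm2 ob cinner_mxsq. Qed.
Lemma orthonormal_inj q n (b : mfun R q n) (c d : 'cV[C]_n) : L2 b -> orthonormal b ->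
  aeq (fun t => b t *m c) (fun t => b t *m d) -> c = d.
Proof.
move=> Lb ob /aeqB0 h; apply/eqP; rewrite -subr_eq0; apply/eqP; apply: mxsq_eq0.
rewrite -(orthonormal_nrm2 _ ob) -(nrm2_zf R q); apply: nrm2_aeq.
- exact: L2_mulmxr.
- exact: L2_zf.
- by apply: aeC_imp h => t _; rewrite mulmxBr.
Qed.

Lemma crd_residual q n (b : mfun R q n) x d : L2 b -> orthonormal b -> L2 x ->
  inner (fun t => x t - b t *m crd b x) (fun t => b t *m d) = 0.
Proof.
move=> Lb ob Lx; rewrite innerBl//; [|exact: L2_mulmxr..].
by rewrite ob inner_crd// subrr.
Qed.
Lemma nrm2_crd_le q n (b : mfun R q n) x d : L2 b -> orthonormal b -> L2 x ->
  nrm2 (fun t => x t - b t *m crd b x) <= nrm2 (fun t => x t - b t *m d).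
Proof.
move=> Lb ob Lx.
have -> : (fun t => x t - b t *m d) =
    (fun t => (x t - b t *m crd b x) + b t *m (crd b x - d)).
  by apply/funext => t; rewrite mulmxBr addrA subrK.
have Lbc m (c : 'M[C]_(n, m)) : L2 (fun t => b t *m c) by exact: L2_mulmxr.
by rewrite (nrm2D_orth _ _ (crd_residual (crd b x - d) Lb ob Lx)) ?lerDl ?nrm2_ge0//; exact: L2B.
Qed.

Lemma orthonormal_row_mx q n (b : mfun R q n) r : L2 b -> L2 r -> orthonormal b ->
  nrm2 r = 1 -> (forall d, inner r (fun t => b t *m d) = 0) ->
  orthonormal (fun t => row_mx (b t) (r t)).
Proof.
move=> Lb Lr ob r1 rb c d.
have e x : (fun t => row_mx (b t) (r t) *m x) =
    (fun t => b t *m usubmx x + dsubmx x 0 0 *: r t).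
  apply/funext => t; rewrite -{1}[x]vsubmxK mul_row_col; congr (_ + _).
  by rewrite {1}[dsubmx x]mx11_scalar mul_mx_scalar.
rewrite !e; have Lbx x : L2 (fun t => b t *m x) by exact: L2_mulmxr.
have LZ z : L2 (fun t => z *: r t) by exact: L2Z.
rewrite innerDl ?innerDr//; try by apply: L2D.
rewrite !innerZl ?innerZr// ob rb [inner _ r]innerC// rb conjc0 !mulr0 addr0 add0r.
rewrite inner_nrm2// r1 [rC 1](_ : _ = 1)// mulr1.
rewrite /cinner big_split_ord /=; congr (_ + _).
  by apply: eq_bigr => i _; rewrite !mxE.
by rewrite big_ord1 !mxE.
Qed.
End orthonormal.

(** * Realization of a Hankel operator of finite rank *)
Section hankel_range.
Variables (R : realType) (p q : nat) (G : mfun R q p).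
Local Notation C := R[i].
Hypothesis LG : Linf G.
Hypothesis frG : finite_rank G.

(** Only asks for an orthonormal system inside the range of H; that it spans the range is obtained
    in [range_onb_exists]. *)
Definition range_onb n (b : mfun R q n) := [/\ K2 b, orthonormal b &
  forall c, exists2 f, H2 f & aeq (Hank G f) (fun t => b t *m c)].

(** The columns are combinations of the k functions given by finite rank, and orthonormality makes
    the coefficient matrix row-free. *)
Lemma range_onb_ub : exists k, forall n (b : mfun R q n), range_onb b -> (n <= k)%N.
Proof.
have [k [g gP]] := frG; exists k => n b [Kb ob bH].
have /choice[D DP] : forall i : 'I_n, exists c : 'I_k -> C,
    aeq (fun t => b t *m (delta_mx i 0 : 'cV_n)) (lincomb c g).
  move=> i; have [f Hf fb] := bH (delta_mx i 0); have [c cP] := gP f Hf.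
  by exists c; apply: aeq_trans cP; exact: aeq_sym.
pose M : 'M[C]_(n, k) := \matrix_(i, j) D i j.
suff : row_free M by rewrite /row_free => /eqP <-; exact: rank_leq_col.
rewrite -kermx_eq0; apply/eqP/row_matrixP => i; rewrite row0.
set v := row i _; have vM : v *m M = 0 by rewrite /v -row_mul mulmx_ker row0.
apply: trmx_inj; rewrite trmx0; apply: (orthonormal_inj (b := b)) => //; first by case: Kb.
have := aeC_forall (DP : forall i : 'I_n, aeC _); apply: aeC_imp => t _ ht.
rewrite mulmx0 [v^T]matrix_sum_delta mulmx_sumr.
under eq_bigr do rewrite big_ord1 -scalemxAr ht /lincomb scaler_sumr.
rewrite exchange_big big1// => j _; have /(congr1 (fun M : 'rV_k => M 0 j)) := vM.
rewrite !mxE => vj; under eq_bigr do rewrite scalerA.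
rewrite -scaler_suml (_ : \sum_i _ = 0) ?scale0r// -[RHS]vj.
by apply: eq_bigr => l _; rewrite [v^T _ _]mxE [M _ _]mxE.
Qed.

Lemma range_onb_extend n (b : mfun R q n) f : range_onb b -> H2 f ->
  (forall c, ~ aeq (Hank G f) (fun t => b t *m c)) ->
  exists b' : mfun R q (n + 1), range_onb b'.
Proof.
move=> [Kb ob bH] Hf fn; have [Lb _] := Kb; have LH := Hank_L2 LG Hf.
set c := crd b (Hank G f); set r := fun t => Hank G f t - b t *m c.
have Kr : K2 r by apply: K2B; [exact: Hank_K2|exact: K2_mulmxr].
have [Lr _] := Kr.
have rn0 : nrm2 r != 0.
  by apply/eqP => r0; apply: (fn c); apply/aeqB0; exact: nrm2_eq0.
have rp : 0 < nrm2 r by rewrite lt_def rn0 nrm2_ge0.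
set a := (Num.sqrt (nrm2 r))^-1.
have a2 : a ^+ 2 * nrm2 r = 1 by rewrite exprVn sqr_sqrtr ?nrm2_ge0// mulVf.
pose r' := fun t => rC a *: r t.
have Kr' : K2 r' by exact: K2Z.
suff : range_onb (fun t => row_mx (b t) (r' t)) by exists (fun t => row_mx (b t) (r' t)).
have e x : (fun t => row_mx (b t) (r' t) *m x) =
    (fun t => b t *m usubmx x + dsubmx x 0 0 *: r' t).
  apply/funext => t; rewrite -{1}[x]vsubmxK mul_row_col; congr (_ + _).
  by rewrite {1}[dsubmx x]mx11_scalar mul_mx_scalar.
split.
- apply: K2_cols => j; rewrite e; apply: K2D; [exact: K2_mulmxr|exact: K2Z].
- apply: orthonormal_row_mx => //.
  + by case: Kr'.
  + by rewrite nrm2Z// nsq_rC.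
  + move=> d; rewrite innerZl//; last exact: L2_mulmxr.
    by rewrite crd_residual// mulr0.
move=> x; rewrite e; set z := dsubmx x 0 0 * rC a.
have [f1 Hf1 h1] := bH (usubmx x - z *: c).
exists (fun t => f1 t + z *: f t); first by apply: H2D => //; exact: H2Z.
apply: aeq_trans (HankD LG Hf1 (H2Z z Hf)) _.
apply: aeC_imp2 h1 (HankZ LG z Hf) => t _ -> ->.
by rewrite /r' /r scalerA -/z scalerBr scalemxAr mulmxBr [z *: _ - _]addrC addrA.
Qed.

(** If no system spanned the range, Gram-Schmidt would extend each one and produce systems of every
    size, against the bound k. *)
Lemma range_onb_exists : exists n (b : mfun R q n), range_onb b /\
  forall f, H2 f -> exists c, aeq (Hank G f) (fun t => b t *m c).
Proof.
have [k kP] := range_onb_ub; apply: contrapT => hn.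
have step n : exists b : mfun R q n, range_onb b.
  elim: n => [|n [b bP]].
    exists zf; split; first by split; [exact: L2_zf|move=> l _; exact: fc_zf].
      move=> c d; rewrite /cinner big_ord0 (_ : (fun t => _ *m c) = zf) ?inner0l//.
      by apply/funext => t; rewrite mul0mx.
    move=> c; exists zf; first exact: H2_cst.
    have H0 : H2 (@zf R p 1) by exact: H2_cst.
    apply: Pminus_uniq.
      by apply: K2_mulmxr; split; [exact: L2_zf|move=> l _; exact: fc_zf].
    rewrite (_ : (fun t => _) = zf); first exact: H2_cst.
    by apply/funext => t; rewrite /zf mulmx0 mul0mx subrr.
  rewrite -addn1; apply: contrapT => hb; apply: hn; exists n, b; split=> // f Hf.
  apply: contrapT => hc; apply: hb; apply: (range_onb_extend bP Hf) => c hfc.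
  by apply: hc; exists c.
have [b bP] := step k.+1; by have := kP _ _ bP; rewrite ltnn.
Qed.
End hankel_range.

(** * Matrices of the shift, of WE and of WW^*, and the adjoint W^* *)

Section realization_exists.
Variables (R : realType) (p q : nat) (G : mfun R q p).
Local Notation C := R[i].
Hypothesis LG : Linf G.
Variables (n : nat) (b : mfun R q n).
Hypothesis bP : range_onb G b.
Hypothesis bX : forall f, H2 f -> exists c, aeq (Hank G f) (fun t => b t *m c).
Let Kb : K2 b. Proof. by case: bP. Qed.
Let Lb : L2 b. Proof. by case: Kb. Qed.

Lemma VminusE (x : mfun R q 1) : K2 x ->
  aeq (Vminus x) (fun t => cexpi t *: x t - fc x (-1)).
Proof.
move=> [Lx x0]; have LV := L2_Vmul Lx; apply: Pminus_uniq.
  split; first by apply: L2B => //; exact: L2_cst.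
  move=> k k0; rewrite fcB//; last exact: L2_cst.
  rewrite (fc_Vmul x) fc_cst; case: (eqVneq k 0) => [->|kn]; first by rewrite sub0r subrr.
  by rewrite x0 ?subrr//; lia.
have -> : (fun t => Vmul x t - (cexpi t *: x t - fc x (-1))) = (fun=> fc x (-1)).
  by apply/funext => t; rewrite /Vmul opprB addrC subrK.
exact: H2_cst.
Qed.

(** The range of H is invariant under V_- by the intertwining, and V_- x is e^{it} x minus its
    constant term. *)
Lemma shift_matrix : exists A : 'M[C]_n,
  aeq (fun t => cexpi t *: b t - fc b (-1)) (fun t => b t *m A).
Proof.
have /choice[a aP] : forall j : 'I_n, exists c : 'cV[C]_n,
    aeq (fun t => (cexpi t *: b t - fc b (-1)) *m (delta_mx j 0 : 'cV_n)) (fun t => b t *m c).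
  move=> j; have [_ _ /(_ (delta_mx j 0))[f Hf fb]] := bP.
  have [c cP] := bX (H2_Vmul Hf); exists c.
  apply: aeq_trans (_ : aeq _ (Vminus (fun t => b t *m (delta_mx j 0 : 'cV_n)))) _.
    apply: aeq_sym; apply: aeq_trans (VminusE (K2_mulmxr _ Kb)) _.
    by apply: aeC_all => t _; rewrite mulmxBl -scalemxAl fc_mulmxr.
  apply: aeq_trans cP; apply: aeq_sym; apply: aeq_trans (HankV LG Hf) _.
  apply: Pminus_aeq.
  - by apply: L2_Vmul; exact: Hank_L2.
  - by apply: L2_Vmul; exact: L2_mulmxr.
  - exact: aeqV.
exists (\matrix_(i, j) a j i 0); apply: aeq_cols => j.
by apply: aeC_imp (aP j : aeC _) => t _ ->; rewrite -mulmxA mul_cols.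
Qed.

(** Serves twice: the constant identity gives B, the functions w give Q. *)
Lemma range_matrix m (f : mfun R p m) : H2 f ->
  exists B : 'M[C]_(n, m), H2 (fun t => G t *m f t - b t *m B).
Proof.
move=> Hf; have [Lf _] := Hf.
have /choice[a aP] : forall j : 'I_m, exists c : 'cV[C]_n,
    aeq (Hank G (fun t => f t *m (delta_mx j 0 : 'cV_m))) (fun t => b t *m c).
  by move=> j; apply: bX; exact: H2_mulmxr.
exists (\matrix_(i, j) a j i 0); apply: H2_cols => j.
have Hfj := H2_mulmxr (delta_mx j 0 : 'cV_m) Hf.
apply: H2_aeq (Hank_H2 LG Hfj).
  apply: L2_mulmxr; apply: L2B; last exact: L2_mulmxr.
  by apply: L2_mul => //; exact: Linf_ebdd.
by apply: aeC_imp (aP j : aeC _) => t _ ->; rewrite mulmxBl -!mulmxA mul_cols.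
Qed.

Lemma ebdd_ctr : ebdd (fun t => ctr (G t)).
Proof.
have [mG [K [K0 KG]]] := Linf_ebdd LG; split.
  move=> i j; have := cmeasJ (mG j i : cmeas _).
  by have -> : (fun t => conjc (G t j i)) = (fun t => ctr (G t) i j)
    by apply/funext => t; rewrite ctrE.
exists K; split=> //; apply: aeC_imp KG => t _ h i j.
by rewrite ctrE nsqJ.
Qed.

(** The adjoint of H sends y to the H^2 part of G^* y. *)
Lemma Hank_adjoint y : K2 y -> exists2 x, H2 x &
  forall u, H2 u -> inner (Hank G u) y = inner u x.
Proof.
move=> Ky; have [Ly _] := Ky; have LGy := L2_mul ebdd_ctr Ly.
have [KP HP] := PminusP LGy; exists (fun t => ctr (G t) *m y t - Pminus (fun t => ctr (G t) *m y t) t) => //.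
move=> u Hu; have [Lu _] := Hu; have [LP _] := KP.
rewrite (Hank_adj LG Hu Ky) innerBr// (H2_K2_orth Hu KP) subr0.
rewrite /inner; congr (_ * cint _); apply/funext => t.
exact: (cinner_ctr (G t) (u t) (y t)).
Qed.

Lemma adjoint_matrix : exists2 w : mfun R p n, H2 w &
  forall u c, H2 u -> inner (Hank G u) (fun t => b t *m c) = inner u (fun t => w t *m c).
Proof.
have /choice[x xP] : forall j : 'I_n, exists x : mfun R p 1, H2 x /\ forall u, H2 u ->
    inner (Hank G u) (fun t => b t *m (delta_mx j 0 : 'cV_n)) = inner u x.
  by move=> j; have [x Hx h] := Hank_adjoint (K2_mulmxr (delta_mx j 0 : 'cV_n) Kb); exists x.
pose w : mfun R p n := fun t => \matrix_(i, j) x j t i 0.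
have we j : (fun t => w t *m (delta_mx j 0 : 'cV_n)) = x j.
  by apply/funext => t; rewrite /w mul_cols.
have Hw : H2 w by apply: H2_cols => j; rewrite we; have [] := xP j.
exists w => // u c Hu; have [Lu _] := Hu; have [Lw _] := Hw.
rewrite !inner_crd//; last exact: Hank_L2.
congr cinner; apply/matrixP => j k; rewrite [LHS]mxE [RHS]mxE we.
by have [_ ->] := xP j.
Qed.
End realization_exists.

Section choice_operators.
Variable R : realType.

(** Existence of a witness rules out the default value; this is the only way to reason about [adj]
    and [opinv]. *)
Lemma pickdP (U : Type) (d : U) (P : U -> Prop) : (exists x, P x) -> P (pickd d P).
Proof. by rewrite /pickd; case: pselect => // h _; exact: (proj2_sig (cid h)). Qed.
Lemma adjP m k (dom : set (mfun R m 1)) (T : mfun R m 1 -> mfun R k 1) y :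
  (exists x, dom x /\ forall u, dom u -> inner (T u) y = inner u x) ->
  dom (adj dom T y) /\ forall u, dom u -> inner (T u) y = inner u (adj dom T y).
Proof. exact: (pickdP zf). Qed.
Lemma opinvP m (X : set (mfun R m 1)) (T : mfun R m 1 -> mfun R m 1) y :
  (exists x, X x /\ aeq (T x) y) -> X (opinv X T y) /\ aeq (T (opinv X T y)) y.
Proof. exact: (pickdP zf). Qed.
End choice_operators.

(** * Inner products in the presence of constant terms *)

Section constants.
Variables (R : realType) (m : nat).
Implicit Types (f g : mfun R m 1) (u v : 'cV[R[i]]_m).

Lemma cinner0l v : cinner 0 v = 0.
Proof. by rewrite -ctr_mulE mulmx0 mxE. Qed.
Lemma inner_cst_l u f : L2 f -> inner (fun=> u) f = cinner u (fc f 0).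
Proof. by move=> Lf; rewrite innerC// ?inner_cst_r// -?cinnerC//; exact: L2_cst. Qed.
Lemma inner_K2_cst f g u v : K2 f -> K2 g ->
  inner (fun t => f t + u) (fun t => g t + v) = inner f g + cinner u v.
Proof.
move=> [Lf f0] [Lg g0]; have Lu : L2 (fun=> u) by exact: L2_cst.
have Lv : L2 (fun=> v) by exact: L2_cst.
rewrite innerDl//; last exact: L2D.
rewrite !innerDr// inner_cst_r// f0// cinner0l addr0 inner_cst_l// g0//.
by rewrite cinnerC cinner0l conjc0 add0r inner_cst_r// fc_cst.
Qed.
Lemma inner_sub_mean f g : L2 f -> L2 g ->
  inner (fun t => f t - fc f 0) (fun t => g t - fc g 0) =
  inner f g - cinner (fc f 0) (fc g 0).
Proof.
move=> Lf Lg; have Lu : L2 (fun=> fc f 0) by exact: L2_cst.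
have Lv : L2 (fun=> fc g 0) by exact: L2_cst.
rewrite innerBl//; last exact: L2B.
rewrite !innerBr// !inner_cst_l// inner_cst_r// fc_cst /=.
by rewrite subrr subr0.
Qed.
Lemma inner_Vmul_cst f g u : H2 f -> L2 g ->
  inner (Vmul f) (fun t => g t - u) = inner (Vmul f) g.
Proof.
move=> [Lf f0] Lg; have LV := L2_Vmul Lf; rewrite innerBr//; last exact: L2_cst.
by rewrite inner_cst_r// fc_Vmul f0// cinner0l subr0.
Qed.
End constants.

(* The columns of [b] are an orthonormal basis of X and those of [w] their images
   under W^*. *)
Section realization.
Variables (R : realType) (p q : nat) (G : mfun R q p).
Local Notation C := R[i].
Local Notation gamma := (hnorm G).
Hypothesis LG : Linf G.
Variables (n : nat) (b : mfun R q n) (w : mfun R p n).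
Variables (A Q : 'M[C]_n) (B : 'M[C]_(n, p)).
Hypothesis bP : range_onb G b.
Hypothesis bX : forall f, H2 f -> exists c, aeq (Hank G f) (fun t => b t *m c).
Hypothesis AE : aeq (fun t => cexpi t *: b t - fc b (-1)) (fun t => b t *m A).
Hypothesis BE : H2 (fun t => G t - b t *m B).
Hypothesis Hw : H2 w.
Hypothesis wE : forall u c, H2 u ->
  inner (Hank G u) (fun t => b t *m c) = inner u (fun t => w t *m c).
Hypothesis QE : H2 (fun t => G t *m w t - b t *m Q).

Local Notation Cq := (fc b (-1)).
Local Notation g2 := (gamma ^+ 2).
Local Notation D := (Dm A Q g2).

Let Kb : K2 b. Proof. by case: bP. Qed.
Let Lb : L2 b. Proof. by case: Kb. Qed.
Let ob : orthonormal b. Proof. by case: bP. Qed.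
Let Lw : L2 w. Proof. by case: Hw. Qed.
Let Lbc m (c : 'M[C]_(n, m)) : L2 (fun t => b t *m c). Proof. exact: L2_mulmxr. Qed.
Let Lwc m (c : 'M[C]_(n, m)) : L2 (fun t => w t *m c). Proof. exact: L2_mulmxr. Qed.
Let Kbc m (c : 'M[C]_(n, m)) : K2 (fun t => b t *m c). Proof. exact: K2_mulmxr. Qed.
Let Hwc m (c : 'M[C]_(n, m)) : H2 (fun t => w t *m c). Proof. exact: H2_mulmxr. Qed.

Lemma Vminus_b c : aeq (Vminus (fun t => b t *m c)) (fun t => b t *m (A *m c)).
Proof.
apply: aeq_trans (VminusE (Kbc c)) _; apply: aeC_imp (AE : aeC _) => t _ h.
by rewrite fc_mulmxr// mulmxA -h mulmxBl scalemxAl.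
Qed.
Lemma Hank_const u : aeq (Hank G (Econst u)) (fun t => b t *m (B *m u)).
Proof.
apply: Pminus_uniq; first exact: Kbc.
have -> : (fun t => G t *m Econst u t - b t *m (B *m u)) = (fun t => (G t - b t *m B) *m u).
  by apply/funext => t; rewrite mulmxBl !mulmxA.
exact: H2_mulmxr.
Qed.
Lemma Hank_w c : aeq (Hank G (fun t => w t *m c)) (fun t => b t *m (Q *m c)).
Proof.
apply: Pminus_uniq; first exact: Kbc.
have -> : (fun t => G t *m (w t *m c) - b t *m (Q *m c)) =
    (fun t => (G t *m w t - b t *m Q) *m c).
  by apply/funext => t; rewrite mulmxBl !mulmxA.
exact: H2_mulmxr.
Qed.

(** Q, the matrix of WW^*, is the Gram matrix of w. *)
Lemma Q_gram c d : inner (fun t => w t *m c) (fun t => w t *m d) = cinner (Q *m c) d.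
Proof.
rewrite -wE// -ob; apply: inner_aeq => //; [exact: Hank_L2|exact: Hank_w|exact: aeq_refl].
Qed.
Lemma Q_herm : ctr Q = Q.
Proof.
apply: cinner_ext => c d; rewrite -[RHS]Q_gram innerC// Q_gram.
by rewrite -cinnerC cinner_ctr ctrK.
Qed.

Lemma w0E : fc w 0 = ctr B.
Proof.
apply: cinner_ext => c d; rewrite -fc_mulmxr// -inner_cst_r//.
have Hd : H2 (fun=> d : 'cV[C]_p) by exact: H2_cst.
rewrite innerC//; last by case: Hd.
rewrite -wE// (_ : inner _ _ = inner (fun t => b t *m (B *m d)) (fun t => b t *m c)).
  by rewrite ob -cinnerC cinner_ctr ctrK.
apply: inner_aeq => //; [exact: Hank_L2|exact: Hank_const|exact: aeq_refl].
Qed.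

(* The intertwining [H S = V_- H], read on adjoints. *)
Lemma inner_w_shift u c : H2 u ->
  inner u (fun t => w t *m (ctr A *m c)) = inner (Vmul u) (fun t => w t *m c).
Proof.
move=> Hu; have [f fP] := bX Hu; have HVu := H2_Vmul Hu; have [LVu _] := HVu.
have LH := Hank_L2 LG Hu; have LHV := Hank_L2 LG HVu.
rewrite -(wE _ Hu) -(wE _ HVu).
transitivity (inner (fun t => b t *m f) (fun t => b t *m (ctr A *m c))).
  by apply: inner_aeq => //; exact: aeq_refl.
rewrite ob -cinner_ctr -ob.
apply: inner_aeq => //; last exact: aeq_refl.
apply: aeq_trans (aeq_sym (Vminus_b f)) _; apply: aeq_sym.
apply: aeq_trans (HankV LG Hu) _; apply: Pminus_aeq.
- exact: L2_Vmul.
- exact: L2_Vmul.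
- exact: aeqV.
Qed.

(** The functions W^* x are rational: w = B^* (1 - z A^* )^-1. By the intertwining, w A^* is the
    backward shift of w, and w has mean value B^*. *)
Lemma w_shift : aeq (fun t => w t *m (1%:M - cexpi t *: ctr A)) (fun=> ctr B).
Proof.
apply: aeq_cols => j; set c := delta_mx j 0.
have Lbw : L2 (fun t => cexpi (-1 * t) *: (w t *m c - fc w 0 *m c)).
  by apply: L2_expi; apply: L2B => //; exact: L2_cst.
(* The backward shift of w c, in H^2 because the mean value has been removed. It has the same inner
   products with H^2 as w A^* c. *)
pose h t := cexpi (-1 * t) *: (w t *m c - fc w 0 *m c).
have hE t : cexpi t *: h t = w t *m c - fc w 0 *m c.
  by rewrite scalerA -cexpiD mulN1r subrr cexpi0 scale1r.
have hV : Vmul h = (fun t => w t *m c - fc w 0 *m c) by apply/funext => t; exact: hE.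
have Hh : H2 h.
  split=> // k k0; have := fc_Vmul h (k + 1); rewrite addrK => <-.
  rewrite hV fcB//; last exact: L2_cst.
  rewrite fc_mulmxr// fc_cst; case: eqP => [->|kn]; first by rewrite subrr.
  by have [_ ->] := Hw; rewrite ?mul0mx ?subrr//; lia.
clearbody h; suff : aeq (fun t => w t *m (ctr A *m c)) h.
  apply: aeC_imp => t _ wh; rewrite mulmxBr mulmx1 mulmxBl -scalemxAr -scalemxAl.
  by rewrite -[w t *m _ *m _]mulmxA wh hE opprB addrC subrK w0E.
pose d t := w t *m (ctr A *m c) - h t; have Hd : H2 d := H2B (Hwc (ctr A *m c)) Hh.
apply/aeqB0; rewrite -/d.
have [Ld _] := Hd; apply: nrm2_eq0 => //; rewrite /nrm2.
suff -> : inner d d = 0 by [].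
have := inner_w_shift c Hd; rewrite -(inner_Vmul_cst (fc w 0 *m c) Hd (Lwc c)) -hV.
rewrite inner_Vmul => e; have [Lh _] := Hh.
by have := innerBr (Lwc (ctr A *m c)) Lh Ld; rewrite e subrr.
Qed.

(** By [w_shift], e^{it} w A^* = w - B^*. Inner products of the left side give A Q A^*; on the
    right, removing the mean value subtracts B B^* from Q. *)
Lemma Stein : Q = A *m Q *m ctr A + B *m ctr B.
Proof.
apply: cinner_ext => c d.
have e x : aeq (Vmul (fun t => w t *m (ctr A *m x))) (fun t => w t *m x - ctr B *m x).
  apply: aeC_imp (w_shift : aeC _) => t _ /(congr1 (fun M : 'M[C]_(p, n) => M *m x)).
  rewrite mulmxBr mulmx1 mulmxBl -scalemxAr -scalemxAl -mulmxA /Vmul => <-.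
  by rewrite opprB addrC subrK.
have : inner (fun t => w t *m (ctr A *m c)) (fun t => w t *m (ctr A *m d)) =
    cinner (Q *m c) d - cinner (B *m (ctr B *m c)) d.
  rewrite -inner_Vmul [LHS](inner_aeq _ _ _ _ (e c) (e d)); try exact: L2_Vmul; last first.
  - by apply: L2B => //; exact: L2_cst.
  - by apply: L2B => //; exact: L2_cst.
  have E x : ctr B *m x = fc (fun t => w t *m x) 0 by rewrite fc_mulmxr// w0E.
  rewrite [in LHS]E [X in inner _ X](_ : _ = (fun t => w t *m d - fc (fun t => w t *m d) 0)).
    by rewrite inner_sub_mean// Q_gram -!E [cinner (B *m _) _]cinner_ctr.
  by apply/funext => t; rewrite E.
rewrite Q_gram -[in cinner (Q *m _) _](ctrK A) -cinner_ctr ctrK => /eqP.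
rewrite eq_sym subr_eq => /eqP ->; rewrite mulmxDl cinnerDl -!mulmxA //.
Qed.

(** e^{it} b = b A + C is a sum of a K^2 part and a constant, which are orthogonal, while
    multiplication by e^{it} preserves inner products. *)
Lemma isometry : ctr A *m A + ctr Cq *m Cq = 1%:M.
Proof.
apply: cinner_ext => c d; rewrite mul1mx mulmxDl cinnerDl -!mulmxA.
rewrite -[X in _ = X]ob -inner_Vmul.
have e x : aeq (Vmul (fun t => b t *m x)) (fun t => b t *m (A *m x) + Cq *m x).
  apply: aeC_imp (AE : aeC _) => t _ h.
  by rewrite mulmxA -h mulmxBl subrK -scalemxAl.
rewrite [RHS](inner_aeq _ _ _ _ (e c) (e d)); try exact: L2_Vmul; last first.
- by apply: L2D => //; exact: L2_cst.
- by apply: L2D => //; exact: L2_cst.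
rewrite inner_K2_cst// ob [cinner (ctr A *m _) _]cinner_ctr.
by rewrite [cinner (ctr Cq *m _) _]cinner_ctr !ctrK.
Qed.

Lemma b_resolvent : aeq (fun t => b t *m ((cexpi t)%:M - A)) (fun=> Cq).
Proof.
apply: aeC_imp (AE : aeC _) => t _ h.
by rewrite mulmxBr mul_mx_scalar -h opprB addrC subrK.
Qed.

(** If A x = z x with |z| >= 1, the isometry relation forces C x = 0. Then e^{it} b x = z b x, and
    comparing coefficients kills those of negative index one after the other, starting from index
    0. *)
Lemma A_stable : stable A.
Proof.
move=> z x z1 Ax; apply: (orthonormal_inj Lb ob).
have Cx : Cq *m x = 0.
  apply: mxsq_eq0; apply/eqP; rewrite eq_le mxsq_ge0 andbT.
  have : mxsq x = nsq z * mxsq x + mxsq (Cq *m x).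
    have := congr1 (fun M : 'M[C]_n => qf M x) isometry; rewrite qfD.
    have -> : qf (ctr A *m A) x = nsq z * mxsq x.
      by have := qf_gram (ctr A) x; rewrite ctrK Ax mxsqZ.
    have -> : qf (ctr Cq *m Cq) x = mxsq (Cq *m x).
      by have := qf_gram (ctr Cq) x; rewrite ctrK.
    have -> : qf (1%:M : 'M[C]_n) x = mxsq x.
      by have := qf_scalar 1 x; rewrite mul1r => <-.
    by move=> ->.
  have : mxsq x <= nsq z * mxsq x by rewrite ler_peMl ?mxsq_ge0.
  by move: (mxsq x) (nsq z * mxsq x) (mxsq (Cq *m x)) => u v s; lra.
have zx : aeq (Vmul (fun t => b t *m x)) (fun t => z *: (b t *m x)).
  apply: aeC_imp (b_resolvent : aeC _) => t _ /(congr1 (fun M : 'M[C]_(q, n) => M *m x)).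
  rewrite Cx -mulmxA mulmxBl mul_scalar_mx Ax mulmxBr -!scalemxAr => /eqP.
  by rewrite subr_eq0 => /eqP.
have f0 (k : nat) : fc (fun t => b t *m x) (- k%:Z) = 0.
  elim: k => [|k IH]; first by have [_ ->] := Kbc x.
  have := fc_Vmul (fun t => b t *m x) (- k%:Z).
  have -> : fc (Vmul (fun t => b t *m x)) (- k%:Z) = 0.
    transitivity (fc (fun t => z *: (b t *m x)) (- k%:Z)).
      by apply: fc_aeq zx; [exact: L2_Vmul|exact: L2Z].
    by rewrite fcZ// IH scaler0.
  rewrite (_ : - k%:Z - 1 = - k.+1%:Z); last by lia.
  exact: esym.
rewrite (_ : (fun t => b t *m 0) = zf); last by apply/funext => t; rewrite mulmx0.
apply: fourier_uniqueness => // k.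
have [k0|k0] := leP 0 k; first by have [_ ->] := Kbc x.
by have -> : k = - `|k|%N%:Z by lia.
Qed.
Lemma qf_Q x : qf Q x = nrm2 (fun t => w t *m x).
Proof. by rewrite /nrm2 Q_gram -ctr_mulE mulmxA. Qed.

(** W^* is bounded by the norm of W. Expanding |H w x - gamma^2 b x|^2 >= 0 gives it up to a factor
    gamma^2, so gamma = 0 is settled apart. *)
Lemma nrm2_w_le x : nrm2 (fun t => w t *m x) <= g2 * mxsq x.
Proof.
have Hwx := Hwc x; have LH := Hank_L2 LG Hwx.
have := nrm2_Hank LG Hwx; set y := nrm2 (fun t => w t *m x) => hy.
have y0 : 0 <= y by exact: nrm2_ge0.
have yE : y = complex.Re (inner (Hank G (fun t => w t *m x)) (fun t => b t *m x)).
  by rewrite wE.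
have [g0|gn0] := eqVneq g2 0.
  have Hz : aeq (Hank G (fun t => w t *m x)) zf.
    by apply: nrm2_eq0 => //; apply/eqP; rewrite eq_le nrm2_ge0 andbT (le_trans hy)// g0 mul0r.
  by rewrite g0 mul0r yE (inner_aeq LH (L2_zf _ _ _) (Lbc x) (Lbc x) Hz (aeq_refl _)) inner0l.
have gp : 0 < g2 by rewrite lt_def gn0 sqr_ge0.
have := nrm2_ge0 (fun t => Hank G (fun t => w t *m x) t - b t *m (rC g2 *: x)).
rewrite nrm2B// orthonormal_nrm2// mxsqZ nsq_rC.
have -> : (fun t => b t *m (rC g2 *: x)) = (fun t => rC g2 *: (b t *m x)).
  by apply/funext => t; rewrite scalemxAr.
rewrite innerZr// conjc_rC cRe_rCM -yE => h.
rewrite -(ler_pM2l gp); move: h hy; rewrite expr2 -mulrA.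
move: (nrm2 _) (g2 * y) (g2 * (g2 * _)) => u v s; lra.
Qed.

Lemma Xm_psd x : 0 <= qf (Xm Q g2) x.
Proof. by rewrite qfB qf_scalar qf_Q subr_ge0 nrm2_w_le. Qed.

Hypothesis maxvec_notin_SH2 : forall h, maxvec G h -> ~ SH2 h.

(** The first half of (C2) in the form used below: a shifted function attaining the norm has to
    vanish. *)
Lemma Vmul_not_max h : H2 h -> nrm2 (Hank G (Vmul h)) = g2 * nrm2 h -> nrm2 h = 0.
Proof.
move=> Hh e; have [Lh _] := Hh; have HV := H2_Vmul Hh; rewrite -nrm2_Vmul.
suff hz : aeq (Vmul h) zf.
  by rewrite (nrm2_aeq (L2_Vmul Lh) (L2_zf _ _ _) hz) nrm2_zf.
apply: contrapT => hn; apply: (@maxvec_notin_SH2 (Vmul h)).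
  by apply: maxvecP => //; rewrite nrm2_Vmul.
by exists h; split=> //; exact: aeq_refl.
Qed.

(** If gamma = 0, a shifted constant would be a maximizing vector in SH^2. The index [i] says that p
    > 0, so that a nonzero constant exists. *)
Lemma hnorm_sqr_neq0 (i : 'I_p) : g2 != 0.
Proof.
apply/eqP => g0; pose e : mfun R p 1 := fun=> delta_mx i 0.
have He : H2 e by exact: H2_cst.
have : nrm2 e = 0.
  apply: Vmul_not_max => //; rewrite g0 mul0r; apply/eqP; rewrite eq_le nrm2_ge0 andbT.
  by apply: le_trans (nrm2_Hank LG (H2_Vmul He)) _; rewrite g0 mul0r.
have -> : nrm2 e = mxsq (delta_mx i 0 : 'cV[C]_p).
  rewrite /nrm2 inner_cst_r; last by case: He.
  by rewrite fc_cst cinner_mxsq.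
move=> /mxsq_eq0/matrixP/(_ i 0); rewrite !mxE !eqxx => /eqP.
by rewrite oner_eq0.
Qed.

(** For h = W^* Z^* x, the relation A Q A^* x = gamma^2 x gives |h|^2 = gamma^2 |x|^2 and H S h =
    gamma^2 x, so S h attains the norm of H and therefore vanishes. *)
Lemma Dm_inj (x : 'cV[C]_n) : D *m x = 0 -> x = 0.
Proof.
rewrite mulmxBl mul_scalar_mx => /eqP; rewrite subr_eq0 eq_sym => /eqP Dx.
set y := ctr A *m x; have AQy : A *m (Q *m y) = rC g2 *: x by rewrite -Dx !mulmxA.
have Hh := Hwc y; have HVh := H2_Vmul Hh.
have nh : nrm2 (fun t => w t *m y) = g2 * mxsq x.
  rewrite /nrm2 Q_gram {2}/y -cinner_ctr AQy cinnerZl cinner_mxsq cRe_rCM //.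
have e : aeq (Hank G (Vmul (fun t => w t *m y))) (fun t => b t *m (rC g2 *: x)).
  rewrite -AQy; apply: aeq_trans (HankV LG Hh) _.
  apply: aeq_trans (Vminus_b (Q *m y)); apply: Pminus_aeq.
  - by apply: L2_Vmul; exact: Hank_L2.
  - exact: L2_Vmul.
  - by apply: aeqV; exact: Hank_w.
have : g2 * mxsq x = 0.
  rewrite -nh; apply: Vmul_not_max => //; rewrite nh.
  rewrite (nrm2_aeq (Hank_L2 LG HVh) (Lbc (rC g2 *: x)) e) orthonormal_nrm2//.
  by rewrite mxsqZ nsq_rC mulrA -expr2.
move/eqP; rewrite mulf_eq0 => /orP[/eqP g0|/eqP/mxsq_eq0//].
(* If gamma = 0 then H = 0, and b x, lying in the range, is zero. *)
have [_ _ /(_ x)[f Hf fb]] := bP; apply: mxsq_eq0; rewrite -(orthonormal_nrm2 _ ob).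
rewrite -(nrm2_aeq (Hank_L2 LG Hf) (Lbc x) fb); apply/eqP.
by rewrite eq_le nrm2_ge0 andbT (le_trans (nrm2_Hank LG Hf))// g0 mul0r.
Qed.

(** For c the coordinates of H h, w c is W^* W h. Expanding |gamma^2 h - W^* W h|^2 and using the
    maximality of h shows W^* W h = gamma^2 h; applying H gives the eigenvector equation for c. *)
Lemma maxvec_coords h : maxvec G h ->
  exists2 c : 'cV[C]_n, aeq (fun t => w t *m c) (fun t => rC g2 *: h t) & Q *m c = rC g2 *: c.
Proof.
move=> /(maxvec_nrm2)[Hh hmax]; have [c hc] := bX Hh; have [Lh _] := Hh.
have LH := Hank_L2 LG Hh; have HZ := H2Z (rC g2) Hh.
have nc : mxsq c = g2 * nrm2 h.
  by rewrite -hmax (nrm2_aeq LH (Lbc c) hc) orthonormal_nrm2.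
have wc : aeq (fun t => w t *m c) (fun t => rC g2 *: h t).
  apply: aeq_sym; apply/aeqB0; apply: nrm2_eq0; first by apply: L2B => //; exact: L2Z.
  apply/eqP; rewrite eq_le nrm2_ge0 andbT nrm2B//; last exact: L2Z.
  rewrite nrm2Z// innerZl// cRe_rCM -wE//.
  rewrite (inner_aeq LH (Lbc c) (Lbc c) (Lbc c) hc (aeq_refl _)) ob cinner_mxsq Re_rC.
  have := nrm2_w_le c; rewrite nc nsq_rC.
  move: (nrm2 (fun t => w t *m c)) (nrm2 h) g2 => x y z; lra.
exists c => //; apply: (orthonormal_inj Lb ob); apply: aeq_trans (aeq_sym (Hank_w c)) _.
apply: aeq_trans (Hank_aeq LG (Hwc c) HZ wc) _.
apply: aeq_trans (HankZ LG _ Hh) _; apply: aeC_imp hc => t _ ->.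
by rewrite scalemxAr.
Qed.

Lemma span_maxvec_coords f : in_span (maxvec G) f ->
  exists2 c : 'cV[C]_n, aeq (fun t => w t *m c) (fun t => rC g2 *: f t) & Q *m c = rC g2 *: c.
Proof.
move=> [k [a [h [hmax fE]]]].
have /choice[c cP] : forall i, exists c : 'cV[C]_n,
    aeq (fun t => w t *m c) (fun t => rC g2 *: h i t) /\ Q *m c = rC g2 *: c.
  by move=> i; have [c c1 c2] := maxvec_coords (hmax i); exists c.
exists (\sum_i a i *: c i); last first.
  rewrite mulmx_sumr scaler_sumr; apply: eq_bigr => i _; have [_ e] := cP i.
  by rewrite -scalemxAr e !scalerA mulrC.
have c1 : forall i, aeC (fun t => w t *m c i = rC g2 *: h i t).
  by move=> i; have [] := cP i.
apply: aeC_imp2 fE (aeC_forall c1) => t _ -> ht.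
rewrite mulmx_sumr scaler_sumr; apply: eq_bigr => i _.
by rewrite -scalemxAr ht !scalerA mulrC.
Qed.

(** The columns are coordinates for a basis of the span of maximizing vectors. Since w c is gamma^2
    times the basis vector, their independence requires gamma to be nonzero. *)
Lemma maxvec_matrix : span_dim (maxvec G) p -> exists2 K : 'M[C]_(n, p),
  Q *m K = rC g2 *: K & forall v : 'cV[C]_p, K *m v = 0 -> v = 0.
Proof.
move=> [f [fin [find _]]].
have /choice[c cP] : forall i, exists c : 'cV[C]_n,
    aeq (fun t => w t *m c) (fun t => rC g2 *: f i t) /\ Q *m c = rC g2 *: c.
  by move=> i; have [c c1 c2] := span_maxvec_coords (fin i); exists c.
pose K : 'M[C]_(n, p) := \matrix_(i, j) c j i 0.
exists K.
  apply: cols_ext => j; rewrite -mulmxA -scalemxAl mul_cols.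
  by have [] := cP j.
move=> v Kv; apply/matrixP => i j; rewrite ord1 [RHS]mxE.
apply: (find (fun i => v i 0)).
have c1 : forall i, aeC (fun t => w t *m c i = rC g2 *: f i t).
  by move=> l; have [] := cP l.
apply: aeC_imp (aeC_forall c1) => t _ ht.
have g0 : rC g2 != 0 by apply: contra_neq (hnorm_sqr_neq0 i) => /(congr1 (@complex.Re _)).
apply: (scalerI g0); rewrite scaler0 /lincomb scaler_sumr.
transitivity (w t *m (K *m v)); last by rewrite Kv mulmx0.
have -> : K *m v = \sum_i v i 0 *: c i.
  rewrite {1}[v]matrix_sum_delta mulmx_sumr; apply: eq_bigr => l _.
  by rewrite big_ord1 -scalemxAr mul_cols.
rewrite mulmx_sumr; apply: eq_bigr => l _.
by rewrite -scalemxAr ht !scalerA mulrC.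
Qed.

(** * Operators on X in coordinates *)

Definition represents (x : mfun R q 1) (c : 'cV[C]_n) := L2 x /\ aeq x (fun t => b t *m c).

Lemma represents_b c : represents (fun t => b t *m c) c.
Proof. by split=> //; exact: aeq_refl. Qed.
Lemma represents_inj x y c d : represents x c -> represents y d -> aeq x y -> c = d.
Proof.
move=> [_ xc] [_ yd] xy; apply: (orthonormal_inj Lb ob).
by apply: aeq_trans (aeq_sym xc) _; exact: aeq_trans xy yd.
Qed.
Lemma represents_aeq x y c : represents x c -> represents y c -> aeq x y.
Proof. by move=> [_ xc] [_ yc]; apply: aeq_trans xc _; exact: aeq_sym. Qed.
Lemma representsZ z x c : represents x c -> represents (fun t => z *: x t) (z *: c).
Proof.
move=> [Lx xc]; split; first exact: L2Z.
by apply: aeC_imp xc => t _ ->; rewrite scalemxAr.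
Qed.
Lemma representsB x y c d : represents x c -> represents y d ->
  represents (fun t => x t - y t) (c - d).
Proof.
move=> [Lx xc] [Ly yd]; split; first exact: L2B.
by apply: aeC_imp2 xc yd => t _ -> ->; rewrite mulmxBr.
Qed.
Lemma inner_represents x y c d : represents x c -> represents y d ->
  inner x y = cinner c d.
Proof. by move=> [Lx xc] [Ly yd]; rewrite (inner_aeq Lx (Lbc c) Ly (Lbc d) xc yd) ob. Qed.

(** A finite-dimensional range is closed: the orthogonal projection of x is at least as close to x
    as every H f, hence at distance 0. *)
Lemma Xsp_represents x : Xsp G x <-> exists c, represents x c.
Proof.
split=> [[Lx hx]|[c [Lx xc]]]; last first.
  split=> // e e0; have [_ _ /(_ c)[f Hf fc]] := bP; exists f; split=> //.
  have LD : L2 (fun t => x t - Hank G f t) by apply: L2B => //; exact: Hank_L2.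
  rewrite (l2norm_aeq LD (L2_zf _ _ _)) ?l2normE ?nrm2_zf ?sqrtr0//.
  by apply/aeqB0; apply: aeq_trans xc _; exact: aeq_sym.
exists (crd b x); split=> //; apply/aeqB0; apply: nrm2_eq0; first exact: L2B.
rewrite -sqr_l2norm; apply/eqP; rewrite expf_eq0 /=; apply/eqP/le_anti; rewrite l2norm_ge0 andbT; apply/ler_addgt0Pr => e e0; rewrite add0r.
have [f [Hf fe]] := hx e e0; have [d fd] := bX Hf; apply: le_trans (ltW fe).
rewrite !l2normE ler_wsqrtr//; apply: le_trans (nrm2_crd_le d Lb ob Lx) _.
have LH := Hank_L2 LG Hf.
rewrite (nrm2_aeq (L2B Lx (Lbc d)) (L2B Lx LH))//.
by apply: aeqB; [exact: aeq_refl|exact: aeq_sym].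
Qed.

Lemma represents_Zop x c : represents x c -> represents (Zop G x) (A *m c).
Proof.
move=> [Lx xc]; have LV := L2_Vmul Lx; split; first by have [[]] := PminusP LV.
by apply: aeq_trans (Vminus_b c); apply: Pminus_aeq => //; [exact: L2_Vmul|exact: aeqV].
Qed.

Lemma Wst_represents x c : represents x c ->
  H2 (Wst G x) /\ aeq (Wst G x) (fun t => w t *m c).
Proof.
move=> [Lx xc]; have wx u : H2 u -> inner (Hank G u) x = inner u (fun t => w t *m c).
  move=> Hu; have LH := Hank_L2 LG Hu.
  by rewrite (inner_aeq LH LH Lx (Lbc c) (aeq_refl _) xc) wE.
have [] : H2 (Wst G x) /\ (forall u, H2 u -> inner (Wop G u) x = inner u (Wst G x)).
  by apply: adjP; exists (fun t => w t *m c).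
move: (Wst G x) => y H Hx; have [L _] := H; split=> //.
apply/aeqB0; have Hd := H2B H (Hwc c); have [Ld _] := Hd.
apply: nrm2_eq0 => //; rewrite /nrm2 innerBr// -(wx _ Hd) (Hx _ Hd).
by rewrite subrr.
Qed.

Lemma represents_WWst x c : represents x c -> represents (Wop G (Wst G x)) (Q *m c).
Proof.
move=> /Wst_represents[HW Wc]; split; first exact: Hank_L2.
by apply: aeq_trans (Hank_w c); exact: Hank_aeq.
Qed.

Lemma represents_const u : represents (Wop G (Econst u)) (B *m u).
Proof. by split; [apply: Hank_L2 => //; exact: H2_cst|exact: Hank_const]. Qed.

Lemma represents_Zst x c : represents x c -> represents (Zst G x) (ctr A *m c).
Proof.
move=> xc; have ex : Xsp G (fun t => b t *m (ctr A *m c)) /\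
    forall u, Xsp G u -> inner (Zop G u) x = inner u (fun t => b t *m (ctr A *m c)).
  split; first by apply/Xsp_represents; exists (ctr A *m c); exact: represents_b.
  move=> u /Xsp_represents[d ud].
  rewrite (inner_represents (represents_Zop ud) xc) cinner_ctr.
  by rewrite (inner_represents ud (represents_b _)).
have [] : Xsp G (Zst G x) /\ (forall u, Xsp G u -> inner (Zop G u) x = inner u (Zst G x)).
  by apply: adjP; exists (fun t => b t *m (ctr A *m c)).
move: (Zst G x) => y /Xsp_represents[d yd] hd; suff -> : ctr A *m c = d by [].
(* The adjoint inside X is unique: its defining property is tested on b e, with e the difference of
   the two candidates. *)
apply/eqP; rewrite -subr_eq0; apply/eqP; apply: mxsq_eq0; set e := _ - _.
have Xe : Xsp G (fun t => b t *m e) by apply/Xsp_represents; exists e; exact: represents_b.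
have := hd _ Xe; rewrite [LHS](inner_represents (represents_Zop (represents_b e)) xc).
rewrite (inner_represents (represents_b e) yd) cinner_ctr => h.
have : cinner e e = 0.
  by rewrite {2}/e -[_ - d]addrC cinnerDr -scaleN1r cinnerZr h conjcN conjc1 mulN1r addNr.
by rewrite cinner_mxsq => /(congr1 (@complex.Re _)).
Qed.

Lemma represents_Delta x c : represents x c -> represents (Delta G x) (D *m c).
Proof.
move=> xc; rewrite /Dm mulmxBl mul_scalar_mx -!mulmxA; apply: representsB.
  exact: representsZ.
by apply: represents_Zop; apply: represents_WWst; exact: represents_Zst.
Qed.
Lemma represents_Xi x c : represents x c -> represents (Xi G x) (Xm Q g2 *m c).
Proof.
move=> xc; rewrite /Xm mulmxBl mul_scalar_mx; apply: representsB.
  exact: representsZ.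
exact: represents_WWst.
Qed.

Section represented_operator.
Variables (op : mfun R q 1 -> mfun R q 1) (T : 'M[C]_n).
Hypothesis opT : forall x c, represents x c -> represents (op x) (T *m c).
Hypothesis uT : T \in unitmx.

Lemma represents_opinv y d : represents y d ->
  represents (opinv (Xsp G) op y) (invmx T *m d).
Proof.
move=> yd; have xd := represents_b (invmx T *m d).
have ex : Xsp G (fun t => b t *m (invmx T *m d)) /\
    aeq (op (fun t => b t *m (invmx T *m d))) y.
  split; first by apply/Xsp_represents; exists (invmx T *m d).
  by have := opT xd; rewrite mulKVmx// => /represents_aeq; exact.
have [] : Xsp G (opinv (Xsp G) op y) /\ aeq (op (opinv (Xsp G) op y)) y.
  by apply: opinvP; exists (fun t => b t *m (invmx T *m d)).
move: (opinv _ _ _) => x /Xsp_represents[c xc] hx.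
by rewrite -(represents_inj (opT xc) yd hx) mulKmx.
Qed.
Lemma represented_invertible : invertible_on (Xsp G) op.
Proof.
split=> [y /Xsp_represents[d yd]|x /Xsp_represents[c xc] x0].
  exists (fun t => b t *m (invmx T *m d)); have xd := represents_b (invmx T *m d).
  split; first by apply/Xsp_represents; exists (invmx T *m d).
  by have := opT xd; rewrite mulKVmx// => /represents_aeq; exact.
have z0 : represents zf 0.
  by split; [exact: L2_zf|apply: aeC_all => t _; rewrite mulmx0].
apply: (represents_aeq xc); suff -> : c = 0 by [].
by rewrite -[c](mulKmx uT) (represents_inj (opT xc) z0 x0) mulmx0.
Qed.
End represented_operator.

(** Where the determinant of mu - T is nonzero, the matrix inverse provides an inverse on X. *)
Lemma represented_spec op (T : 'M[C]_n) mu :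
  (forall x c, represents x c -> represents (op x) (T *m c)) ->
  spec (Xsp G) op mu -> root (char_poly T) mu.
Proof.
move=> opT; apply: contra_notT; rewrite rootE char_poly_horner => dT.
apply: (represented_invertible (T := mu%:M - T)); last by rewrite unitmxE unitfE.
move=> x c xc; rewrite mulmxBl mul_scalar_mx; apply: representsB; last exact: opT.
exact: representsZ.
Qed.

Lemma represented_rspec op (T : 'M[C]_n) :
  (forall x c, represents x c -> represents (op x) (T *m c)) -> stable T ->
  rspec (Xsp G) op < 1.
Proof.
move=> opT sT; have [s sE hs] := stable_roots sT.
(* [rspec] is a supremum, so a strict bound needs one r < 1 valid for all of the finitely many
   roots. *)
have [r [r0 r1 hr]] : exists r : R, [/\ 0 <= r, r < 1 & forall z, z \in s -> cabs z <= r].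
  elim: s {sE} hs => [|z s IH] hs; first by exists 0; rewrite ltr01.
  have [z' zs|r [r0 r1 hr]] := IH; first by apply: hs; rewrite inE zs orbT.
  exists (Num.max r (cabs z)); rewrite le_max r0 gt_max r1; split=> //.
    by rewrite cabsE -sqrtr1 ltr_sqrt// hs// mem_head.
  move=> z'; rewrite inE => /orP[/eqP ->|/hr zr]; first by rewrite le_max lexx orbT.
  by rewrite le_max zr.
apply: le_lt_trans r1; rewrite /rspec.
have ub : forall x, (cabs @` spec (Xsp G) op) x -> x <= r.
  move=> _ [z /(represented_spec opT) zs <-]; apply: hr.
  by move: zs; rewrite sE root_prod_XsubC.
(* An empty spectrum gives the value 0 of [sup0]. *)
have [->|/set0P ne] := eqVneq (cabs @` spec (Xsp G) op) set0; first by rewrite sup0.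
exact: ge_sup.
Qed.

Variable K : 'M[C]_(n, p).
Hypothesis QK : Q *m K = rC g2 *: K.
Hypothesis Kinj : forall v : 'cV[C]_p, K *m v = 0 -> v = 0.

Local Notation T := (Tm A Q g2).
Local Notation Y := (Ym A B Q g2).
Let g20 : 0 <= g2. Proof. exact: sqr_ge0. Qed.
Let uD : D \in unitmx. Proof. apply: Dm_unit; exact: Dm_inj. Qed.
Let sT : stable T.
Proof. exact: Tm_stable g20 Q_herm Stein isometry A_stable Xm_psd Dm_inj. Qed.

Lemma represents_ZstDinvXi x c : represents x c ->
  represents (Zst G (Dinv G (Xi G x))) (T *m c).
Proof.
move=> xc; rewrite /Tm -!mulmxA; apply: represents_Zst.
by apply: (represents_opinv represents_Delta uD); exact: represents_Xi.
Qed.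
Lemma represents_ZstDinvW u :
  represents (Zst G (Dinv G (Wop G (Econst u)))) (ctr A *m Y *m u).
Proof.
rewrite /Ym -!mulmxA; apply: represents_Zst.
by apply: (represents_opinv represents_Delta uD); exact: represents_const.
Qed.
Lemma represents_chainN z u : nsq z <= 1 ->
  represents (chainN G z u) (X1 A B Q g2 z *m u).
Proof.
move=> z1; rewrite /X1 -mulmxA; apply: (represents_opinv (T := 1%:M - z *: ctr A)).
- move=> x c xc; rewrite mulmxBl mul1mx -scalemxAl; apply: representsB => //.
  by apply: representsZ; exact: represents_Zst.
- by apply: stable_ctr_unit => //; exact: A_stable.
- exact: represents_ZstDinvW.
Qed.
Lemma represents_chainMi z u : nsq z <= 1 ->
  represents (opinv (Xsp G) (fun x t => x t - z *: Zst G (Dinv G (Xi G x)) t)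
    (Zst G (Dinv G (Wop G (Econst u))))) (X2 A B Q g2 z *m u).
Proof.
move=> z1; rewrite /X2 -mulmxA; apply: (represents_opinv (T := 1%:M - z *: T)).
- move=> x c xc; rewrite mulmxBl mul1mx -scalemxAl; apply: representsB => //.
  by apply: representsZ; exact: represents_ZstDinvXi.
- exact: stable_unit.
- exact: represents_ZstDinvW.
Qed.
Lemma Estar_Wst x c : represents x c -> Estar (Wst G x) = ctr B *m c.
Proof.
move=> /Wst_represents[[LW _] Wc]; rewrite EstarE// (fc_aeq 0 LW (Lwc c) Wc).
by rewrite fc_mulmxr// w0E.
Qed.
Lemma Pi_Hank_Wst x c : represents x c -> Pi (Hank G (Wst G x)) = Cq *m (Q *m c).
Proof.
move=> /represents_WWst[LW Wc]; rewrite PiE (fc_aeq (-1) LW (Lbc (Q *m c)) Wc).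
by rewrite fc_mulmxr.
Qed.
Lemma Mfun_Mm z : nsq z <= 1 -> Mfun G z = Mm A B Q g2 z.
Proof.
move=> z1; congr (_ + _ *: _); apply: cols_ext => j.
by rewrite mul_cols (Estar_Wst (represents_chainN (unitv j) z1)) mulmxA.
Qed.
Lemma Minv_formula_Mi z : nsq z <= 1 -> Minv_formula G z = Mi A B Q g2 z.
Proof.
move=> z1; congr (_ - _ *: _); apply: cols_ext => j.
by rewrite mul_cols (Estar_Wst (represents_chainMi (unitv j) z1)) mulmxA.
Qed.
Lemma Nfun_E z : nsq z <= 1 -> Nfun G z = - (Cq *m Q *m X1 A B Q g2 z).
Proof.
move=> z1; congr (- _); apply: cols_ext => j.
by rewrite mul_cols (Pi_Hank_Wst (represents_chainN (unitv j) z1)) !mulmxA.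
Qed.
Lemma Mfun_inv z : nsq z <= 1 ->
  Mfun G z \in unitmx /\ invmx (Mfun G z) = Minv_formula G z.
Proof.
move=> z1; rewrite Mfun_Mm// Minv_formula_Mi//; split.
  exact: Mm_unit g20 Q_herm Stein isometry A_stable Xm_psd Dm_inj _ z1.
exact: invMm g20 Q_herm Stein isometry A_stable Xm_psd Dm_inj _ z1.
Qed.
Lemma Phiplus_E z : nsq z <= 1 -> Phiplus G z = - (Cq *m Q *m X2 A B Q g2 z).
Proof.
move=> z1; have [_ Mi1] := Mfun_inv z1.
have -> : Phiplus G z = Nfun G z *m Mi A B Q g2 z.
  by rewrite -(Minv_formula_Mi z1) -Mi1.
rewrite (Nfun_E z1) mulNmx.
have := X1Mi g20 Q_herm Stein isometry A_stable Xm_psd Dm_inj z1.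
by move: (X1 _ _ _ _ _) (X2 _ _ _ _ _) (Mi _ _ _ _ _) => x1 x2 mi <-; rewrite !mulmxA.
Qed.

(** Phi_+ = - C Q (1 - z T)^-1 A^* Y, a resolvent of the stable matrix T between constants. *)
Lemma Phiplus_HInf : HInf (fun t => Phiplus G (cexpi t)).
Proof.
have := resolv_HInf (- (Cq *m Q)) (ctr A *m Y) sT.
congr HInf; apply/funext => t; rewrite Phiplus_E ?nsq_cexpi//.
by rewrite !mulNmx -!mulmxA.
Qed.

(** * Optimality and uniqueness in the Nehari problem *)

Let phi t := Phi A B Cq Q g2 (cexpi t).

Lemma b_Rz : aeq b (fun t => Cq *m Rz A (cexpi t)).
Proof.
apply: aeC_imp (b_resolvent : aeC _) => t _ <-; rewrite mulmxK//.
by apply: stable_unit_sub; [exact: A_stable|rewrite nsq_cexpi].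
Qed.

Lemma Phi_split : aeq (fun t => b t *m B + Phiplus G (cexpi t)) phi.
Proof.
apply: aeC_imp (b_Rz : aeC _) => t _ ->; rewrite Phiplus_E ?nsq_cexpi// /phi.
by rewrite (PhiE g20 Q_herm Stein isometry A_stable Xm_psd Dm_inj QK Kinj) ?nsq_cexpi.
Qed.

Lemma mxnorm_Phi t : mxnorm (phi t) <= gamma.
Proof.
apply: mxnorm_le; first exact: hnorm_ge0.
move=> v; rewrite -qf_scalar.
rewrite -(Phi_gram g20 Q_herm Stein isometry A_stable Xm_psd Dm_inj QK Kinj (nsq_cexpi t)).
by have := qf_gram (ctr (phi t)) v; rewrite ctrK => ->.
Qed.

(** b B is G_-, so G - b B is the analytic part of G. *)
Definition nehari_solution t := G t - b t *m B - Phiplus G (cexpi t).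

Lemma error_Phi : aeq (fun t => G t - nehari_solution t) phi.
Proof.
apply: aeC_imp (Phi_split : aeC _) => t _ <-; rewrite /nehari_solution.
by rewrite -addrA -opprD subKr.
Qed.

(** Both terms are in H^2, but G_+ need not be bounded on its own; boundedness comes from G - F =
    Phi, of norm at most gamma. *)
Lemma nehari_solution_HInf : HInf nehari_solution.
Proof.
have LGf : L2 G by apply: ebdd_L2; exact: Linf_ebdd.
have [LN N0] : H2 nehari_solution := H2B BE (HInf_H2 Phiplus_HInf).
split; last exact: N0.
have bphi : ebdd (fun t => G t - nehari_solution t).
  split; first by have [] : L2 (fun t => G t - nehari_solution t) by exact: L2B.
  exists g2; split=> //; apply: aeC_imp (error_Phi : aeC _) => t _ -> i j.
  apply: le_trans (nsq_le_mxnorm _ _ _) _.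
  by rewrite ler_pXn2r ?nnegrE ?mxnorm_ge0 ?mxnorm_Phi//; exact: hnorm_ge0.
have := ebdd_Linf (ebddB (Linf_ebdd LG) bphi); congr Linf; apply/funext => t.
exact: subKr.
Qed.

Lemma hnorm_le_linf F : HInf F -> gamma <= linf_norm (fun t => G t - F t).
Proof.
move=> HF; apply: lb_le_inf.
  have [_ [M hM]] : Linf (fun t => G t - F t).
    by exact: (ebdd_Linf (ebddB (Linf_ebdd LG) (Linf_ebdd (proj1 HF)))).
  by exists M.
move=> M /= hM; have M0 := ae_mxnorm_bound_ge0 (hM : aeC _).
by apply: hnorm_le => // f Hf; exact: nrm2_Hank_sub hM Hf.
Qed.

Lemma linf_error : linf_norm (fun t => G t - nehari_solution t) <= gamma.
Proof.
apply: ge_inf; first by exists 0 => M /= hM; exact: ae_mxnorm_bound_ge0 hM.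
by apply: aeC_imp (error_Phi : aeC _) => t _ ->; exact: mxnorm_Phi.
Qed.

Lemma nehari_solution_optimal : nehari_optimal G nehari_solution.
Proof.
split; first exact: nehari_solution_HInf.
by move=> F HF; apply: le_trans linf_error _; exact: hnorm_le_linf.
Qed.

(** [linf_norm] is an infimum, so the estimate is made with c + e for each e > 0 and then e tends to
    0. *)
Lemma linf_norm_nrm2_le m k (M : mfun R m k) (c : R) f : Linf M -> linf_norm M <= c ->
  L2 f -> nrm2 (fun t => M t *m f t) <= c ^+ 2 * nrm2 f.
Proof.
move=> LM Mc Lf; have bM := Linf_ebdd LM; have [_ [M0 hM0]] := LM.
have c0 : 0 <= c.
  apply: le_trans Mc; apply: lb_le_inf; first by exists M0.
  by move=> e /= he; exact: ae_mxnorm_bound_ge0 he.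
have h e : 0 < e -> nrm2 (fun t => M t *m f t) <= (c + e) ^+ 2 * nrm2 f.
  move=> e0; have ce : inf [set M' | {ae (@lebesgue_measure R), forall t,
    circ t -> mxnorm (M t) <= M'}] < c + e by apply: le_lt_trans Mc _; rewrite ltrDl.
  have [M' hM' M'c] := inf_lt (ex_intro _ M0 hM0) ce.
  apply: nrm2_mul_le => //; first by rewrite addr_ge0// ltW.
  by apply: aeC_imp (hM' : aeC _) => t _ /le_trans; apply; exact: ltW.
rewrite -!sqr_l2norm -exprMn ler_pXn2r ?nnegrE ?mulr_ge0 ?l2norm_ge0//.
apply/ler_addgt0Pr => d d0; have y0 := l2norm_ge0 f.
have y1 : 0 < l2norm f + 1 by rewrite ltr_wpDl.
have := h (d / (l2norm f + 1)) (divr_gt0 d0 y1).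
rewrite -!sqr_l2norm -exprMn ler_pXn2r ?nnegrE ?mulr_ge0 ?addr_ge0 ?l2norm_ge0//; last first.
  by rewrite ltW// divr_gt0.
move/le_trans; apply; rewrite mulrDl lerD2l mulrAC ler_pdivrMr// ler_pM2l//.
by rewrite lerDl.
Qed.

Lemma nehari_optimal_linf F : nehari_optimal G F ->
  linf_norm (fun t => G t - F t) <= gamma.
Proof.
move=> [_ /(_ _ nehari_solution_HInf)]; move/le_trans; apply; exact: linf_error.
Qed.

(** Identifies the columns of M on the circle with elements W^* Y v of H^2, the maximizing vectors
    on which uniqueness is tested. *)
Lemma w_Y : aeq (fun t => w t *m Y) (fun t => Mm A B Q g2 (cexpi t)).
Proof.
apply: aeC_imp (w_shift : aeC _) => t _ e; have z1 : nsq (cexpi t) <= 1 by rewrite nsq_cexpi.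
rewrite (MmE Stein A_stable Dm_inj QK Kinj z1) -e -!mulmxA.
by rewrite [X in _ = w t *m X]mulmxA (S1V A_stable z1) mul1mx.
Qed.

(* [w Y v] is a maximizing vector, so the error of an optimal solution acts
   on it as the Hankel operator does. *)
Lemma optimal_error_w F (v : 'cV[C]_p) : nehari_optimal G F ->
  aeq (fun t => (G t - F t) *m (w t *m (Y *m v))) (fun t => rC g2 *: (b t *m (Y *m v))).
Proof.
move=> optF; have [HF _] := optF; have Hh := Hwc (Y *m v); have [Lh _] := Hh.
set h := fun t => w t *m (Y *m v).
have QYv : Q *m (Y *m v) = rC g2 *: (Y *m v).
  by rewrite mulmxA (QY Stein Dm_inj QK Kinj) -scalemxAl.
have LD : Linf (fun t => G t - F t).
  exact: (ebdd_Linf (ebddB (Linf_ebdd LG) (Linf_ebdd (proj1 HF)))).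
have LDh : L2 (fun t => (G t - F t) *m h t) by apply: L2_mul => //; exact: Linf_ebdd.
have LH := Hank_L2 LG Hh.
have HE : aeq (Hank G h) (fun t => rC g2 *: (b t *m (Y *m v))).
  have := Hank_w (Y *m v); rewrite QYv; apply: aeC_imp => t _ ->.
  by rewrite -scalemxAr.
(* r lies in H^2 and is orthogonal to H h, so Pythagoras gives |r|^2 + |H h|^2 <= gamma^2 |h|^2 = |H
   h|^2, whence r = 0. *)
pose r t := (G t - F t) *m h t - Hank G h t.
have Hr : H2 r.
  have -> : r = (fun t => (G t *m h t - Hank G h t) - F t *m h t).
    by apply/funext => t; rewrite /r mulmxBl addrAC.
  by apply: H2B; [exact: Hank_H2|exact: H2_HInf_mul].
have [Lr _] := Hr; apply: (aeq_trans (g := Hank G h)) (HE); apply/aeqB0; apply: nrm2_eq0 => //.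
have e : nrm2 (fun t => (G t - F t) *m h t) = nrm2 r + nrm2 (Hank G h).
  rewrite -(nrm2D_orth Lr LH (H2_K2_orth Hr (Hank_K2 LG Hh))); congr nrm2.
  by apply/funext => t; rewrite /r subrK.
have nH : nrm2 (Hank G h) = g2 * nrm2 h.
  rewrite (nrm2_aeq LH (L2Z _ (Lbc _)) HE) nrm2Z// nsq_rC orthonormal_nrm2//.
  by rewrite /nrm2 Q_gram QYv cinnerZl cinner_mxsq cRe_rCM mulrA -expr2.
have := linf_norm_nrm2_le LD (nehari_optimal_linf optF) Lh; rewrite e nH.
have := nrm2_ge0 r; rewrite gerDr => r0 r1; apply/eqP.
by rewrite eq_le r0 andbT.
Qed.

(** M is invertible at every point of the circle, so the values of G - F on its columns determine G
    - F. *)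
Lemma nehari_solution_unique F : nehari_optimal G F -> aeq F nehari_solution.
Proof.
move=> optF.
have h : aeq (fun t => (G t - F t) *m (w t *m Y)) (fun t => rC g2 *: (b t *m Y)).
  apply: aeq_cols => j; apply: aeC_imp (optimal_error_w (delta_mx j 0) optF : aeC _) => t _.
  by rewrite -scalemxAl -!mulmxA.
have h2 : aeC (fun t => (G t - F t) *m Mm A B Q g2 (cexpi t) =
    rC g2 *: (Cq *m Rz A (cexpi t) *m Y)).
  apply: aeC_imp2 (h : aeC _) (aeC_and (w_Y : aeC _) (b_Rz : aeC _)) => t _.
  by move=> e [e1 e2]; rewrite -e1 e e2.
apply: aeC_imp2 h2 (error_Phi : aeC _) => t _ e e'.
have z1 : nsq (cexpi t) = 1 by exact: nsq_cexpi.
have uM : Mm A B Q g2 (cexpi t) \in unitmx.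
  by apply: (Mm_unit g20 Q_herm Stein isometry A_stable Xm_psd Dm_inj); rewrite z1.
rewrite -(Phi_Mm g20 Q_herm Stein isometry A_stable Xm_psd Dm_inj z1) in e.
have {}e := congr1 (mulmx^~ (invmx (Mm A B Q g2 (cexpi t)))) e.
by move: e; rewrite /= !mulmxK// -/(phi t) -e' => /addrI/oppr_inj.
Qed.

(** The splitting into H^2 and K^2 is unique up to null sets, so every analytic part of G agrees
    with G - b B. *)
Lemma analytic_part_solution Gp : analytic_part G Gp ->
  aeq nehari_solution (fun t => Gp t - Phiplus G (cexpi t)).
Proof.
move=> [HGp KGp]; apply: aeqB; last exact: aeq_refl.
apply/aeqB0; apply: H2_K2_0; first exact: H2B.
have -> : (fun t => G t - b t *m B - Gp t) = (fun t => (G t - Gp t) - b t *m B).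
  by apply/funext => t; rewrite addrAC.
exact: K2B KGp (Kbc B).
Qed.

Lemma Delta_invertible : invertible_on (Xsp G) (Delta G).
Proof. exact: represented_invertible represents_Delta uD. Qed.
Lemma rspec_lt1 : rspec (Xsp G) (fun x => Zst G (Dinv G (Xi G x))) < 1.
Proof. exact: represented_rspec represents_ZstDinvXi sT. Qed.
End realization.

Theorem theorem5p1 (R : realType) (p q : nat) (G : R -> 'M[R[i]]_(q, p)) :
  Linf G ->
  (* (C1) *) finite_rank G ->
  (* (C2) *) (forall h, maxvec G h -> ~ SH2 h) ->
             span_dim (maxvec G) p ->
  invertible_on (Xsp G) (Delta G) /\
  (exists F : R -> 'M[R[i]]_(q, p),
      nehari_optimal G F /\
      (forall F', nehari_optimal G F' -> aeq F' F) /\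
      HInf (fun t => Phiplus G (cexpi t)) /\
      (forall Gp, analytic_part G Gp ->
         aeq F (fun t => Gp t - Phiplus G (cexpi t)))) /\
  rspec (Xsp G) (fun x => Zst G (Dinv G (Xi G x))) < 1 /\
  (forall lam : R[i], cabs lam <= 1 ->
     Mfun G lam \in unitmx /\ invmx (Mfun G lam) = Minv_formula G lam).
Proof.
move=> LG frG maxSH2 spanM.
have [n [b [bP bX]]] := range_onb_exists LG frG.
have [A AE] := shift_matrix LG bP bX.
(* Applied to the constant identity matrix, H gives the columns of G_-, whose coordinates form B. *)
have [B BE'] := range_matrix LG bP bX (H2_cst (1%:M : 'M[R[i]]_p)).
have BE : H2 (fun t => G t - b t *m B).
  by move: BE'; under eq_fun do rewrite mulmx1.
have [w Hw wE] := adjoint_matrix LG bP.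
have [Q QE] := range_matrix LG bP bX Hw.
have [K QK Kinj] := maxvec_matrix LG bP bX Hw wE QE maxSH2 spanM.
split; first by apply: Delta_invertible; eauto.
split; last first.
  split; first by apply: rspec_lt1; eauto.
  move=> lam lam1; apply: Mfun_inv; eauto.
  by rewrite -(sqr_sqrtr (nsq_ge0 lam)) -cabsE expr_le1// cabsE sqrtr_ge0.
exists (nehari_solution G b B); split.
  by apply: nehari_solution_optimal; eauto.
split; first by apply: nehari_solution_unique; eauto.
split; first by apply: Phiplus_HInf; eauto.
exact: (analytic_part_solution bP BE).
Qed.
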